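(* Let $k\in l_2(X)$ with $\check k\in L^\infty(G)$ and $|\check k|=1$ a.e. on $G$. Then: (i) $W_k$ is left invertible on $l_2(X_+)$ if and only if $\operatorname{dist}_{L^\infty}(\check k,H^\infty(G))<1$, and $W_k$ is right invertible if and only if $\operatorname{dist}_{L^\infty}(\overline{\check k},H^\infty(G))<1$; (ii) $W_k$ is invertible on $l_2(X_+)$ if and only if there exists an invertible element $\psi$ of $H^\infty(G)$ with $\|\check k-\psi\|_{L^\infty(G)}<1$.
   Context: $X$ is a discrete linearly ordered abelian group with positive cone $X_+$; $G$ is its compact dual group with normalized Haar measure. $\check k(x)=\sum_{\xi\in X}k(\xi)\xi(x)$; $W_kg=1_{X_+}(k\ast g)$ on $l_2(X_+)$. $H^\infty(G)=\{f\in L^\infty(G):\widehat f(\chi)=0\ \forall\chi\notin X_+\}$ with the $L^\infty$ norm, where $\widehat f(\xi)=\int_Gf(x)\overline{\xi(x)}dx$; $\operatorname{dist}_{L^\infty}(f,H^\infty(G))=\inf_{h\in H^\infty(G)}\|f-h\|_{L^\infty}$. *)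

(* Defs.v *)
From HB Require Import structures.
From mathcomp Require Import all_boot all_order all_algebra.
From mathcomp Require Import all_classical all_reals all_analysis.
From mathcomp Require Export complex.
From mathcomp Require Import ring.
From mathcomp Require Import ess_sup_inf.

Set Implicit Arguments.
Unset Strict Implicit.
Unset Printing Implicit Defensive.

Import Order.TTheory GRing.Theory Num.Theory.
Import numFieldNormedType.Exports.

Local Open Scope classical_set_scope.
Local Open Scope ring_scope.

(* Linearly ordered abelian group, given by its positive cone X_+ .    *)
(* P \/ -P = X.  (x <= y  iff  y - x \in P.)                           *)
Definition positive_cone (X : zmodType) (P : set X) : Prop :=
  [/\ (forall a b, P a -> P b -> P (a + b)),
      (forall a, P a -> P (- a) -> a = 0)
    & (forall a, P a \/ P (- a))].

Definition cabs (R : rcfType) (z : R[i]) : R :=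
  Num.sqrt (complex.Re z ^+ 2 + complex.Im z ^+ 2).

(* The dual group G of the discrete group X: all homomorphisms         *)
(* X -> T (unit circle).  For x : G and xi : X, xi(x) := dchar x xi.   *)
Record dual (X : zmodType) (R : rcfType) := Dual {
  dchar : X -> R[i];
  dchar_add : forall a b, dchar (a + b) = dchar a * dchar b;
  dchar_abs : forall a, cabs (dchar a) = 1 }.

Section DualGroup.
Variables (X : zmodType) (R : rcfType).

HB.instance Definition _ := gen_eqMixin (dual X R).
HB.instance Definition _ := gen_choiceMixin (dual X R).

Lemma cabs1 : cabs (1 : R[i]) = 1.
Proof. by rewrite /cabs /= expr1n expr0n /= addr0 sqrtr1. Qed.

Definition dual1 : dual X R :=
  @Dual X R (fun _ => 1) (fun _ _ => esym (mulr1 1)) (fun _ => cabs1).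

HB.instance Definition _ := isPointed.Build (dual X R) dual1.

Lemma cabsM (z w : R[i]) : cabs (z * w) = cabs z * cabs w.
Proof.
case: z => a b; case: w => c d; rewrite /cabs /= -sqrtrM ?addr_ge0 ?sqr_ge0 //.
congr Num.sqrt; rewrite !expr2; ring.
Qed.

Definition dmul (x y : dual X R) : dual X R.
Proof.
refine (@Dual X R (fun a => dchar x a * dchar y a) _ _).
- by move=> a b; rewrite !dchar_add mulrACA.
- by move=> a; rewrite cabsM !dchar_abs mulr1.
Defined.

End DualGroup.

Section DualGen.
Variables (X : zmodType) (R : realType).

(* sigma-algebra on G generated by the coordinate maps x |-> xi(x)
   (real and imaginary parts): the Baire sigma-algebra of the compact
   group G with its topology of pointwise convergence. *)
Definition dual_gen : set (set (dual X R)) :=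
  [set S | exists (a : X) (B : set R), measurable B /\
     (S = (fun x => complex.Re (dchar x a)) @^-1` B \/
      S = (fun x => complex.Im (dchar x a)) @^-1` B)].

End DualGen.

Definition Gm (X : zmodType) (R : realType) := g_sigma_algebraType (@dual_gen X R).

Section Analysis.
Variables (X : zmodType) (R : realType).
Local Notation G := (Gm X R).
Local Notation C := (R[i]).

Definition haar (mu : probability G R) : Prop :=
  forall (y : dual X R) (A : set G), measurable A ->
    mu ((fun x : G => (dmul x y : G)) @^-1` A) = mu A.

Definition cmeasurable (f : G -> C) : Prop :=
  measurable_fun setT (fun x => complex.Re (f x)) /\
  measurable_fun setT (fun x => complex.Im (f x)).

Definition cint (mu : probability G R) (f : G -> C) : C :=
  Complex (Rintegral mu setT (fun x => complex.Re (f x)))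
          (Rintegral mu setT (fun x => complex.Im (f x))).

Definition fourier (mu : probability G R) (f : G -> C) (xi : X) : C :=
  cint mu (fun x => f x * conjc (dchar x xi)).

Definition Linf_norm (mu : probability G R) (f : G -> C) : \bar R :=
  ess_sup mu (fun x => (cabs (f x))%:E).

Definition Hinf (mu : probability G R) (P : set X) (f : G -> C) : Prop :=
  [/\ cmeasurable f, (Linf_norm mu f < +oo)%E
    & forall xi, ~ P xi -> fourier mu f xi = 0].

Definition dist_Hinf (mu : probability G R) (P : set X) (f : G -> C) : \bar R :=
  ereal_inf [set Linf_norm mu (fun x => f x - h x) | h in Hinf mu P].

Definition Hinf_invertible (mu : probability G R) (P : set X) (psi : G -> C) :=
  Hinf mu P psi /\
  exists phi, Hinf mu P phi /\ (\forall x \ae mu, psi x * phi x = 1).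

Definition l2sq (g : X -> C) : \bar R :=
  (\esum_(a in setT) ((cabs (g a)) ^+ 2)%:E)%E.

Definition l2plus (P : set X) (g : X -> C) : Prop :=
  (forall a, ~ P a -> g a = 0) /\ (l2sq g < +oo)%E.

(* sum of an (absolutely summable) real / complex family over X *)
Definition rsum (u : X -> R) : R :=
  fine (\esum_(a in setT) (Num.max (u a) 0)%:E)%E -
  fine (\esum_(a in setT) (Num.max (- u a) 0)%:E)%E.

Definition csum (f : X -> C) : C :=
  Complex (rsum (fun a => complex.Re (f a))) (rsum (fun a => complex.Im (f a))).

Definition convol (k g : X -> C) (xi : X) : C :=
  csum (fun eta => k (xi - eta) * g eta).

Definition Wk (P : set X) (k : X -> C) (g : X -> C) : X -> C :=
  fun xi => if `[< P xi >] then convol k g xi else 0.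

Definition bounded_op (P : set X) (T : (X -> C) -> (X -> C)) : Prop :=
  [/\ (forall g, l2plus P g -> l2plus P (T g)),
      (forall (c : C) g h, l2plus P g -> l2plus P h ->
          T (fun a => c * g a + h a) = (fun a => c * T g a + T h a))
    & exists M : R, forall g, l2plus P g -> (l2sq (T g) <= M%:E * l2sq g)%E].

Definition left_invertible (P : set X) (A : (X -> C) -> (X -> C)) : Prop :=
  bounded_op P A /\
  exists L, bounded_op P L /\ forall g, l2plus P g -> L (A g) = g.

Definition right_invertible (P : set X) (A : (X -> C) -> (X -> C)) : Prop :=
  bounded_op P A /\
  exists B, bounded_op P B /\ forall g, l2plus P g -> A (B g) = g.

Definition invertible_op (P : set X) (A : (X -> C) -> (X -> C)) : Prop :=
  bounded_op P A /\
  exists B, [/\ bounded_op P B,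
               (forall g, l2plus P g -> B (A g) = g)
             & (forall g, l2plus P g -> A (B g) = g)].

End Analysis.

(* Main.v *)
Require Import Defs.
From HB Require Import structures.
From mathcomp Require Import all_boot all_order all_algebra.
From mathcomp Require Import all_classical all_reals all_analysis.
From mathcomp Require Import complex ess_sup_inf measurable_realfun ring lra.

Set Implicit Arguments.
Unset Strict Implicit.
Unset Printing Implicit Defensive.

Import Order.TTheory GRing.Theory Num.Theory.
Import numFieldNormedType.Exports.
Local Open Scope classical_set_scope.
Local Open Scope ring_scope.

(* Let phi = \check k, so that W_k is the Toeplitz operator T_phi on H^2 in the basis
   of characters.  As |phi| = 1, |f|^2 = |T_phi f|^2 + |H_phi f|^2 for f in H^2, where
   H_phi is the Hankel operator: T_phi is bounded below iff |H_phi| < 1.  That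
   |H_phi| bounds dist(phi, H^oo) is a Nehari theorem, for which one needs to factor
   analytic polynomials p without constant term.  Since X = X_+ \cup -X_+, every real
   trigonometric polynomial is the real part of an analytic one; truncating the
   logarithmic series thus gives an analytic polynomial u with 2 Re u uniformly close
   to a regularization of ln |p|, up to a constant.  With a, b truncations of exp u and
   exp (- u), p is close to a (p b), and |a|^2 and |p b|^2 are close to |p|.  Hence
   p |-> \int phi p has norm at most |H_phi| for the L^1 norm; by Riesz-Fischer its
   Hahn-Banach extension to the trigonometric polynomials is integration against some
   v with |v| <= |H_phi|, and phi - v is in H^oo.

   Conversely, if |phi - h| <= c < 1 with h in H^oo, then |1 - conj(h) phi| <= c, so
   T_(conj(h) phi) = T_(conj h) T_phi is invertible by a Neumann series.  The other
   implications follow by conjugation and from T_(phi h) = T_phi T_h.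

   The Fourier transform is injective on L^1(G) because the bounded functions u such
   that u f has null coefficients whenever f has form an algebra stable under bounded
   pointwise limits; iterating q |-> q (3 - q^2) / 2 puts the indicators of the sets
   {u > r} in it, hence those of all measurable sets. *)

Section Modulus.
Variable R : rcfType.
Implicit Types (z w : R[i]) (c r t : R).

Lemma cabs_normc z : cabs z = ComplexField.Normc.normc z.
Proof. by case: z. Qed.

Lemma cabs_ge0 z : 0 <= cabs z. Proof. exact: sqrtr_ge0. Qed.

Lemma sqr_cabs z : cabs z ^+ 2 = complex.Re z ^+ 2 + complex.Im z ^+ 2.
Proof. by rewrite sqr_sqrtr// addr_ge0// sqr_ge0. Qed.

Lemma cabs0 : cabs (0 : R[i]) = 0.
Proof. by rewrite /cabs /= expr0n addr0 sqrtr0. Qed.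

Lemma cabsD z w : cabs (z + w) <= cabs z + cabs w.
Proof. by rewrite !cabs_normc; exact: le_normcD. Qed.

Lemma cabsN z : cabs (- z) = cabs z.
Proof. by case: z => a b; rewrite /cabs /= !sqrrN. Qed.

Lemma cabs_conj z : cabs (conjc z) = cabs z.
Proof. by case: z => a b; rewrite /cabs /= sqrrN. Qed.

Lemma cabs0_eq0 z : cabs z = 0 -> z = 0.
Proof. by rewrite cabs_normc; exact: ComplexField.Normc.eq0_normc. Qed.

Lemma cabs_eq0 z : (cabs z == 0) = (z == 0).
Proof. by apply/eqP/eqP => [/cabs0_eq0//|->]; rewrite cabs0. Qed.

Lemma cabsX z n : cabs (z ^+ n) = cabs z ^+ n.
Proof.
by elim: n => [|n IH]; rewrite ?expr0 ?cabs1// !exprS cabsM IH.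
Qed.

Lemma cabsR c : cabs (c%:C%C) = `|c|.
Proof. by rewrite /cabs /= expr0n addr0 sqrtr_sqr. Qed.

Lemma cabsV z : cabs z^-1 = (cabs z)^-1.
Proof.
have [->|z0] := eqVneq z 0; first by rewrite invr0 cabs0 invr0.
apply: (mulfI (x := cabs z)); first by rewrite cabs_eq0.
by rewrite -cabsM divff// cabs1 divff// cabs_eq0.
Qed.

Lemma Re_le_cabs z : `|complex.Re z| <= cabs z.
Proof. by rewrite -sqrtr_sqr ler_sqrt ?addr_ge0 ?sqr_ge0// lerDl sqr_ge0. Qed.

Lemma Im_le_cabs z : `|complex.Im z| <= cabs z.
Proof. by rewrite -sqrtr_sqr ler_sqrt ?addr_ge0 ?sqr_ge0// lerDr sqr_ge0. Qed.

Lemma mul_conjc z : z * conjc z = (cabs z ^+ 2)%:C%C.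
Proof.
rewrite sqr_cabs; case: z => a b /=; apply/eqP; rewrite eq_complex /=.
by apply/andP; split; apply/eqP; ring.
Qed.

Lemma conjc_mul1 z : cabs z = 1 -> conjc z * z = 1.
Proof. by move=> h; rewrite mulrC mul_conjc h expr1n. Qed.

Lemma cabsDsqr z w : cabs (z + w) ^+ 2 =
  cabs z ^+ 2 + cabs w ^+ 2 + 2 * complex.Re (z * conjc w).
Proof. by rewrite !sqr_cabs; case: z w => a b [c d] /=; ring. Qed.

Lemma creD z w : complex.Re (z + w) = complex.Re z + complex.Re w.
Proof. by case: z w => a b []. Qed.
Lemma cimD z w : complex.Im (z + w) = complex.Im z + complex.Im w.
Proof. by case: z w => a b []. Qed.
Lemma creN z : complex.Re (- z) = - complex.Re z. Proof. by case: z. Qed.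
Lemma cimN z : complex.Im (- z) = - complex.Im z. Proof. by case: z. Qed.
Lemma creM z w : complex.Re (z * w) =
  complex.Re z * complex.Re w - complex.Im z * complex.Im w.
Proof. by case: z w => a b []. Qed.
Lemma cimM z w : complex.Im (z * w) =
  complex.Re z * complex.Im w + complex.Im z * complex.Re w.
Proof. by case: z w => a b [c d] /=. Qed.
Lemma creJ z : complex.Re (conjc z) = complex.Re z. Proof. by case: z. Qed.
Lemma cimJ z : complex.Im (conjc z) = - complex.Im z. Proof. by case: z. Qed.

Lemma complex_ext z w :
  complex.Re z = complex.Re w -> complex.Im z = complex.Im w -> z = w.
Proof. by case: z w => a b [c d] /= -> ->. Qed.

Lemma rotate_to_cabs z : exists2 w, cabs w = 1 & w * z = (cabs z)%:C%C.
Proof.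
have [->|z0] := eqVneq z 0; first by exists 1; rewrite ?cabs1// mul1r cabs0.
have cz : cabs z != 0 by rewrite cabs_eq0.
exists (conjc z * ((cabs z)^-1)%:C%C).
  by rewrite cabsM cabs_conj cabsR ger0_norm ?invr_ge0 ?cabs_ge0// divff.
by rewrite mulrAC [_ * z]mulrC mul_conjc -rmorphM /= expr2 mulfK.
Qed.

End Modulus.

Section RealAux.
Variable R : rcfType.
Implicit Types (a b x t : R).

Lemma sqr_le_of_amgm a b x : 0 <= x -> 0 <= a -> 0 <= b ->
  (forall t, 0 < t -> 2 * x <= t * a + t^-1 * b) -> x ^+ 2 <= a * b.
Proof.
move=> x0 a0 b0 H.
have [->|xn] := eqVneq x 0; first by rewrite expr0n mulr_ge0.
have xp : 0 < x by rewrite lt_neqAle eq_sym xn.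
have [az|an] := eqVneq a 0.
  have := H ((b + 1) / x); rewrite divr_gt0//; last by lra.
  move=> /(_ isT); rewrite az mulr0 add0r invf_div.
  have : x / (b + 1) * b <= x.
    by rewrite mulrAC ler_pdivrMr; last lra; rewrite ler_pM2l//; lra.
  lra.
have ap : 0 < a by rewrite lt_neqAle eq_sym an.
have := H (x / a); rewrite divr_gt0// => /(_ isT).
rewrite divfK// invf_div => h.
have {h} : x <= a / x * b by lra.
by rewrite mulrAC ler_pdivlMr// expr2.
Qed.

End RealAux.

(** * Integrable and square integrable functions on the dual group *)

Section RealIntegrals.
Variables (X : zmodType) (R : realType) (mu : probability (Gm X R) R).
Local Notation G := (Gm X R).
Implicit Types (f g : G -> R).

Definition rintegrable f : Prop := mu.-integrable setT (EFin \o f).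
Definition rintegral f : R := Rintegral mu setT f.

Lemma rintegrable_meas f : rintegrable f -> measurable_fun setT f.
Proof. by case/integrableP => /measurable_EFinP. Qed.

Lemma rintegrableD f g : rintegrable f -> rintegrable g -> rintegrable (fun x => f x + g x).
Proof. by move=> hf hg; apply: integrableD hf hg. Qed.

Lemma rintegrableZ c f : rintegrable f -> rintegrable (fun x => c * f x).
Proof. by move=> hf; apply: integrableZl hf. Qed.

Lemma rintegrableN f : rintegrable f -> rintegrable (fun x => - f x).
Proof. by move=> hf; apply: integrableN hf. Qed.

Lemma rintegrableB f g : rintegrable f -> rintegrable g -> rintegrable (fun x => f x - g x).
Proof. by move=> hf hg; apply: rintegrableD => //; exact: rintegrableN. Qed.

Lemma rintegrable_cst c : rintegrable (fun=> c).
Proof. exact: finite_measure_integrable_cst. Qed.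

Lemma rintegrable_le f g : measurable_fun setT f -> rintegrable g ->
  (forall x, `|f x| <= g x) -> rintegrable f.
Proof.
move=> mf ig fg; apply: le_integrable ig => //; first exact/measurable_EFinP.
by move=> x _ /=; rewrite lee_fin (le_trans (fg x))// ler_norm.
Qed.

Lemma rintegrable_norm f : rintegrable f -> rintegrable (fun x => `|f x|).
Proof. exact: integrable_norm. Qed.

Lemma rintegrable_ae_le f g : measurable_fun setT f -> rintegrable g ->
  (\forall x \ae mu, `|f x| <= g x) -> rintegrable f.
Proof.
move=> mf ig fg; apply/integrableP; split; first exact/measurable_EFinP.
have /integrableP[mg] := rintegrable_norm ig; apply: le_lt_trans.
apply: ae_ge0_le_integral => //.
- by apply: measurableT_comp => //; exact/measurable_EFinP.
- by apply: measurableT_comp.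
- apply: filterS fg => x h _; rewrite /= lee_fin normr_id.
  by rewrite (le_trans h)// ler_norm.
Qed.

Lemma eq_rintegral f g : f =1 g -> rintegral f = rintegral g.
Proof. by move=> /funext ->. Qed.

Lemma rintegral_EFin f : rintegrable f -> (rintegral f)%:E = (\int[mu]_x (f x)%:E)%E.
Proof. by move=> hf; rewrite fineK//; exact: integrable_fin_num. Qed.

Lemma rintegralD f g : rintegrable f -> rintegrable g ->
  rintegral (fun x => f x + g x) = rintegral f + rintegral g.
Proof. by move=> hf hg; rewrite /rintegral RintegralD. Qed.

Lemma rintegralZ c f : rintegrable f -> rintegral (fun x => c * f x) = c * rintegral f.
Proof. by move=> hf; rewrite /rintegral RintegralZl. Qed.

Lemma rintegralN f : rintegrable f -> rintegral (fun x => - f x) = - rintegral f.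
Proof.
move=> hf; rewrite -[RHS]mulN1r -rintegralZ//; congr rintegral.
by apply/funext => x; rewrite mulN1r.
Qed.

Lemma rintegralB f g : rintegrable f -> rintegrable g ->
  rintegral (fun x => f x - g x) = rintegral f - rintegral g.
Proof. by move=> hf hg; rewrite rintegralD ?rintegralN//; exact: rintegrableN. Qed.

Lemma rintegral_cst c : rintegral (fun=> c) = c.
Proof.
rewrite /rintegral Rintegral_cst//.
by rewrite [X in c * fine X](_ : _ = 1%E) ?mulr1//; exact: probability_setT.
Qed.

Lemma rintegral_ge0 f : (forall x, 0 <= f x) -> 0 <= rintegral f.
Proof. by move=> h; apply: Rintegral_ge0. Qed.

Lemma rintegral_ae f g : measurable_fun setT f -> measurable_fun setT g ->
  (\forall x \ae mu, f x = g x) -> rintegral f = rintegral g.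
Proof.
move=> mf mg fg; congr fine; apply: ae_eq_integral => //.
- exact/measurable_EFinP.
- exact/measurable_EFinP.
- by apply: filterS fg => x h _; rewrite h.
Qed.

Lemma le_rintegral f g : rintegrable f -> rintegrable g ->
  (forall x, f x <= g x) -> rintegral f <= rintegral g.
Proof. by move=> hf hg h; apply: le_Rintegral. Qed.

Lemma rintegrable_ae_eq f g : measurable_fun setT f -> rintegrable g ->
  (\forall x \ae mu, f x = g x) -> rintegrable f.
Proof.
move=> mf ig fg; apply: (rintegrable_ae_le mf (rintegrable_norm ig)).
by apply: filterS fg => x ->.
Qed.

Lemma ae_le_rintegral f g : rintegrable f -> rintegrable g -> (\forall x \ae mu, f x <= g x) ->
  rintegral f <= rintegral g.
Proof.
move=> hf hg fg; have mf := rintegrable_meas hf; have mg := rintegrable_meas hg.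
have mm : measurable_fun setT (fun x => Num.max (f x) (g x)).
  exact: measurable_maxr.
have e : \forall x \ae mu, Num.max (f x) (g x) = g x.
  by apply: filterS fg => x h; apply/max_idPr.
rewrite -(rintegral_ae mm mg e); apply: le_rintegral => //.
  exact: rintegrable_ae_eq mm hg e.
by move=> x; rewrite le_max lexx.
Qed.

End RealIntegrals.

Section ComplexIntegrals.
Variables (X : zmodType) (R : realType) (mu : probability (Gm X R) R).
Local Notation G := (Gm X R).
Local Notation C := (R[i]).
Implicit Types (f g h : G -> C).
Local Notation rintegrable := (rintegrable mu).
Local Notation rintegral := (rintegral mu).
Local Notation cint := (cint mu).

Lemma Re_cint f : complex.Re (cint f) = rintegral (fun x => complex.Re (f x)).
Proof. by []. Qed.

Lemma Im_cint f : complex.Im (cint f) = rintegral (fun x => complex.Im (f x)).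
Proof. by []. Qed.

Lemma cmeas_cst c : cmeasurable (fun _ : G => c).
Proof. by split; exact: measurable_cst. Qed.

Lemma cmeasD f g : cmeasurable f -> cmeasurable g ->
  cmeasurable (fun x => f x + g x).
Proof.
move=> [f1 f2] [g1 g2]; split.
  under eq_fun do rewrite creD; exact: measurable_funD.
under eq_fun do rewrite cimD; exact: measurable_funD.
Qed.

Lemma cmeasM f g : cmeasurable f -> cmeasurable g ->
  cmeasurable (fun x => f x * g x).
Proof.
move=> [f1 f2] [g1 g2]; split.
  by under eq_fun do rewrite creM; apply: measurable_funB; exact: measurable_funM.
by under eq_fun do rewrite cimM; apply: measurable_funD; exact: measurable_funM.
Qed.

Lemma cmeasN f : cmeasurable f -> cmeasurable (fun x => - f x).
Proof.
move=> [f1 f2]; split.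
  under eq_fun do rewrite creN; exact: measurable_funN.
under eq_fun do rewrite cimN; exact: measurable_funN.
Qed.

Lemma cmeasB f g : cmeasurable f -> cmeasurable g ->
  cmeasurable (fun x => f x - g x).
Proof. by move=> hf hg; apply: cmeasD => //; exact: cmeasN. Qed.

Lemma cmeasJ f : cmeasurable f -> cmeasurable (fun x => conjc (f x)).
Proof.
move=> [f1 f2]; split; first by under eq_fun do rewrite creJ.
under eq_fun do rewrite cimJ; exact: measurable_funN.
Qed.

Lemma cmeasR (u : G -> R) : measurable_fun setT u -> cmeasurable (fun x => (u x)%:C%C).
Proof. by move=> hu; split => //=; exact: measurable_cst. Qed.

Lemma cmeas_sqr_cabs f : cmeasurable f ->
  measurable_fun setT (fun x => cabs (f x) ^+ 2).
Proof.
move=> [f1 f2]; under eq_fun do rewrite sqr_cabs.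
by apply: measurable_funD; exact: measurable_funX.
Qed.

Lemma cmeas_cabs f : cmeasurable f -> measurable_fun setT (fun x => cabs (f x)).
Proof.
move=> mf.
have -> : (fun x => cabs (f x)) = Num.sqrt \o (fun x => cabs (f x) ^+ 2).
  by apply/funext => x /=; rewrite sqrtr_sqr ger0_norm// cabs_ge0.
apply: measurableT_comp (cmeas_sqr_cabs mf).
by apply: continuous_measurable_fun; exact: sqrt_continuous.
Qed.

Lemma cmeas_dchar (a : X) : cmeasurable (fun x : G => dchar x a).
Proof.
split => _ Y mY; rewrite setTI; apply: sub_sigma_algebra; exists a, Y.
  by split => //; left.
by split => //; right.
Qed.

Definition cL1 f := cmeasurable f /\ rintegrable (fun x => cabs (f x)).

Lemma cL1_Re f : cL1 f -> rintegrable (fun x => complex.Re (f x)).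
Proof. by move=> [[m1 m2] i]; apply: rintegrable_le i _ => // x; exact: Re_le_cabs. Qed.

Lemma cL1_Im f : cL1 f -> rintegrable (fun x => complex.Im (f x)).
Proof. by move=> [[m1 m2] i]; apply: rintegrable_le i _ => // x; exact: Im_le_cabs. Qed.

Lemma cL1_ae_le f (g : G -> R) : cmeasurable f -> rintegrable g ->
  (\forall x \ae mu, cabs (f x) <= g x) -> cL1 f.
Proof.
move=> mf ig h; split => //; apply: rintegrable_ae_le (cmeas_cabs mf) ig _.
by apply: filterS h => x; rewrite ger0_norm ?cabs_ge0.
Qed.

Lemma cL1_le f (g : G -> R) : cmeasurable f -> rintegrable g ->
  (forall x, cabs (f x) <= g x) -> cL1 f.
Proof. by move=> mf ig h; apply: cL1_ae_le mf ig _; exact: aeW. Qed.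

Lemma cL1D f g : cL1 f -> cL1 g -> cL1 (fun x => f x + g x).
Proof.
move=> [mf jf] [mg jg]; apply: cL1_le (rintegrableD jf jg) _; first exact: cmeasD.
by move=> x; exact: cabsD.
Qed.

Lemma cL1Z c f : cL1 f -> cL1 (fun x => c * f x).
Proof.
move=> [mf jf]; apply: cL1_le (rintegrableZ (cabs c) jf) _.
  by apply: cmeasM => //; exact: cmeas_cst.
by move=> x; rewrite cabsM.
Qed.

Lemma cL1N f : cL1 f -> cL1 (fun x => - f x).
Proof.
move=> /(cL1Z (-1)); rewrite (_ : (fun x => -1 * f x) = (fun x => - f x))//.
by apply/funext => x; rewrite mulN1r.
Qed.

Lemma cL1B f g : cL1 f -> cL1 g -> cL1 (fun x => f x - g x).
Proof. by move=> hf hg; apply: cL1D => //; exact: cL1N. Qed.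

Lemma cintD f g : cL1 f -> cL1 g -> cint (fun x => f x + g x) = cint f + cint g.
Proof.
move=> hf hg; have rf := cL1_Re hf; have jf := cL1_Im hf.
have rg := cL1_Re hg; have jg := cL1_Im hg.
apply: complex_ext; rewrite ?creD ?cimD ?Re_cint ?Im_cint -rintegralD//;
  by apply: eq_rintegral => x; rewrite ?creD ?cimD.
Qed.

Lemma cintZ c f : cL1 f -> cint (fun x => c * f x) = c * cint f.
Proof.
move=> hf; have rf := cL1_Re hf; have jf := cL1_Im hf.
apply: complex_ext; rewrite ?creM ?cimM !Re_cint !Im_cint -!rintegralZ//.
- rewrite -rintegralB; [|exact: rintegrableZ..].
  by apply: eq_rintegral => x; rewrite creM.
- rewrite -rintegralD; [|exact: rintegrableZ..].
  by apply: eq_rintegral => x; rewrite cimM.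
Qed.

Lemma cintN f : cL1 f -> cint (fun x => - f x) = - cint f.
Proof.
move=> hf; rewrite -mulN1r -cintZ//; congr cint.
by apply/funext => x; rewrite mulN1r.
Qed.

Lemma cintB f g : cL1 f -> cL1 g -> cint (fun x => f x - g x) = cint f - cint g.
Proof. by move=> hf hg; rewrite cintD ?cintN//; exact: cL1N. Qed.

Lemma cintJ f : cL1 f -> cint (fun x => conjc (f x)) = conjc (cint f).
Proof.
move=> hf; have jf := cL1_Im hf.
apply: complex_ext; rewrite ?creJ ?cimJ ?Re_cint ?Im_cint -?rintegralN//;
  by apply: eq_rintegral => x; rewrite ?creJ ?cimJ.
Qed.

Lemma cint_ae f g : cmeasurable f -> cmeasurable g ->
  (\forall x \ae mu, f x = g x) -> cint f = cint g.
Proof.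
move=> [f1 f2] [g1 g2] h; congr Complex; apply: rintegral_ae => //;
  by apply: filterS h => x ->.
Qed.

Lemma cint_cst c : cint (fun=> c) = c.
Proof. by apply: complex_ext; rewrite ?Re_cint ?Im_cint rintegral_cst. Qed.

Lemma cabs_cint f : cL1 f -> cabs (cint f) <= rintegral (fun x => cabs (f x)).
Proof.
move=> hf; have [w w1 wE] := rotate_to_cabs (cint f).
have -> : cabs (cint f) = rintegral (fun x => complex.Re (w * f x)).
  by have := cintZ w hf; rewrite wE => -[].
apply: le_rintegral; [exact: cL1_Re (cL1Z w hf)|exact: hf.2|move=> x].
by rewrite (le_trans (ler_norm _))// (le_trans (Re_le_cabs _))// cabsM w1 mul1r.
Qed.

End ComplexIntegrals.

Section L2Space.
Variables (X : zmodType) (R : realType) (mu : probability (Gm X R) R).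
Local Notation G := (Gm X R).
Local Notation C := (R[i]).
Implicit Types (f g h F : G -> C).
Local Notation rintegrable := (rintegrable mu).
Local Notation rintegral := (rintegral mu).
Local Notation cint := (cint mu).
Local Notation cL1 := (cL1 mu).
Local Notation fourier := (fourier mu).

Definition L2 f := cmeasurable f /\ rintegrable (fun x => cabs (f x) ^+ 2).
Definition sqnorm f : R := rintegral (fun x => cabs (f x) ^+ 2).
Definition inner f g : C := cint (fun x => f x * conjc (g x)).
Definition essbd F (M : R) :=
  cmeasurable F /\ \forall x \ae mu, cabs (F x) <= M.

Lemma sqnorm_ge0 f : 0 <= sqnorm f.
Proof. by apply: rintegral_ge0 => x; exact: sqr_ge0. Qed.

Lemma L2_ae_le f (g : G -> R) : cmeasurable f -> rintegrable g ->
  (\forall x \ae mu, cabs (f x) ^+ 2 <= g x) -> L2 f.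
Proof.
move=> mf ig h; split => //; apply: rintegrable_ae_le ig _; first exact: cmeas_sqr_cabs.
by apply: filterS h => x; rewrite ger0_norm ?sqr_ge0.
Qed.

Lemma L2_le f (g : G -> R) : cmeasurable f -> rintegrable g ->
  (forall x, cabs (f x) ^+ 2 <= g x) -> L2 f.
Proof. by move=> mf ig h; apply: L2_ae_le mf ig _; exact: aeW. Qed.

Lemma cabs_mul_le (z w : C) : cabs z * cabs w <= cabs z ^+ 2 + cabs w ^+ 2.
Proof.
have := sqr_ge0 (cabs z - cabs w); have := cabs_ge0 z; have := cabs_ge0 w.
by move: (cabs z) (cabs w) => a b; nra.
Qed.

Lemma L2M f g : L2 f -> L2 g -> cL1 (fun x => f x * g x).
Proof.
move=> [mf jf] [mg jg]; apply: cL1_le (rintegrableD jf jg) _; first exact: cmeasM.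
by move=> x; rewrite cabsM cabs_mul_le.
Qed.

Lemma L2J f : L2 f -> L2 (fun x => conjc (f x)).
Proof.
move=> [mf jf]; split; first exact: cmeasJ.
by under eq_fun do rewrite cabs_conj.
Qed.

Lemma inner_cL1 f g : L2 f -> L2 g -> cL1 (fun x => f x * conjc (g x)).
Proof. by move=> hf hg; apply: L2M => //; exact: L2J. Qed.

Lemma sqnorm_J f : sqnorm (fun x => conjc (f x)) = sqnorm f.
Proof. by apply: eq_rintegral => x; rewrite cabs_conj. Qed.

Lemma L2_essbdM F M f : essbd F M -> L2 f -> L2 (fun x => F x * f x).
Proof.
move=> [mF hF] [mf jf]; apply: L2_ae_le (rintegrableZ (M ^+ 2) jf) _.
  exact: cmeasM.
apply: filterS hF => x h; rewrite cabsM exprMn ler_wpM2r ?sqr_ge0//.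
by rewrite lerXn2r ?nnegrE ?cabs_ge0// (le_trans (cabs_ge0 _) h).
Qed.

Lemma sqnorm_essbdM F M f : essbd F M -> L2 f -> sqnorm (fun x => F x * f x) <= M ^+ 2 * sqnorm f.
Proof.
move=> bF hf; have [_ jFf] := L2_essbdM bF hf; have [mF hF] := bF.
have [_ jf] := hf.
rewrite -rintegralZ//; apply: ae_le_rintegral => //; first exact: rintegrableZ.
apply: filterS hF => x h; rewrite cabsM exprMn ler_wpM2r ?sqr_ge0//.
by rewrite lerXn2r ?nnegrE ?cabs_ge0// (le_trans (cabs_ge0 _) h).
Qed.

Lemma essbd_cst c : essbd (fun=> c) (cabs c).
Proof. by split; [exact: cmeas_cst|exact: aeW]. Qed.

Lemma essbdM F M f N : essbd F M -> essbd f N -> essbd (fun x => F x * f x) (M * N).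
Proof.
move=> [mF hF] [mf hf]; split; first exact: cmeasM.
by apply: filterS2 hF hf => x h1 h2; rewrite cabsM ler_pM ?cabs_ge0.
Qed.

Lemma essbdD F M f N : essbd F M -> essbd f N -> essbd (fun x => F x + f x) (M + N).
Proof.
move=> [mF hF] [mf hf]; split; first exact: cmeasD.
by apply: filterS2 hF hf => x h1 h2; rewrite (le_trans (cabsD _ _))// lerD.
Qed.

Lemma essbdN F M : essbd F M -> essbd (fun x => - F x) M.
Proof.
move=> [mF hF]; split; first exact: cmeasN.
by apply: filterS hF => x; rewrite cabsN.
Qed.

Lemma essbdB F M f N : essbd F M -> essbd f N -> essbd (fun x => F x - f x) (M + N).
Proof. by move=> hF hf; apply: essbdD => //; exact: essbdN. Qed.

Lemma essbdJ F M : essbd F M -> essbd (fun x => conjc (F x)) M.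
Proof.
move=> [mF hF]; split; first exact: cmeasJ.
by apply: filterS hF => x; rewrite cabs_conj.
Qed.

Lemma essbd_dchar (a : X) : essbd (fun x => dchar x a) 1.
Proof.
split; first exact: cmeas_dchar.
by apply: aeW => x; rewrite dchar_abs.
Qed.

Lemma L2_cst c : L2 (fun=> c).
Proof. by split; [exact: cmeas_cst|exact: rintegrable_cst]. Qed.

Lemma essbd_L2 F M : essbd F M -> L2 F.
Proof.
move=> /L2_essbdM /(_ (L2_cst 1)).
by under eq_fun do rewrite mulr1.
Qed.

Lemma L2_dchar (a : X) : L2 (fun x => dchar x a).
Proof. exact: essbd_L2 (essbd_dchar a). Qed.

Lemma L2Z c f : L2 f -> L2 (fun x => c * f x).
Proof. exact: L2_essbdM (essbd_cst c). Qed.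

Lemma cabsD_sqr (z w : C) : cabs (z + w) ^+ 2 <= 2 * cabs z ^+ 2 + 2 * cabs w ^+ 2.
Proof.
have := cabsD z w; have := cabs_ge0 (z + w); have := cabs_ge0 z; have := cabs_ge0 w.
have := sqr_ge0 (cabs z - cabs w).
move: (cabs z) (cabs w) (cabs _) => a b c; nra.
Qed.

Lemma L2D f g : L2 f -> L2 g -> L2 (fun x => f x + g x).
Proof.
move=> [mf jf] [mg jg]; apply: L2_le (rintegrableD (rintegrableZ 2 jf) (rintegrableZ 2 jg)) _.
  exact: cmeasD.
by move=> x; exact: cabsD_sqr.
Qed.

Lemma L2N f : L2 f -> L2 (fun x => - f x).
Proof.
move=> [mf jf]; split; first exact: cmeasN.
by under eq_fun do rewrite cabsN.
Qed.

Lemma L2B f g : L2 f -> L2 g -> L2 (fun x => f x - g x).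
Proof. by move=> hf hg; apply: L2D => //; exact: L2N. Qed.

Lemma L2_cL1 f : L2 f -> cL1 f.
Proof. by move=> /L2M /(_ (L2_cst 1)); under eq_fun do rewrite mulr1. Qed.

Lemma sqnormZ c f : L2 f -> sqnorm (fun x => c * f x) = cabs c ^+ 2 * sqnorm f.
Proof. by move=> [_ hf]; rewrite -rintegralZ//; apply: eq_rintegral => x; rewrite cabsM exprMn. Qed.

Lemma sqnormN f : sqnorm (fun x => - f x) = sqnorm f.
Proof. by apply: eq_rintegral => x; rewrite cabsN. Qed.

Lemma sqnorm_ae f g : cmeasurable f -> cmeasurable g ->
  (\forall x \ae mu, f x = g x) -> sqnorm f = sqnorm g.
Proof.
move=> mf mg h; apply: rintegral_ae; [exact: cmeas_sqr_cabs..|].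
by apply: filterS h => x ->.
Qed.

Lemma sqnormD f g : L2 f -> L2 g ->
  sqnorm (fun x => f x + g x) = sqnorm f + sqnorm g + 2 * complex.Re (inner f g).
Proof.
move=> hf hg; have hfg := cL1_Re (inner_cL1 hf hg); have [_ jf] := hf; have [_ jg] := hg.
rewrite Re_cint -rintegralZ// -rintegralD// -rintegralD//; last 2 first.
- exact: rintegrableD.
- exact: rintegrableZ.
by apply: eq_rintegral => x; rewrite cabsDsqr.
Qed.

Lemma cauchy_schwarz f g : L2 f -> L2 g ->
  rintegral (fun x => cabs (f x) * cabs (g x)) ^+ 2 <= sqnorm f * sqnorm g.
Proof.
move=> hf hg; have [_ jf] := hf; have [_ jg] := hg.
have jfg : rintegrable (fun x => cabs (f x) * cabs (g x)).
  by have [_] := L2M hf hg; under eq_fun do rewrite cabsM.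
apply: sqr_le_of_amgm; [|exact: sqnorm_ge0..|].
  by apply: rintegral_ge0 => x; rewrite mulr_ge0 ?cabs_ge0.
move=> t t0; rewrite -!rintegralZ// -rintegralD; [|exact: rintegrableZ..].
apply: le_rintegral; [exact: rintegrableZ|by apply: rintegrableD; exact: rintegrableZ|move=> x].
move: (cabs (f x)) (cabs (g x)) => a b.
have tn : t != 0 by rewrite gt_eqF.
have : 0 <= t^-1 * (t * a - b) ^+ 2 by rewrite mulr_ge0 ?sqr_ge0 ?invr_ge0 ?ltW.
have -> : t^-1 * (t * a - b) ^+ 2 = t * a ^+ 2 + t^-1 * b ^+ 2 - 2 * (a * b).
  by field.
by rewrite subr_ge0.
Qed.

Lemma inner_cauchy_schwarz f g : L2 f -> L2 g -> cabs (inner f g) ^+ 2 <= sqnorm f * sqnorm g.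
Proof.
move=> hf hg; apply: le_trans (cauchy_schwarz hf hg).
rewrite lerXn2r ?nnegrE ?cabs_ge0//.
  by apply: rintegral_ge0 => x; rewrite mulr_ge0 ?cabs_ge0.
apply: le_trans (cabs_cint (inner_cL1 hf hg)) _.
rewrite le_eqVlt; apply/orP; left; apply/eqP; apply: eq_rintegral => x.
by rewrite cabsM cabs_conj.
Qed.

Lemma innerZl c f h : L2 f -> L2 h -> inner (fun x => c * f x) h = c * inner f h.
Proof.
move=> hf hh; rewrite -cintZ; last exact: inner_cL1.
by congr cint; apply/funext => x; rewrite mulrA.
Qed.

Lemma innerBl f g h : L2 f -> L2 g -> L2 h ->
  inner (fun x => f x - g x) h = inner f h - inner g h.
Proof.
move=> hf hg hh; rewrite -cintB; [|exact: inner_cL1..].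
by congr cint; apply/funext => x; rewrite mulrBl.
Qed.

Lemma innerJ f g : L2 f -> L2 g -> inner g f = conjc (inner f g).
Proof.
move=> hf hg; rewrite -cintJ; last exact: inner_cL1.
by congr cint; apply/funext => x; rewrite rmorphM /= conjcK mulrC.
Qed.

Lemma inner_self f : L2 f -> inner f f = (sqnorm f)%:C%C.
Proof.
move=> hf; apply: complex_ext; rewrite ?Re_cint ?Im_cint /=.
  by apply: eq_rintegral => x; rewrite mul_conjc.
by rewrite -[RHS](rintegral_cst mu 0); apply: eq_rintegral => x; rewrite mul_conjc.
Qed.

Lemma cL1_dchar f a : cL1 f -> cL1 (fun x => f x * conjc (dchar x a)).
Proof.
move=> [mf jf]; apply: cL1_le jf _.
  by apply: cmeasM => //; apply: cmeasJ; exact: cmeas_dchar.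
by move=> x; rewrite cabsM cabs_conj dchar_abs mulr1.
Qed.

Lemma fourierD f g a : cL1 f -> cL1 g ->
  fourier (fun x => f x + g x) a = fourier f a + fourier g a.
Proof.
move=> hf hg; rewrite -cintD; [|exact: cL1_dchar..].
by congr cint; apply/funext => x; rewrite mulrDl.
Qed.

Lemma fourierB f g a : cL1 f -> cL1 g ->
  fourier (fun x => f x - g x) a = fourier f a - fourier g a.
Proof.
move=> hf hg; rewrite -cintB; [|exact: cL1_dchar..].
by congr cint; apply/funext => x; rewrite mulrBl.
Qed.

Lemma fourierZ c f a : cL1 f -> fourier (fun x => c * f x) a = c * fourier f a.
Proof.
move=> hf; rewrite -cintZ; last exact: cL1_dchar.
by congr cint; apply/funext => x; rewrite mulrA.
Qed.

Lemma fourier_ae f g a : cmeasurable f -> cmeasurable g ->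
  (\forall x \ae mu, f x = g x) -> fourier f a = fourier g a.
Proof.
move=> mf mg h; apply: cint_ae.
- by apply: cmeasM => //; apply: cmeasJ; exact: cmeas_dchar.
- by apply: cmeasM => //; apply: cmeasJ; exact: cmeas_dchar.
- by apply: filterS h => x ->.
Qed.

Lemma sqnorm_dchar a : sqnorm (fun x => dchar x a) = 1.
Proof. by rewrite -[RHS](rintegral_cst mu 1); apply: eq_rintegral => x; rewrite dchar_abs expr1n. Qed.

Lemma sqr_fourier_le f a : L2 f -> cabs (fourier f a) ^+ 2 <= sqnorm f.
Proof.
by move=> hf; rewrite -[leRHS]mulr1 -(sqnorm_dchar a); apply: inner_cauchy_schwarz hf (L2_dchar a).
Qed.

End L2Space.

(** * Separation of points by characters *)

(* A partial homomorphism into the unit circle is represented by its graph;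
   a maximal one is total because the circle is divisible. *)
Section CharacterExtension.
Variables (X : zmodType) (R : rcfType).
Local Notation C := (R[i]).
Implicit Types (S : set (X * C)).

Definition hom_graph S : Prop :=
  [/\ forall p q, S p -> S q -> S (p.1 - q.1, p.2 / q.2),
      forall z, S (0, z) -> z = 1
    & forall p, S p -> cabs p.2 = 1].

Lemma cabs1_neq0 (w : C) : cabs w = 1 -> w != 0.
Proof. by move=> w1; rewrite -cabs_eq0 w1 oner_eq0. Qed.

Lemma cabs_exprz (w : C) (n : int) : cabs w = 1 -> cabs (w ^ n) = 1.
Proof.
by move=> w1; case: n => n; rewrite /= ?cabsV cabsX w1 expr1n ?invr1.
Qed.

Lemma hom_graph_inv S x z : hom_graph S -> S (x, z) -> S (- x, z^-1).
Proof.
move=> [hB h0 h1] Sx; have S0 := hB _ _ Sx Sx.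
have zn : z != 0 by exact: cabs1_neq0 (h1 _ Sx).
rewrite /= subrr divff// in S0.
by have := hB _ _ S0 Sx; rewrite /= sub0r div1r.
Qed.

Lemma hom_graphD S x z y w : hom_graph S -> S (x, z) -> S (y, w) -> S (x + y, z * w).
Proof.
move=> hS Sx Sy; have [hB _ _] := hS.
by have := hB _ _ Sx (hom_graph_inv hS Sy); rewrite /= opprK invrK.
Qed.

Lemma hom_graph_fun S x z w : hom_graph S -> S (x, z) -> S (x, w) -> z = w.
Proof.
move=> [hB h0 h1] Sz Sw; have wn := cabs1_neq0 (h1 _ Sw).
have := hB _ _ Sz Sw; rewrite /= subrr => /h0 /(congr1 (fun t => t * w)).
by rewrite divfK// mul1r.
Qed.

Lemma hom_graphMn S x z n : hom_graph S -> S (x, z) -> S (x *+ n, z ^+ n).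
Proof.
move=> hS Sx; elim: n => [|n IH]; last by rewrite mulrS exprS; exact: hom_graphD.
rewrite mulr0n expr0; have [hB _ h1] := hS.
have := hB _ _ Sx Sx; rewrite /= subrr divff//; exact: cabs1_neq0 (h1 _ Sx).
Qed.

Lemma hom_graph_extend S b w : hom_graph S -> S !=set0 -> cabs w = 1 ->
  (forall (n : int) z, S (b *~ n, z) -> z = w ^ n) ->
  exists S', [/\ hom_graph S', S `<=` S' & S' (b, w)].
Proof.
move=> hS [[x0 z0] S0] w1 hw; have [hB h0 h1] := hS.
have wn : w != 0 by exact: cabs1_neq0.
have S1 : S (0, 1) by have := hom_graphMn 0 hS S0; rewrite mulr0n expr0.
exists [set p | exists x z (n : int), S (x, z) /\ p = (x + b *~ n, z * w ^ n)]; split.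
- split.
  + move=> _ _ [x [z [n [Sx ->]]]] [y [v [m [Sy ->]]]] /=.
    exists (x - y), (z / v), (n - m); split; first exact: hB _ _ Sx Sy.
    rewrite mulrzBr expfzDr// -invr_expz invfM; congr (_, _); last by ring.
    by rewrite opprD addrACA.
  + move=> _ [x [z [n [Sx [/esym/eqP + ->]]]]].
    rewrite addr_eq0 => /eqP xE.
    have : S (b *~ (- n), z) by rewrite mulrNz -xE.
    by move=> /hw ->; rewrite -expfzDr// addNr expr0z.
  + move=> _ [x [z [n [Sx ->]]]] /=.
    by rewrite cabsM (h1 _ Sx) cabs_exprz// mulr1.
- by move=> [x z] Sx; exists x, z, 0; rewrite mulr0z expr0z addr0 mulr1.
- by exists 0, 1, 1; rewrite mulr1z expr1z add0r mul1r.
Qed.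

Lemma hom_graph_root S b : hom_graph S -> S !=set0 ->
  exists2 w, cabs w = 1 & forall (n : int) z, S (b *~ n, z) -> z = w ^ n.
Proof.
move=> hS [[x0 z0] S0]; have [hB h0 h1] := hS.
suff [w w1 hw] : exists2 w, cabs w = 1 &
    forall (n : nat) z, S (b *+ n, z) -> z = w ^+ n.
  exists w => // -[n|n] z; first exact: hw.
  rewrite NegzE mulrNz => /(hom_graph_inv hS); rewrite opprK => /hw zE.
  by rewrite -invr_expz -[z]invrK zE.
pose Q (n : nat) := `[< (0 < n)%N /\ exists z, S (b *+ n, z) >].
have [exQ|nQ] := pselect (exists n, Q n); last first.
  exists 1; rewrite ?cabs1// => -[|n] z Sz.
    by rewrite expr0; apply: h0; rewrite mulr0n in Sz.
  by exfalso; apply: nQ; exists n.+1; apply/asboolP; split => //; exists z.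
case: (ex_minnP exQ) => d /asboolP[d0 [z Sz]] dmin.
have wd : (d.-root z) ^+ d = z by exact: rootCK.
have w1 : cabs (d.-root z) = 1.
  apply/eqP; rewrite -(@pexpr_eq1 _ _ d) ?cabs_ge0// -cabsX wd.
  by rewrite (h1 _ Sz).
exists (d.-root z) => // n y Sy.
have Sr : S (b *+ (n %% d), y / z ^+ (n %/ d)).
  have := hB _ _ Sy (hom_graphMn (n %/ d) hS Sz); rewrite /= -mulrnA.
  by rewrite {1}(divn_eq n d) mulrnDr mulnC addrAC subrr add0r.
have r0 : (n %% d)%N = 0%N.
  apply/eqP; rewrite -leqn0 leqNgt; apply/negP => r0.
  have : Q (n %% d)%N by apply/asboolP; split => //; eexists; exact: Sr.
  by move=> /dmin; rewrite leqNgt ltn_mod d0.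
move: Sr; rewrite r0 mulr0n => /h0 /(congr1 (fun t => t * z ^+ (n %/ d))).
rewrite divfK ?expf_neq0 ?(cabs1_neq0 (h1 _ Sz))// mul1r => ->.
by rewrite -{1}wd -exprM {2}(divn_eq n d) r0 addn0 mulnC.
Qed.

Lemma dual_of_hom_graph S : hom_graph S -> (forall x, exists z, S (x, z)) ->
  exists chi : dual X R, forall p, S p -> dchar chi p.1 = p.2.
Proof.
move=> hS tot; have [hB h0 h1] := hS.
pose f x := sval (cid (tot x)).
have fS x : S (x, f x) by exact: (svalP (cid (tot x))).
have fD a b : f (a + b) = f a * f b.
  by apply: (hom_graph_fun hS (fS _)); exact: hom_graphD.
have f1 a : cabs (f a) = 1 by exact: (h1 _ (fS a)).
exists (Dual fD f1) => -[x z] Sz /=; exact: (hom_graph_fun hS (fS _) Sz).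
Qed.

Lemma exists_dual a : (forall n, a *+ n.+1 != 0) ->
  exists chi : dual X R, dchar chi a = -1.
Proof.
move=> ha.
have cN1 : cabs (-1 : C) = 1 by rewrite cabsN cabs1.
pose Q S := hom_graph S /\ (S !=set0 -> S (a, -1)).
have [A [[hA Aa] Amax]] : exists A, Q A /\ (forall B, A `<` B -> ~ Q B).
  apply: Zorn_bigcup => F FQ Ftot; split; last first.
    move=> [p [S FS Sp]]; exists S => //; apply: (FQ _ FS).2; by exists p.
  split.
  - move=> p q [S FS Sp] [S' FS' Sq].
    have [h|h] := Ftot _ _ FS FS'.
      exists S' => //; have [[hB _ _] _] := FQ _ FS'; exact: hB (h _ Sp) Sq.
    exists S => //; have [[hB _ _] _] := FQ _ FS; exact: hB Sp (h _ Sq).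
  - by move=> z [S FS]; have [[_ h0 _] _] := FQ _ FS; exact: h0.
  - by move=> p [S FS]; have [[_ _ h1] _] := FQ _ FS; exact: h1.
have A0 : A !=set0.
  apply/set0P/negP => /eqP A0.
  have [] := @hom_graph_extend [set (0, 1)] a (-1).
  - split=> [_ _ -> ->|z [->]|_ ->] //=; last exact: cabs1.
    by rewrite subrr divff ?oner_neq0.
  - by exists (0, 1).
  - exact: cN1.
  - move=> [[|n]|n] z; first by case=> ->; rewrite expr0z.
      by move=> [E _]; exfalso; have := ha n; rewrite pmulrn E eqxx.
    move=> [E _]; exfalso; have := ha n; rewrite pmulrn.
    by move: E; rewrite NegzE mulrNz => /eqP; rewrite oppr_eq0 => ->.
  - move=> S' [hS' sub S'a]; apply: (Amax S'); last by split.
    by rewrite A0; split => // /(_ _ S'a).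
have Atot x : exists z, A (x, z).
  have [w w1 hw] := hom_graph_root x hA A0.
  have [S' [hS' sub S'x]] := hom_graph_extend hA A0 w1 hw.
  exists w; apply: contrapT => nA; apply: (Amax S').
    by split => // /(_ _ S'x).
  by split => // _; apply: sub; exact: Aa.
have [chi hchi] := dual_of_hom_graph hA Atot.
by exists chi; exact: hchi (Aa A0).
Qed.

End CharacterExtension.

Section Characters.
Variables (X : zmodType) (R : rcfType).
Implicit Types (x : dual X R) (a b : X).

Lemma dchar_neq0 x a : dchar x a != 0.
Proof. by apply: cabs1_neq0; exact: dchar_abs. Qed.

Lemma dchar0 x : dchar x 0 = 1.
Proof.
have := dchar_add x 0 0; rewrite addr0 => /eqP.
by rewrite -subr_eq0 -{1}[dchar x 0]mulr1 -mulrBr mulf_eq0 (negbTE (dchar_neq0 _ _)) /= subr_eq0 => /eqP.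
Qed.

Lemma dcharN x a : dchar x (- a) = conjc (dchar x a).
Proof.
apply: (mulfI (dchar_neq0 x a)).
by rewrite -dchar_add subrr dchar0 mulrC conjc_mul1 ?dchar_abs.
Qed.

Lemma dcharB x a b : dchar x (a - b) = dchar x a * conjc (dchar x b).
Proof. by rewrite dchar_add dcharN. Qed.

Lemma positive_cone_torsion_free (P : set X) a n :
  positive_cone P -> a != 0 -> a *+ n.+1 != 0.
Proof.
move=> [PD P0 Ptot]; wlog Pa : a / P a => [H|] a0.
  case: (Ptot a) => [/H/(_ a0)//|/H]; rewrite oppr_eq0 => /(_ a0).
  by rewrite mulNrn oppr_eq0.
have Pn m : P (a *+ m.+1) by elim: m => [//|m IH]; rewrite mulrS; exact: PD.
apply/eqP => E; move/eqP: a0; apply; case: n E => [//|n E].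
by apply: P0 => //; move/eqP: E; rewrite mulrS addr_eq0 => /eqP ->; rewrite opprK.
Qed.

End Characters.

Lemma sgn_iter_cvg (R : realType) (s : R) : `|s| <= 1 ->
  iter n (fun q : R => q * (3 - q ^+ 2) / 2) s @[n --> \oo] --> Num.sg s.
Proof.
set F := fun q : R => _.
have FN q : F (- q) = - F q by rewrite /F sqrrN !mulNr.
wlog s0 : s / 0 <= s => [H s1|].
  have [/H|s0] := leP 0 s; first exact.
  have -> : (fun n => iter n F s) = (fun n => - iter n F (- s)).
    by apply/funext; elim=> [|n IH]; rewrite ?opprK//= -FN -IH.
  rewrite -[s in Num.sg s]opprK sgrN; apply: cvgN; apply: H; last by rewrite normrN.
  by rewrite oppr_ge0 ltW.
rewrite ger0_norm// => s1.
have [->|sn] := eqVneq s 0.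
  rewrite sgr0 (_ : (fun n => _) = (fun=> 0)); first exact: cvg_cst.
  by apply/funext; elim=> [//|n IH] /=; rewrite IH /F !mul0r.
have sp : 0 < s by rewrite lt_neqAle eq_sym sn.
rewrite gtr0_sg//.
have b n : s <= iter n F s <= 1 /\ 1 - iter n F s <= (1 - s / 2) ^+ n.
  elim: n => [|n [/andP[h1 h2] h3]] /=; first by rewrite lexx s1 expr0 gerBl.
  set q := iter n F s in h1 h2 h3 *.
  have e : 1 - F q = (1 - q) * (1 - q / 2 - q ^+ 2 / 2) by rewrite /F; field.
  have q0 : 0 <= q by apply: le_trans h1; exact: ltW.
  have q2 : 0 <= q * (1 - q) by rewrite mulr_ge0// subr_ge0.
  have q3 : 0 <= (1 - q) * (1 - q / 2 - q ^+ 2 / 2).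
    by rewrite mulr_ge0 ?subr_ge0//; nra.
  split; last first.
    rewrite e [(1 - s / 2) ^+ _]exprSr ler_pM// ?subr_ge0//; nra.
  apply/andP; split; last by rewrite -subr_ge0 e.
  have -> : F q = q + q * (1 - q) * ((1 + q) / 2) by rewrite /F; field.
  by rewrite (le_trans h1)// lerDl mulr_ge0//; lra.
have g : (1 - s / 2) ^+ n @[n --> \oo] --> (0 : R).
  by apply: cvg_expr; rewrite ger0_norm; lra.
have g1 : 1 - (1 - s / 2) ^+ n @[n --> \oo] --> (1 : R).
  by rewrite -[X in _ --> X]subr0; apply: cvgB => //; exact: cvg_cst.
apply: squeeze_cvgr; [|exact: g1|exact: cvg_cst].
by apply: nearW => n; have [/andP[_ h2] h3] := b n; rewrite h2 andbT; lra.
Qed.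

Section Orthogonality.
Variables (X : zmodType) (R : realType) (mu : probability (Gm X R) R).
Local Notation G := (Gm X R).
Local Notation C := (R[i]).

Lemma measurable_dmul (y : dual X R) :
  measurable_fun setT (fun x : G => (dmul x y : G)).
Proof.
apply: (@measurability _ _ G G setT _ (@dual_gen X R)) => //.
move=> _ [S [a [B [mB SB]]] <-]; rewrite setTI.
have [m1 m2] : cmeasurable (fun x : G => dchar x a * dchar y a).
  by apply: cmeasM; [exact: cmeas_dchar|exact: cmeas_cst].
case: SB => ->.
- by have := m1 measurableT B mB; rewrite setTI.
- by have := m2 measurableT B mB; rewrite setTI.
Qed.

Lemma rintegral_dmul (y : dual X R) (f : G -> R) : haar mu -> rintegrable mu f ->
  rintegrable mu (fun x => f (dmul x y)) -> rintegral mu (fun x => f (dmul x y)) = rintegral mu f.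
Proof.
move=> hmu hf hf'; congr fine.
have mf := rintegrable_meas hf.
rewrite [RHS](_ : _ = (\int[pushforward mu (fun x : G => (dmul x y : G))]_x (f x)%:E)%E).
  rewrite integral_pushforward//; first exact: measurable_dmul.
  exact/measurable_EFinP.
apply: eq_measure_integral => [|mdy A mA _]; first exact: measurable_dmul.
exact/esym/(hmu y A mA).
Qed.

Lemma cint_dchar (P : set X) (a : X) : positive_cone P -> haar mu -> a != 0 ->
  cint mu (fun x => dchar x a) = 0.
Proof.
move=> hP hmu a0.
have [|y ya] := @exists_dual X R a.
  by move=> n; exact: positive_cone_torsion_free hP a0.
have hL : cL1 mu (fun x => dchar x a) by exact/L2_cL1/L2_dchar.
have swap : (fun x : G => dchar x a * -1) = (fun x => -1 * dchar x a).
  by apply/funext => x; rewrite mulrC.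
have hL' := cL1Z (-1) hL; rewrite -swap in hL'.
have e : cint mu (fun x => dchar x a * -1) = cint mu (fun x => dchar x a).
  apply: complex_ext; rewrite ?Re_cint ?Im_cint.
  - rewrite -(rintegral_dmul (y := y) hmu (cL1_Re hL)).
      by apply: eq_rintegral => x /=; rewrite ya.
    by have := cL1_Re hL'; rewrite -ya.
  - rewrite -(rintegral_dmul (y := y) hmu (cL1_Im hL)).
      by apply: eq_rintegral => x /=; rewrite ya.
    by have := cL1_Im hL'; rewrite -ya.
move: e; rewrite swap cintZ// mulN1r => /eqP; rewrite -subr_eq0 -opprD oppr_eq0.
by rewrite -mulr2n mulrn_eq0 /= => /eqP.
Qed.

Lemma fourier_dchar (P : set X) (a b : X) : positive_cone P -> haar mu ->
  fourier mu (fun x => dchar x a) b = (a == b)%:R.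
Proof.
move=> hP hmu; rewrite /fourier.
under eq_fun do rewrite -dcharB.
have [->|ab] := eqVneq a b.
  by rewrite subrr; under eq_fun do rewrite dchar0; rewrite cint_cst.
by rewrite (cint_dchar hP hmu)// subr_eq0.
Qed.

End Orthogonality.

(** * Injectivity of the Fourier transform *)

Section Uniqueness.
Variables (X : zmodType) (R : realType) (mu : probability (Gm X R) R).
Local Notation G := (Gm X R).
Local Notation C := (R[i]).
Implicit Types (f g : G -> C) (u v : G -> R).
Local Notation rintegrable := (rintegrable mu).
Local Notation rintegral := (rintegral mu).
Local Notation cint := (cint mu).
Local Notation cL1 := (cL1 mu).
Local Notation fourier := (fourier mu).

Lemma rintegral_dominated_cvg0 (u_ : nat -> G -> R) h :
  (forall n, measurable_fun setT (u_ n)) -> rintegrable h ->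
  (forall n x, `|u_ n x| <= h x) -> (forall x, u_ n x @[n --> \oo] --> 0) ->
  rintegral (u_ n) @[n --> \oo] --> 0.
Proof.
move=> um ih uh u0.
have iu n : rintegrable (u_ n) by apply: rintegrable_le ih _.
have [|||||_ _] := @dominated_convergence _ G R mu setT measurableT
  (fun n x => (u_ n x)%:E) (cst 0%E) (EFin \o h).
- by move=> n; exact/measurable_EFinP.
- exact: measurable_cst.
- by apply: aeW => x _; apply/fine_cvgP; split; [exact: nearW|exact: u0].
- exact: ih.
- by apply: aeW => x n _ /=; rewrite lee_fin.
rewrite integral0 => /fine_cvg.
by apply: cvg_trans; apply: near_eq_cvg; exact: nearW.
Qed.

Definition null_coef f := cL1 f /\ forall a, fourier f a = 0.

Lemma null_coefD f g : null_coef f -> null_coef g -> null_coef (fun x => f x + g x).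
Proof.
move=> [hf f0] [hg g0]; split; first exact: cL1D.
by move=> a; rewrite fourierD// f0 g0 addr0.
Qed.

Lemma null_coefZ c f : null_coef f -> null_coef (fun x => c * f x).
Proof.
move=> [hf f0]; split; first exact: cL1Z.
by move=> a; rewrite fourierZ// f0 mulr0.
Qed.

Lemma null_coef_dchar b f : null_coef f -> null_coef (fun x => dchar x b * f x).
Proof.
move=> [[mf jf] f0]; split.
  split; first by apply: cmeasM => //; exact: cmeas_dchar.
  by under eq_fun do rewrite cabsM dchar_abs mul1r.
move=> a; rewrite -[RHS](f0 (a - b)); congr cint; apply/funext => x.
by rewrite dcharB rmorphM /= conjcK; ring.
Qed.

Definition null_mul u := [/\ measurable_fun setT u, exists M, forall x, `|u x| <= M
  & forall f, null_coef f -> null_coef (fun x => (u x)%:C%C * f x)].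

Lemma null_mul_cst c : null_mul (fun=> c).
Proof.
split; [exact: measurable_cst|by exists `|c| |]; first exact: null_coefZ.
Qed.

Lemma null_mulD u v : null_mul u -> null_mul v -> null_mul (fun x => u x + v x).
Proof.
move=> [mu_ [M uM] nu] [mv [N vN] nv]; split; first exact: measurable_funD.
  by exists (M + N) => x; rewrite (le_trans (ler_normD _ _))// lerD.
move=> f hf; have := null_coefD (nu f hf) (nv f hf).
by under eq_fun do rewrite -mulrDl -rmorphD.
Qed.

Lemma null_mulM u v : null_mul u -> null_mul v -> null_mul (fun x => u x * v x).
Proof.
move=> [mu_ [M uM] nu] [mv [N vN] nv]; split; first exact: measurable_funM.
  by exists (M * N) => x; rewrite normrM ler_pM.
move=> f hf; have := nu _ (nv f hf).
by under eq_fun do rewrite mulrA -rmorphM.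
Qed.

Lemma null_mulZ c u : null_mul u -> null_mul (fun x => c * u x).
Proof. exact: null_mulM (null_mul_cst c). Qed.

Lemma null_mulN u : null_mul u -> null_mul (fun x => - u x).
Proof. by move=> /(null_mulZ (-1)); under eq_fun do rewrite mulN1r. Qed.

Lemma null_mulB u v : null_mul u -> null_mul v -> null_mul (fun x => u x - v x).
Proof. by move=> hu hv; apply: null_mulD => //; exact: null_mulN. Qed.

Lemma null_mul_cvg (u_ : nat -> G -> R) u (M : R) :
  (forall n, null_mul (u_ n)) -> (forall n x, `|u_ n x| <= M) ->
  (forall x, u_ n x @[n --> \oo] --> u x) -> null_mul u.
Proof.
move=> hu uM cu.
have mu_ n : measurable_fun setT (u_ n) by case: (hu n).
have mu0 : measurable_fun setT u.
  by apply: (measurable_fun_cvg mu_) => x _; exact: cu.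
have bu x : `|u x| <= M.
  have c : `|u_ n x| @[n --> \oo] --> `|u x| by apply: cvg_norm; exact: cu.
  by rewrite -(cvg_lim _ c)//; apply: limr_le; [exact: (cvgP _ c)|exact: nearW].
split => //; first by exists M.
move=> f [hf f0]; have [mf jf] := hf.
have hL (v : G -> R) : measurable_fun setT v -> (forall x, `|v x| <= M) ->
    cL1 (fun x => (v x)%:C%C * f x).
  move=> mv vM; apply: cL1_le (rintegrableZ M jf) _.
    by apply: cmeasM => //; exact: cmeasR.
  by move=> x; rewrite cabsM cabsR ler_wpM2r ?cabs_ge0.
split; first exact: hL.
move=> a; apply: cabs0_eq0; apply/eqP; rewrite eq_le cabs_ge0 andbT.
have D0 : rintegral (fun x => `|u x - u_ n x| * cabs (f x)) @[n --> \oo] --> 0.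
  apply: (@rintegral_dominated_cvg0 _ (fun x => (M + M) * cabs (f x))).
  - move=> n; apply: measurable_funM; last exact: cmeas_cabs.
    by apply: measurableT_comp => //; exact: measurable_funB.
  - exact: rintegrableZ.
  - move=> n x; rewrite normrM normr_id [`|cabs _|]ger0_norm ?cabs_ge0//.
    rewrite ler_wpM2r ?cabs_ge0// (le_trans (ler_normB _ _))// lerD//.
  - move=> x; rewrite -(mul0r (cabs (f x))); apply: cvgMl.
    rewrite -(normr0 R) -(subrr (u x)); apply: cvg_norm; apply: cvgB => //.
    exact: cvg_cst.
rewrite -(cvg_lim _ D0)//; apply: limr_ge; first exact: (cvgP _ D0).
apply: nearW => n; have [_ _ /(_ f (conj hf f0)) [_ /(_ a) z]] := hu n.
rewrite -[fourier _ _]subr0 -z -fourierB; [|exact: hL..].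
apply: le_trans (cabs_cint _) _.
  by apply: cL1_dchar; apply: cL1B; exact: hL.
rewrite le_eqVlt; apply/orP; left; apply/eqP; apply: eq_rintegral => x.
by rewrite cabsM cabs_conj dchar_abs mulr1 -mulrBl -rmorphB /= cabsM cabsR.
Qed.

Lemma null_mul_Re a : null_mul (fun x => complex.Re (dchar x a)).
Proof.
have [m1 m2] := @cmeas_dchar X R a; split => //.
  by exists 1 => x; rewrite -(dchar_abs x a) Re_le_cabs.
move=> f hf.
have := null_coefZ (2^-1)%:C%C (null_coefD (null_coef_dchar a hf) (null_coef_dchar (- a) hf)).
congr null_coef; apply/funext => x; rewrite -mulrDl mulrA; congr (_ * _).
rewrite dcharN; case: (dchar x a) => p q; apply: complex_ext => /=; lra.
Qed.

Lemma null_mul_Im a : null_mul (fun x => complex.Im (dchar x a)).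
Proof.
have [m1 m2] := @cmeas_dchar X R a; split => //.
  by exists 1 => x; rewrite -(dchar_abs x a) Im_le_cabs.
move=> f hf.
have := null_coefZ (Complex 0 (- 2^-1)) (null_coefD (null_coef_dchar a hf)
  (null_coefZ (-1) (null_coef_dchar (- a) hf))).
congr null_coef; apply/funext => x; rewrite mulrA -mulrDl mulrA; congr (_ * _).
rewrite dcharN; case: (dchar x a) => p q; apply: complex_ext => /=; lra.
Qed.

Lemma null_mul_indic_gt u r : null_mul u ->
  null_mul (\1_(u @^-1` `]r, +oo[%classic)).
Proof.
move=> nu; have [_ [M0 uM0] _] := nu.
pose M := `|M0| + 1; have M0p : 0 < M by rewrite ltr_wpDl.
have uM x : `|u x| <= M.
  by rewrite (le_trans (uM0 x))// (le_trans (ler_norm _))// lerDl.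
pose s x := (M + `|r|)^-1 * (u x - r).
have Mr : 0 < M + `|r| by rewrite ltr_pwDl.
have s1 x : `|s x| <= 1.
  rewrite normrM normfV (gtr0_norm Mr) ler_pdivrMl// mulr1.
  by rewrite (le_trans (ler_normB _ _))// lerD2r.
have ns : null_mul s by apply: null_mulZ; apply: null_mulB => //; exact: null_mul_cst.
have nsg : null_mul (fun x => Num.sg (s x)).
  pose F := fun q : R => q * (3 - q ^+ 2) / 2.
  apply: (@null_mul_cvg (fun n x => iter n F (s x)) _ 1) => [|n x|x].
  - elim=> [//|n IH] /=.
    have := null_mulZ 2^-1 (null_mulM IH (null_mulB (null_mul_cst 3) (null_mulM IH IH))).
    by under eq_fun do rewrite mulrC -expr2.
  - elim: n => [|n]; first exact: s1.
    rewrite /= /F; move: (iter _ _ _) => q; rewrite !ler_norml => /andP[h1 h2].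
    have h3 : 0 <= 1 - q * (3 - q ^+ 2) / 2.
      rewrite (_ : _ - _ = (1 - q) ^+ 2 * ((2 + q) / 2)); last by field.
      by rewrite mulr_ge0 ?sqr_ge0//; lra.
    have h4 : 0 <= 1 + q * (3 - q ^+ 2) / 2.
      rewrite (_ : _ + _ = (1 + q) ^+ 2 * ((2 - q) / 2)); last by field.
      by rewrite mulr_ge0 ?sqr_ge0//; lra.
    by apply/andP; split; lra.
  - exact: sgn_iter_cvg.
have := null_mulZ 2^-1 (null_mulD (null_mulM nsg nsg) nsg).
congr null_mul; apply/funext => x; rewrite indicE.
have e : (x \in u @^-1` `]r, +oo[%classic) = (0 < s x).
  by rewrite pmulr_rgt0 ?invr_gt0// subr_gt0; apply/idP/idP; rewrite inE /= in_itv /= andbT.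
rewrite e; case: (ltrgt0P (s x)) => h.
- by rewrite gtr0_sg//=; field.
- by rewrite ltr0_sg//=; field.
- by rewrite h sgr0 /=; field.
Qed.

Lemma null_mul_indic_sigma_algebra :
  sigma_algebra setT [set S : set G | null_mul (\1_S)].
Proof.
have hC (A : set G) : null_mul (\1_A) -> null_mul (\1_(~` A)).
  move=> hA; have := null_mulB (null_mul_cst 1) hA; congr null_mul.
  by apply/funext => x; rewrite !indicE in_setC; case: (x \in A); rewrite ?subrr ?subr0.
have h0 : null_mul (\1_(set0 : set G)).
  by have := null_mul_cst 0; congr null_mul; apply/funext => x; rewrite indicE in_set0.
have hU (A B : set G) : null_mul (\1_A) -> null_mul (\1_B) -> null_mul (\1_(A `|` B)).
  move=> hA hB.
  have := null_mulB (null_mul_cst 1) (null_mulM (hC _ hA) (hC _ hB)).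
  congr null_mul; apply/funext => x; rewrite !indicE !in_setC in_setU.
  by case: (x \in A); case: (x \in B); rewrite /= ?mulr0 ?mul0r ?mulr1 ?subrr ?subr0.
split => //.
- by move=> A hA; rewrite /= setTD; exact: hC.
- move=> F hF /=.
  have hn n : null_mul (\1_(\big[setU/set0]_(i < n) F i)).
    by elim: n => [|n IH]; rewrite ?big_ord0// big_ord_recr; apply: hU => //; exact: hF.
  apply: (null_mul_cvg hn (M := 1)) => [n x|x].
    by rewrite indicE; case: (_ \in _); rewrite ?normr1// normr0.
  apply: cvg_near_cst; have [[i _ Fi]|nF] := pselect ((\bigcup_k F k) x).
    near=> n; rewrite !indicE !mem_set//; first by exists i.
    rewrite -bigcup_mkord; exists i => //=; near: n; exact: nbhs_infty_gt.
  apply: nearW => n; rewrite !indicE !memNset//.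
  by rewrite -bigcup_mkord => -[i _ Fi]; apply: nF; exists i.
Unshelve. all: by end_near. Qed.

Lemma null_mul_indic (S : set G) : measurable S -> null_mul (\1_S).
Proof.
have hB u : null_mul u -> forall B : set R, measurable B -> null_mul (\1_(u @^-1` B)).
  move=> hu B mB.
  have : (@RGenOInfty.G R).-sigma.-measurable B by rewrite -RGenOInfty.measurableE.
  move: B {mB}; apply: smallest_sub; last first.
    by move=> _ [r ->]; exact: null_mul_indic_gt.
  have [s0 sC sU] := null_mul_indic_sigma_algebra; split => /=.
  - by rewrite preimage_set0; exact: s0.
  - by move=> A hA; rewrite setTD preimage_setC -setTD; exact: sC.
  - by move=> F hF; rewrite preimage_bigcup; exact: sU.
move: S; apply: smallest_sub; first exact: null_mul_indic_sigma_algebra.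
move=> S [a [B [mB [->|->]]]]; apply: hB => //.
  exact: null_mul_Re.
exact: null_mul_Im.
Qed.

Lemma null_coef_ae0 f : null_coef f -> \forall x \ae mu, f x = 0.
Proof.
move=> hf; have [hL _] := hf.
have h (S : set G) : measurable S -> cint (fun x => (\1_S x)%:C%C * f x) = 0.
  move=> /null_mul_indic [_ _ /(_ f hf) [_ /(_ 0)]].
  by rewrite /fourier; under eq_fun do rewrite dchar0 conjc1 mulr1.
have key (v : G -> R) : rintegrable v ->
    (forall S, measurable S -> rintegral (fun x => \1_S x * v x) = 0) ->
    \forall x \ae mu, v x = 0.
  move=> iv v0.
  have : ae_eq mu setT (EFin \o v) (cst 0%E).
    apply: integral_ae_eq => // E _ mE; rewrite integral0.
    have iE : rintegrable (fun x => \1_E x * v x).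
      apply: rintegrable_le (rintegrable_norm iv) _.
        by apply: measurable_funM; [exact: measurable_indic|exact: rintegrable_meas iv].
      move=> x; rewrite normrM -[leRHS]mul1r ler_wpM2r// indicE.
      by case: (_ \in _); rewrite ?normr1// normr0.
    rewrite integral_mkcond -[RHS](congr1 EFin (v0 _ mE)) rintegral_EFin//.
    apply: eq_integral => x _; rewrite patchE indicE.
    by case: (x \in E); rewrite ?mul1r ?mul0r.
  by apply: filterS => x /(_ I) [].
have hR : \forall x \ae mu, complex.Re (f x) = 0.
  apply: key; first exact: cL1_Re.
  move=> S mS; have /(congr1 (@complex.Re R)) := h _ mS; rewrite Re_cint /= => <-.
  by apply: eq_rintegral => x; rewrite creM /= mul0r subr0.
have hI : \forall x \ae mu, complex.Im (f x) = 0.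
  apply: key; first exact: cL1_Im.
  move=> S mS; have /(congr1 (@complex.Im R)) := h _ mS; rewrite Im_cint /= => <-.
  by apply: eq_rintegral => x; rewrite cimM /= mul0r addr0.
by apply: filterS2 hR hI => x h1 h2; apply: complex_ext.
Qed.

Lemma eq_fourier_ae f g : cL1 f -> cL1 g -> (forall a, fourier f a = fourier g a) ->
  \forall x \ae mu, f x = g x.
Proof.
move=> hf hg fg.
have : null_coef (fun x => f x - g x).
  by split; [exact: cL1B|move=> a; rewrite fourierB// fg subrr].
by move=> /null_coef_ae0; apply: filterS => x /eqP; rewrite subr_eq0 => /eqP.
Qed.

End Uniqueness.

Lemma geometric_cvg (R : realType) (u : nat -> R) (c p : R) : 0 <= p < 1 ->
  (forall n, `|u n.+1 - u n| <= c * p ^+ n) ->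
  exists2 l, u n @[n --> \oo] --> l & forall n, `|l - u n| <= c / (1 - p) * p ^+ n.
Proof.
move=> /andP[p0 p1] hu; have q0 : 1 - p != 0 by rewrite gt_eqF// subr_gt0.
set k := c / (1 - p).
have kE n : k * p ^+ n - k * p ^+ n.+1 = c * p ^+ n by rewrite exprS /k; field.
pose w n := u n - k * p ^+ n; pose v n := u n + k * p ^+ n.
have wnd : nondecreasing_seq w.
  apply/nondecreasing_seqP => n; have := hu n; rewrite ler_norml => /andP[h _].
  by rewrite /w; have := kE n; lra.
have vni : nonincreasing_seq v.
  apply/nonincreasing_seqP => n; have := hu n; rewrite ler_norml => /andP[_ h].
  by rewrite /v; have := kE n; lra.
have k0 n : 0 <= k * p ^+ n.
  rewrite mulr_ge0 ?exprn_ge0// divr_ge0//; last by rewrite subr_ge0 ltW.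
  by have := hu 0%N; rewrite expr0 mulr1; exact/le_trans/normr_ge0.
have cp : k * p ^+ n @[n --> \oo] --> (0 : R).
  have pc : p ^+ n @[n --> \oo] --> (0 : R) by apply: cvg_expr; rewrite ger0_norm.
  suff : k * p ^+ n @[n --> \oo] --> k * 0 by rewrite mulr0.
  by apply: cvgM => //; exact: cvg_cst.
have wc : cvgn w.
  apply: nondecreasing_is_cvgn => //; exists (v 0%N) => _ [n _ <-].
  apply: le_trans (vni 0%N n (leq0n n)); rewrite /w /v.
  by have := k0 n; lra.
have uc : u n @[n --> \oo] --> limn w.
  have uE : u = (fun n => w n + k * p ^+ n) by apply/funext => n; rewrite /w subrK.
  by rewrite [X in X @ _]uE -(addr0 (limn w)); apply: cvgD.
have vc : v n @[n --> \oo] --> limn w.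
  by rewrite -(addr0 (limn w)); apply: cvgD.
exists (limn w) => // n; rewrite ler_norml; apply/andP; split.
  have := nondecreasing_cvgn_le wnd wc n; rewrite /w; lra.
have := nonincreasing_cvgn_ge vni (cvgP _ vc) n; rewrite (cvg_lim _ vc)// /v; lra.
Qed.

Lemma ex2_and (T : Type) (P Q : T -> Prop) : (exists2 x, P x & Q x) -> exists x, P x /\ Q x.
Proof. by move=> [x]; exists x. Qed.

(** * The Parseval and Riesz-Fischer theorems *)

Section L2Complete.
Variables (X : zmodType) (R : realType) (mu : probability (Gm X R) R).
Local Notation G := (Gm X R).
Local Notation C := (R[i]).
Local Notation rintegrable := (rintegrable mu).
Local Notation rintegral := (rintegral mu).
Local Notation L2 := (L2 mu).
Local Notation sqnorm := (sqnorm mu).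

Lemma L2_complete (f_ : nat -> G -> C) (c p : R) : 0 < p < 1 ->
  (forall n, L2 (f_ n)) ->
  (forall n, sqnorm (fun x => f_ n.+1 x - f_ n x) <= c * p ^+ (4 * n)) ->
  exists2 f, L2 f & exists K : R, forall n, sqnorm (fun x => f x - f_ n x) <= K * p ^+ (2 * n).
Proof.
move=> /andP[p0 p1] hf hd.
pose d n x := cabs (f_ n.+1 x - f_ n x) ^+ 2.
have dL n : rintegrable (d n) by case: (L2B (hf n.+1) (hf n)).
pose t n x := (p ^- (2 * n) * d n x)%:E.
have t0 n x : (0 <= t n x)%E.
  by rewrite lee_fin mulr_ge0 ?sqr_ge0// invr_ge0 exprn_ge0// ltW.
have mt n : measurable_fun setT (t n).
  by apply/measurable_EFinP; apply: rintegrable_meas; exact: rintegrableZ.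
pose h x := (\sum_(n <oo) t n x)%E.
have h0 x : (0 <= h x)%E by apply: nneseries_ge0 => n _ _; exact: t0.
have mh : measurable_fun setT h.
  by apply: ge0_emeasurable_sum => // n x _ _; exact: t0.
have c0 : 0 <= c by have := hd 0%N; rewrite muln0 expr0 mulr1; exact/le_trans/sqnorm_ge0.
have p2 : p ^+ 2 < 1 by rewrite expr_lt1// ltW.
have ih : (\int[mu]_x h x < +oo)%E.
  rewrite integral_nneseries//.
  apply: (@le_lt_trans _ _ (c / (1 - p ^+ 2))%:E); last by rewrite ltry.
  apply: lime_le; first by apply: is_cvg_nneseries => n _ _; exact: integral_ge0.
  apply: nearW => n.
  have tn k : (\int[mu]_x t k x <= (c * (p ^+ 2) ^+ k)%:E)%E.
    rewrite -(rintegral_EFin (rintegrableZ _ (dL k))) lee_fin rintegralZ//.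
    rewrite -exprM ler_pdivrMl ?exprn_gt0//.
    by rewrite mulrCA -exprD -mulnDl; exact: hd.
  apply: le_trans (lee_sum _ (fun k _ => tn k)) _.
  rewrite sumEFin lee_fin -mulr_sumr ler_wpM2l//.
  rewrite big_mkord -[leRHS]mul1r ler_pdivlMr ?subr_gt0//.
  by rewrite mulrC -opprB mulNr -subrX1 opprB gerBl exprn_ge0// exprn_ge0// ltW.
pose A := [set x | h x \is a fin_num].
have mA : measurable A.
  by rewrite -[A]setTI; exact: emeasurable_fin_num.
pose H x := fine (h x).
have mH : measurable_fun setT H by apply: measurableT_comp mh; exact: fine_measurable.
have H0 x : 0 <= H x by exact: fine_ge0.
have iH : rintegrable H.
  apply/integrableP; split; first exact/measurable_EFinP.
  apply: le_lt_trans ih; apply: ge0_le_integral => //.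
    by apply: measurableT_comp => //; exact/measurable_EFinP.
  by move=> x _; rewrite /= ger0_norm// /H; have := h0 x; case: (h x).
have Aae : \forall x \ae mu, A x.
  have : mu.-integrable setT h.
    apply/integrableP; split => //.
    by under eq_integral do rewrite gee0_abs//.
  by move=> /(integrable_ae measurableT); apply: filterS => x /(_ I).
pose g n x := (\1_A x : R)%:C%C * f_ n x.
have mg n : cmeasurable (g n).
  by apply: cmeasM; [apply: cmeasR; exact: measurable_indic|case: (hf n)].
have gd n x : cabs (g n.+1 x - g n x) <= Num.sqrt (H x) * p ^+ n.
  have sq0 : 0 <= Num.sqrt (H x) * p ^+ n by rewrite mulr_ge0 ?sqrtr_ge0// exprn_ge0// ltW.
  rewrite -mulrBr cabsM cabsR indicE.
  have [Ax|nAx] := boolP (x \in A); last by rewrite normr0 mul0r.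
  rewrite normr1 mul1r -(@ler_pXn2r _ 2)// ?nnegrE ?cabs_ge0//.
  rewrite exprMn [Num.sqrt (H x) ^+ 2]sqr_sqrtr// -exprM mulnC -ler_pdivrMr ?exprn_gt0//.
  rewrite -lee_fin /H fineK; last by rewrite inE in Ax.
  apply: le_trans (nneseries_lim_ge n.+1 (fun k _ _ => t0 k x)).
  rewrite big_nat_recr//= -[X in (X <= _)%E]add0e leeD ?sume_ge0//.
  by rewrite /t lee_fin mulrC.
have pw : 0 <= p < 1 by rewrite ltW.
have gR n x : `|complex.Re (g n.+1 x) - complex.Re (g n x)| <= Num.sqrt (H x) * p ^+ n.
  by apply: le_trans (gd n x); rewrite -creN -creD Re_le_cabs.
have gI n x : `|complex.Im (g n.+1 x) - complex.Im (g n x)| <= Num.sqrt (H x) * p ^+ n.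
  by apply: le_trans (gd n x); rewrite -cimN -cimD Im_le_cabs.
have [lR hR] := choice (fun x => ex2_and (geometric_cvg pw (gR ^~ x))).
have [lI hI] := choice (fun x => ex2_and (geometric_cvg pw (gI ^~ x))).
pose f x := Complex (lR x) (lI x).
have mf : cmeasurable f.
  split; [apply: (measurable_fun_cvg (h := fun n x => complex.Re (g n x)))
         |apply: (measurable_fun_cvg (h := fun n x => complex.Im (g n x)))];
    [by move=> n; case: (mg n)|by move=> x _; case: (hR x)
    |by move=> n; case: (mg n)|by move=> x _; case: (hI x)].
have fg n x : cabs (f x - g n x) ^+ 2 <= 2 / (1 - p) ^+ 2 * p ^+ (2 * n) * H x.
  have [_ /(_ n) h1] := hR x; have [_ /(_ n) h2] := hI x.
  rewrite sqr_cabs !creD !cimD !creN !cimN /=.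
  have e (b : R) : `|b| <= Num.sqrt (H x) / (1 - p) * p ^+ n ->
      b ^+ 2 <= H x / (1 - p) ^+ 2 * p ^+ (2 * n).
    move=> hb; rewrite -real_normK ?num_real//.
    apply: le_trans (lerXn2r 2 _ _ hb) _; rewrite ?nnegrE//.
      by rewrite mulr_ge0 ?exprn_ge0 ?divr_ge0 ?sqrtr_ge0 ?subr_ge0 ?(ltW p1) ?(ltW p0).
    by rewrite !exprMn exprVn [Num.sqrt (H x) ^+ 2]sqr_sqrtr// -exprM mulnC.
  apply: le_trans (lerD (e _ h1) (e _ h2)) _.
  rewrite le_eqVlt; apply/orP; left; apply/eqP; ring.
have Lfg n : L2 (fun x => f x - g n x).
  apply: L2_le (rintegrableZ (2 / (1 - p) ^+ 2 * p ^+ (2 * n)) iH) (fg n).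
  by apply: cmeasB.
have ae_g n : \forall x \ae mu, f_ n x = g n x.
  by apply: filterS Aae => x Ax; rewrite /g indicE mem_set// mul1r.
have Lg n : L2 (g n).
  have [mfn ifn] := hf n; apply: L2_ae_le (mg n) ifn _.
  by apply: filterS (ae_g n) => x ->.
exists f.
  have -> : f = (fun x => (f x - g 0%N x) + g 0%N x) by apply/funext => x; rewrite subrK.
  exact: L2D.
exists (2 / (1 - p) ^+ 2 * rintegral H) => n.
rewrite (_ : sqnorm _ = sqnorm (fun x => f x - g n x)); last first.
  apply: sqnorm_ae; [by apply: cmeasB => //; case: (hf n)|by apply: cmeasB|].
  by apply: filterS (ae_g n) => x ->.
rewrite mulrAC -rintegralZ//; apply: le_rintegral; [by case: (Lfg n)|exact: rintegrableZ|exact: fg].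
Qed.

End L2Complete.

Section NonnegativeSums.
Variables (T : choiceType) (R : realType).
Implicit Types (u v : T -> R) (s : seq T).

Lemma esum_ge_seq u s : (forall a, 0 <= u a) -> uniq s ->
  ((\sum_(a <- s) u a)%:E <= \esum_(a in setT) (u a)%:E)%E.
Proof.
move=> u0 us; apply: esum_ge; exists [set` s]; first by split.
by rewrite -fsbig_seq// -sumEFin.
Qed.

Lemma esum_le_seq u (M : \bar R) : (forall a, 0 <= u a) ->
  (forall s, uniq s -> ((\sum_(a <- s) u a)%:E <= M)%E) ->
  (\esum_(a in setT) (u a)%:E <= M)%E.
Proof.
move=> u0 h; apply: ge_ereal_sup => _ [F [finF _] <-].
by rewrite fsbig_finite//= sumEFin; apply: h; exact: finmap.fset_uniq.
Qed.

Lemma esum_approx_seq u (e : R) : (forall a, 0 <= u a) -> 0 < e ->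
  (\esum_(a in setT) (u a)%:E < +oo)%E ->
  exists2 s, uniq s & (\esum_(a in setT) (u a)%:E <= (\sum_(a <- s) u a + e)%:E)%E.
Proof.
move=> u0 e0 fin; set S := (X in (X < _)%E) in fin *.
have S0 : (0 <= S)%E by apply: esum_ge0 => a _; rewrite lee_fin.
apply: contrapT => H.
have : (S <= S - e%:E)%E.
  apply: esum_le_seq => // s us; rewrite leeBrDr// -EFinD.
  rewrite leNgt; apply/negP => /ltW h; apply: H; exists s => //.
have Sf : S \is a fin_num by rewrite ge0_fin_numE.
rewrite -(fineK Sf) -EFinB lee_fin; lra.
Qed.

End NonnegativeSums.

Section ComplexSums.
Variables (X : zmodType) (R : realType).
Local Notation C := (R[i]).
Implicit Types (f g : X -> C) (u v : X -> R).

Lemma rsum_sub u v (a b : R) : (forall x, 0 <= u x) -> (forall x, 0 <= v x) ->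
  (\esum_(x in setT) (u x)%:E = a%:E)%E -> (\esum_(x in setT) (v x)%:E = b%:E)%E ->
  rsum (fun x => u x - v x) = a - b.
Proof.
move=> u0 v0 ua vb; rewrite /rsum.
have m0 (w : X -> R) : (0 <= \esum_(x in setT) (Num.max (w x) 0)%:E)%E.
  by apply: esum_ge0 => x _; rewrite lee_fin le_max lexx orbT.
have ml (w z : X -> R) c : (forall x, 0 <= w x) -> (forall x, 0 <= z x) ->
    (\esum_(x in setT) (w x)%:E = c%:E)%E ->
    \esum_(x in setT) (Num.max (w x - z x) 0)%:E \is a fin_num.
  move=> w0 z0 wc; rewrite ge0_fin_numE//; apply: (@le_lt_trans _ _ c%:E); last by rewrite ltry.
  rewrite -wc; apply: le_esum => x _; rewrite lee_fin ge_max w0 andbT.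
  by rewrite gerBl.
have f1 := ml u v a u0 v0 ua; have f2 := ml v u b v0 u0 vb.
have -> : (fun x => (Num.max (- (u x - v x)) 0)%:E) = (fun x => (Num.max (v x - u x) 0)%:E).
  by apply/funext => x; rewrite opprB.
have : (\esum_(x in setT) ((Num.max (u x - v x) 0)%:E + (v x)%:E) =
       \esum_(x in setT) ((Num.max (v x - u x) 0)%:E + (u x)%:E))%E.
  apply: eq_esum => x _; rewrite -!EFinD; congr EFin.
  by rewrite /Num.max; case: ifP; case: ifP; lra.
rewrite !esumD//; try by move=> x _; rewrite lee_fin ?le_max ?lexx ?orbT.
rewrite ua vb; move: f1 f2; set A := esum _ _; set B := esum _ _.
by case: A => [a'| |]; case: B => [b'| |] //= _ _ []; lra.
Qed.

End ComplexSums.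

Lemma le0_of_geometric (R : realType) (x c q : R) : 0 <= q < 1 ->
  (forall n, x <= c * q ^+ n) -> x <= 0.
Proof.
move=> /andP[q0 q1] h.
have qc : q ^+ n @[n --> \oo] --> (0 : R) by apply: cvg_expr; rewrite ger0_norm.
have cq : c * q ^+ n @[n --> \oo] --> 0.
  suff : c * q ^+ n @[n --> \oo] --> c * 0 by rewrite mulr0.
  by apply: cvgM => //; exact: cvg_cst.
rewrite -(cvg_lim _ cq)//; apply: limr_ge; first exact: (cvgP _ cq).
exact: nearW.
Qed.

Section Parseval.
Variables (X : zmodType) (R : realType) (mu : probability (Gm X R) R) (P : set X).
Hypotheses (hP : positive_cone P) (hmu : haar mu).
Local Notation G := (Gm X R).
Local Notation C := (R[i]).
Implicit Types (f g h : G -> C) (c : X -> C) (s : seq X).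
Local Notation L2 := (L2 mu).
Local Notation sqnorm := (sqnorm mu).
Local Notation inner := (inner mu).
Local Notation cL1 := (cL1 mu).
Local Notation fourier := (fourier mu).

Definition trigsum c s : G -> C := fun x => \sum_(a <- s) c a * dchar x a.

Lemma trigsum_cons c a s : trigsum c (a :: s) = (fun x => c a * dchar x a + trigsum c s x).
Proof. by apply/funext => x; rewrite /trigsum big_cons. Qed.

Lemma trigsum_nil c : trigsum c [::] = fun=> 0.
Proof. by apply/funext => x; rewrite /trigsum big_nil. Qed.

Lemma L2_trigsum c s : L2 (trigsum c s).
Proof.
elim: s => [|a s IH]; first by rewrite trigsum_nil; exact: L2_cst.
by rewrite trigsum_cons; apply: L2D => //; apply: L2Z; exact: L2_dchar.
Qed.

Lemma fourier0 a : fourier (fun=> 0) a = 0.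
Proof.
rewrite /fourier; under eq_fun do rewrite mul0r.
exact: cint_cst.
Qed.

Lemma fourier_trigsum c s b : uniq s ->
  fourier (trigsum c s) b = if b \in s then c b else 0.
Proof.
elim: s => [|a s IH] /=; first by rewrite trigsum_nil fourier0.
move=> /andP[as_ us]; have La := L2_cL1 (L2_dchar mu a).
rewrite trigsum_cons fourierD ?fourierZ//; last 2 first.
- exact: cL1Z.
- exact/L2_cL1/L2_trigsum.
rewrite IH// (fourier_dchar a b hP hmu) inE [b == a]eq_sym.
have [E|ab] := eqVneq a b; last by rewrite mulr0 add0r.
by rewrite -E (negbTE as_) mulr1 addr0.
Qed.

Lemma sqnorm_sub_proj f a : L2 f ->
  sqnorm (fun x => f x - fourier f a * dchar x a) = sqnorm f - cabs (fourier f a) ^+ 2.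
Proof.
move=> hf; have La := L2_dchar mu a.
have -> : (fun x => f x - fourier f a * dchar x a) =
          (fun x => f x + (- fourier f a) * dchar x a).
  by apply/funext => x; rewrite mulNr.
rewrite sqnormD//; last exact: L2Z.
rewrite sqnormZ// sqnorm_dchar mulr1 cabsN.
have -> : inner f (fun x => - fourier f a * dchar x a) = conjc (- fourier f a) * fourier f a.
  by rewrite (innerJ (L2Z _ La) hf) innerZl// (innerJ hf La) rmorphM; congr (_ * _); exact: conjcK.
rewrite sqr_cabs; case: (fourier f a) => p q /=; ring.
Qed.

Lemma sqnorm_sub_trigsum f s : L2 f -> uniq s ->
  sqnorm (fun x => f x - trigsum (fourier f) s x) = sqnorm f - \sum_(a <- s) cabs (fourier f a) ^+ 2.
Proof.
move=> hf; elim: s => [_|a s IH] /=.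
  by rewrite big_nil subr0; apply: eq_rintegral => x; rewrite trigsum_nil subr0.
move=> /andP[as_ us]; set g := fun x => f x - trigsum (fourier f) s x.
have Lg : L2 g by apply: L2B => //; exact: L2_trigsum.
have ga : fourier g a = fourier f a.
  rewrite fourierB; [|exact: L2_cL1|exact/L2_cL1/L2_trigsum].
  by rewrite fourier_trigsum// (negbTE as_) subr0.
rewrite big_cons opprD addrCA addrC -IH// -{1}ga -sqnorm_sub_proj// ga.
by apply: eq_rintegral => x; rewrite trigsum_cons /g opprD addrA addrAC.
Qed.

Lemma bessel f s : L2 f -> uniq s -> \sum_(a <- s) cabs (fourier f a) ^+ 2 <= sqnorm f.
Proof. by move=> hf us; rewrite -subr_ge0 -sqnorm_sub_trigsum// sqnorm_ge0. Qed.

Lemma sqnorm_trigsum c s : uniq s -> sqnorm (trigsum c s) = \sum_(a <- s) cabs (c a) ^+ 2.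
Proof.
move=> us; have := sqnorm_sub_trigsum (L2_trigsum c s) us.
have -> : trigsum (fourier (trigsum c s)) s = trigsum c s.
  by apply/funext => x; apply: eq_big_seq => a an; rewrite fourier_trigsum// an.
have -> : \sum_(a <- s) cabs (fourier (trigsum c s) a) ^+ 2 = \sum_(a <- s) cabs (c a) ^+ 2.
  by apply: eq_big_seq => a an; rewrite fourier_trigsum// an.
move=> e; apply/eqP; rewrite -subr_eq0 -e -[X in _ == X](rintegral_cst mu 0); apply/eqP/eq_rintegral => x.
by rewrite subrr cabs0 expr0n.
Qed.

Lemma l2sq_bessel f : L2 f -> (l2sq (fourier f) <= (sqnorm f)%:E)%E.
Proof.
move=> hf; apply: esum_le_seq => [a|s us]; first exact: sqr_ge0.
by rewrite lee_fin bessel.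
Qed.

Lemma riesz_fischer c : (l2sq c < +oo)%E ->
  exists f, [/\ L2 f, forall a, fourier f a = c a & ((sqnorm f)%:E <= l2sq c)%E].
Proof.
move=> fin; set S := l2sq c in fin *.
pose u a := cabs (c a) ^+ 2.
have u0 a : 0 <= u a by exact: sqr_ge0.
have S0 : (0 <= S)%E by apply: esum_ge0 => a _; rewrite lee_fin sqr_ge0.
have Sf : S \is a fin_num by rewrite ge0_fin_numE.
pose p : R := 2^-1.
have p01 : 0 < p < 1 by rewrite /p; apply/andP; split; lra.
have pn0 n : 0 < p ^+ n by rewrite exprn_gt0//; case/andP: p01.
have [t ht] := choice (fun n => ex2_and (esum_approx_seq u0 (pn0 (4 * n)%N) fin)).
pose sg := fix sg n := if n is n'.+1 then undup (sg n' ++ t n) else t 0%N.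
have us n : uniq (sg n) by case: n => [|n]; [case: (ht 0%N)|exact: undup_uniq].
have sub n : {subset sg n <= sg n.+1}.
  by move=> a an; rewrite /= mem_undup mem_cat an.
have sumle s s' : uniq s -> uniq s' -> {subset s <= s'} ->
    \sum_(a <- s) u a <= \sum_(a <- s') u a.
  move=> us1 us2 ss; rewrite [leRHS](bigID (mem s))/= -[X in _ <= X + _]big_filter.
  have pe : perm_eq [seq a <- s' | a \in s] s.
    apply: uniq_perm => //; first exact: filter_uniq.
    by move=> a; rewrite mem_filter; case: (boolP (a \in s)) => // /ss ->.
  by rewrite (perm_big _ pe) lerDl sumr_ge0.
pose N n := \sum_(a <- sg n) u a.
have NS n : N n <= fine S by rewrite -lee_fin (fineK Sf); exact: esum_ge_seq.
have SN n : fine S <= N n + p ^+ (4 * n).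
  have [ut h] := ht n; rewrite -lee_fin (fineK Sf).
  apply: le_trans h _; rewrite lee_fin lerD2r; apply: sumle => //.
  by case: n {ut} => [|n] a // an; rewrite /= mem_undup mem_cat an orbT.
have cS n : trigsum (fourier (trigsum c (sg n.+1))) (sg n) = trigsum c (sg n).
  apply/funext => x; apply: eq_big_seq => a an.
  by rewrite fourier_trigsum// (sub _ _ an).
have step n : sqnorm (fun x => trigsum c (sg n.+1) x - trigsum c (sg n) x) <= 1 * p ^+ (4 * n).
  rewrite -(cS n) sqnorm_sub_trigsum//; last exact: L2_trigsum.
  rewrite sqnorm_trigsum// (_ : \sum_(a <- sg n) _ = N n); last first.
    by apply: eq_big_seq => a an; rewrite fourier_trigsum// (sub _ _ an).
  by have := NS n.+1; have := SN n; rewrite mul1r /N; lra.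
have [f Lf [K hK]] := L2_complete p01 (fun n => L2_trigsum c (sg n)) step.
have p2 : 0 <= p ^+ 2 < 1 by rewrite /p; apply/andP; split; lra.
have fc a : fourier f a = c a.
  apply/eqP; rewrite -subr_eq0 -cabs_eq0 -sqrf_eq0 eq_le sqr_ge0 andbT.
  apply: (@le0_of_geometric _ _ (2 * K + 2) _ p2) => n; rewrite -exprM.
  have h1 : cabs (fourier f a - fourier (trigsum c (sg n)) a) ^+ 2 <= K * p ^+ (2 * n).
    apply: le_trans (hK n); rewrite -fourierB; [|exact: L2_cL1|exact/L2_cL1/L2_trigsum].
    by apply: sqr_fourier_le; apply: L2B => //; exact: L2_trigsum.
  have h2 : cabs (fourier (trigsum c (sg n)) a - c a) ^+ 2 <= p ^+ (2 * n).
    rewrite fourier_trigsum//; case: ifP => an.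
      by rewrite subrr cabs0 expr0n ltW.
    rewrite sub0r cabsN; apply: (@le_trans _ _ (p ^+ (4 * n))).
      have : u a + N n <= fine S.
        rewrite -lee_fin (fineK Sf).
        have := @esum_ge_seq _ _ u (a :: sg n) u0.
        by rewrite big_cons /= an us => /(_ isT).
      by have := SN n; rewrite /u; lra.
    by rewrite ler_wiXn2l ?(ltW (proj1 (andP p01)))// ?leq_mul2r ?orbT// ltW//; case/andP: p01.
  have -> : fourier f a - c a =
    (fourier f a - fourier (trigsum c (sg n)) a) + (fourier (trigsum c (sg n)) a - c a).
    by rewrite addrA subrK.
  by apply: le_trans (cabsD_sqr _ _) _; rewrite mulrDl; lra.
exists f; split => //.
rewrite -(fineK Sf) lee_fin -subr_le0.
apply: (@le0_of_geometric _ _ K _ p2) => n; rewrite -exprM.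
apply: le_trans (hK n).
have := sqnorm_sub_trigsum Lf (us n).
have -> : trigsum (fourier f) (sg n) = trigsum c (sg n).
  by apply/funext => x; apply: eq_big_seq => a _; rewrite fc.
move=> ->; rewrite (_ : \sum_(a <- sg n) _ = N n); last first.
  by apply: eq_big_seq => a _; rewrite fc.
by have := NS n; lra.
Qed.

Lemma l2sq_fourier f : L2 f -> l2sq (fourier f) = (sqnorm f)%:E.
Proof.
move=> hf; apply/eqP; rewrite eq_le l2sq_bessel//=.
have [|g [Lg gf gn]] := @riesz_fischer (fourier f).
  by apply: le_lt_trans (l2sq_bessel hf) _; rewrite ltry.
rewrite -(@sqnorm_ae _ _ mu g f)//; [by case: Lg|by case: hf|].
by apply: eq_fourier_ae => //; exact: L2_cL1.
Qed.

Lemma rsum_fourier f g : L2 f -> L2 g ->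
  rsum (fun a => complex.Re (fourier f a * conjc (fourier g a))) = complex.Re (inner f g).
Proof.
move=> hf hg; pose k : C := (2^-1)%:C%C.
have hp : L2 (fun x => k * (f x + g x)) by apply: L2Z; exact: L2D.
have hm : L2 (fun x => k * (f x - g x)) by apply: L2Z; exact: L2B.
rewrite (_ : (fun a => _) = (fun a => cabs (fourier (fun x => k * (f x + g x)) a) ^+ 2 -
   cabs (fourier (fun x => k * (f x - g x)) a) ^+ 2)); last first.
  apply/funext => a; have cf := L2_cL1 hf; have cg := L2_cL1 hg.
  have cs := cL1D cf cg; have cd := cL1B cf cg.
  rewrite !fourierZ// (fourierD _ cf cg) (fourierB _ cf cg).
  rewrite !sqr_cabs /k; case: (fourier f a) (fourier g a) => p q [p' q'] /=; by field.
transitivity (sqnorm (fun x => k * (f x + g x)) - sqnorm (fun x => k * (f x - g x))).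
  by apply: rsum_sub (l2sq_fourier hp) (l2sq_fourier hm) => a; exact: sqr_ge0.
rewrite !sqnormZ; [|exact: L2B|exact: L2D].
rewrite cabsR ger0_norm ?invr_ge0// (sqnormD hf hg) (sqnormD hf (L2N hg)) sqnormN.
rewrite (_ : inner f (fun x => - g x) = - inner f g) ?creN; last first.
  rewrite -cintN; last exact: inner_cL1.
  by congr cint; apply/funext => x; rewrite rmorphN mulrN.
by field.
Qed.

Lemma csum_fourier f g : L2 f -> L2 g ->
  csum (fun a => fourier f a * conjc (fourier g a)) = inner f g.
Proof.
move=> hf hg; apply: complex_ext; first exact: rsum_fourier.
pose i : C := Complex 0 1.
have e z w : complex.Im (z * conjc w) = complex.Re (z * conjc (i * w)) :> R.
  by case: z w => p q [p' q'] /=; ring.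
transitivity (rsum (fun a => complex.Re (fourier f a *
    conjc (fourier (fun x => i * g x) a)))).
  congr rsum; apply/funext => a; rewrite (fourierZ _ _ (L2_cL1 hg)); exact: e.
rewrite rsum_fourier//; last exact: L2Z.
rewrite Re_cint Im_cint; apply: eq_rintegral => x; exact/esym/e.
Qed.

Lemma convol_fourier F M f b : essbd mu F M -> L2 f ->
  convol (fourier F) (fourier f) b = fourier (fun x => F x * f x) b.
Proof.
move=> hF hf; pose g x := conjc (F x) * dchar x b.
have hg : L2 g by apply: (essbd_L2 (M := M * 1)); apply: essbdM; [exact: essbdJ|exact: essbd_dchar].
rewrite /convol (_ : (fun a => _) = (fun a => fourier f a * conjc (fourier g a))); last first.
  apply/funext => a; rewrite mulrC; congr (_ * _).
  rewrite -cintJ; last exact/cL1_dchar/L2_cL1.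
  congr cint; apply/funext => x; rewrite /g dcharB !rmorphM /= !conjcK; ring.
rewrite csum_fourier//; congr cint; apply/funext => x.
by rewrite /g rmorphM /= conjcK; ring.
Qed.

End Parseval.

(** * Toeplitz operators *)

Section Toeplitz.
Variables (X : zmodType) (R : realType) (mu : probability (Gm X R) R) (P : set X).
Hypotheses (hP : positive_cone P) (hmu : haar mu).
Local Notation G := (Gm X R).
Local Notation C := (R[i]).
Implicit Types (f F y r w : G -> C) (g : X -> C).
Local Notation L2 := (L2 mu).
Local Notation sqnorm := (sqnorm mu).
Local Notation inner := (inner mu).
Local Notation essbd := (essbd mu).
Local Notation cL1 := (cL1 mu).
Local Notation fourier := (fourier mu).

Definition H2 f := L2 f /\ forall a, ~ P a -> fourier f a = 0.
Definition hinf f M := essbd f M /\ forall a, ~ P a -> fourier f a = 0.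

Lemma H2_l2plus f : H2 f -> l2plus P (fourier f).
Proof. by move=> [hf f0]; split => //; rewrite (l2sq_fourier hP hmu hf) ltry. Qed.

Lemma l2plus_H2 g : l2plus P g -> exists2 f, H2 f & g = fourier f.
Proof.
move=> [g0 /(riesz_fischer hP hmu)[f [hf fg _]]]; exists f; last exact/funext.
by split => // a /g0; rewrite fg.
Qed.

Lemma csum0 : csum (fun _ : X => 0 : C) = 0.
Proof.
have -> : csum (fun _ : X => 0 : C) = Complex (rsum (fun _ : X => 0 : R)) (rsum (fun _ : X => 0 : R)) by [].
have z : (\esum_(a in (setT : set X)) (0 : R)%:E)%E = 0%:E by rewrite esum1.
suff -> : rsum (fun _ : X => 0 : R) = 0 by [].
have := @rsum_sub X R (fun=> 0) (fun=> 0) 0 0 (fun=> lexx _) (fun=> lexx _) z z.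
rewrite [RHS]subrr => h; apply: etrans h; congr rsum.
by apply/funext => x; rewrite subrr.
Qed.

Lemma inner_eq0 r f : L2 r -> L2 f ->
  (forall a, fourier r a * conjc (fourier f a) = 0) -> inner r f = 0.
Proof.
move=> hr hf h; rewrite -(csum_fourier hP hmu hr hf) -csum0; congr csum.
exact/funext.
Qed.

Lemma inner_eq_on r w f : L2 r -> L2 w -> H2 f ->
  (forall a, P a -> fourier r a = fourier w a) -> inner r f = inner w f.
Proof.
move=> hr hw [hf f0] e; apply/eqP; rewrite -subr_eq0 -innerBl//; apply/eqP.
apply: inner_eq0 => //; first exact: L2B.
move=> a; have [Pa|nPa] := pselect (P a); last by rewrite f0// conjc0 mulr0.
by rewrite fourierB ?e ?subrr ?mul0r//; exact: L2_cL1.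
Qed.

Lemma sqnorm_H2_le r w : H2 r -> L2 w -> (forall a, P a -> fourier r a = fourier w a) ->
  sqnorm r <= sqnorm w.
Proof.
move=> [hr r0] hw e; rewrite -lee_fin -!(l2sq_fourier hP hmu)//; apply: le_esum => a _.
have [Pa|nPa] := pselect (P a); first by rewrite e.
by rewrite r0// cabs0 expr0n /= lee_fin sqr_ge0.
Qed.

Lemma H2_projection w : L2 w -> exists2 r, H2 r & forall a, P a -> fourier r a = fourier w a.
Proof.
move=> hw; have [|r hr e] := @l2plus_H2 (fun a => if `[< P a >] then fourier w a else 0).
  split; first by move=> a /asboolPn /negbTE ->.
  apply: le_lt_trans (ltry (sqnorm w)); rewrite -(l2sq_fourier hP hmu)//; apply: le_esum => a _.
  by case: ifP => // _; rewrite cabs0 expr0n /= lee_fin sqr_ge0.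
by exists r => // a Pa; rewrite -e asboolT.
Qed.

Lemma sqnorm_sub_H2_projection r w : H2 r -> L2 w ->
  (forall a, P a -> fourier r a = fourier w a) -> sqnorm (fun x => w x - r x) = sqnorm w - sqnorm r.
Proof.
move=> hr hw e; have [Lr _] := hr.
have -> : sqnorm w = sqnorm (fun x => (w x - r x) + r x).
  by apply: eq_rintegral => x; rewrite subrK.
rewrite (sqnormD (L2B hw Lr) Lr).
rewrite (_ : inner _ _ = 0) ?mulr0 ?addr0 ?addrK//.
by rewrite innerBl// (@inner_eq_on w r)// ?subrr// => a Pa; rewrite e.
Qed.

Lemma H2D r w : H2 r -> H2 w -> H2 (fun x => r x + w x).
Proof.
move=> [hr r0] [hw w0]; split; first exact: L2D.
by move=> a nPa; rewrite fourierD ?r0 ?w0 ?addr0//; exact: L2_cL1.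
Qed.

Lemma H2Z c r : H2 r -> H2 (fun x => c * r x).
Proof.
move=> [hr r0]; split; first exact: L2Z.
by move=> a nPa; rewrite fourierZ ?r0 ?mulr0//; exact: L2_cL1.
Qed.

Lemma Wk_fourier F M f r : essbd F M -> L2 f -> H2 r ->
  (forall a, P a -> fourier r a = fourier (fun x => F x * f x) a) ->
  Wk P (fourier F) (fourier f) = fourier r.
Proof.
move=> hF hf [_ r0] e; apply/funext => a; rewrite /Wk.
rewrite (convol_fourier hP hmu _ hF hf).
by case: ifPn => [/asboolP Pa|/asboolPn nPa]; [rewrite e|rewrite r0].
Qed.

Lemma Wk_fourierP F M f : essbd F M -> L2 f -> exists r, [/\ H2 r,
  forall a, P a -> fourier r a = fourier (fun x => F x * f x) a
  & Wk P (fourier F) (fourier f) = fourier r].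
Proof.
move=> hF hf; have [r hr e] := H2_projection (L2_essbdM hF hf).
by exists r; split => //; exact: Wk_fourier hF hf hr e.
Qed.

Lemma bounded_Wk F M : essbd F M -> bounded_op P (Wk P (fourier F)).
Proof.
move=> hF; split.
- move=> _ /l2plus_H2[f [hf _] ->]; have [r [hr _ ->]] := Wk_fourierP hF hf.
  exact: H2_l2plus.
- move=> c _ _ /l2plus_H2[f [hf f0] ->] /l2plus_H2[w [hw w0] ->].
  have -> : (fun a => c * fourier f a + fourier w a) = fourier (fun x => c * f x + w x).
    apply/funext => a; rewrite fourierD ?fourierZ//; try exact: L2_cL1.
    by apply: cL1Z; exact: L2_cL1.
  have [r [hr re ->]] := Wk_fourierP hF hf; have [s [hs se ->]] := Wk_fourierP hF hw.
  rewrite (@Wk_fourier _ M _ (fun x => c * r x + s x))//.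
  + apply/funext => a; have [[Lr _] [Ls _]] := (hr, hs).
    rewrite fourierD ?fourierZ//; try exact: L2_cL1.
    by apply: cL1Z; exact: L2_cL1.
  + by apply: L2D => //; exact: L2Z.
  + by apply: H2D => //; exact: H2Z.
  + move=> a Pa; have [[Lr _] [Ls _]] := (hr, hs).
    have c1 := L2_cL1 (L2_essbdM hF hf); have c2 := L2_cL1 (L2_essbdM hF hw).
    have [cr cs] := (L2_cL1 Lr, L2_cL1 Ls); have cr' := cL1Z c cr; have c1' := cL1Z c c1.
    rewrite fourierD ?fourierZ// re// se// -fourierZ// -fourierD//.
    by congr fourier; apply/funext => x; ring.
- exists (M ^+ 2) => _ /l2plus_H2[f [hf _] ->].
  have [r [hr re ->]] := Wk_fourierP hF hf; have [Lr _] := hr.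
  rewrite !(l2sq_fourier hP hmu)// -EFinM lee_fin.
  apply: le_trans (sqnorm_H2_le hr _ re) _; first exact: L2_essbdM hF hf.
  exact: sqnorm_essbdM.
Qed.

Lemma fourier_conj f a : cL1 f -> fourier (fun x => conjc (f x)) a = conjc (fourier f (- a)).
Proof.
move=> hf; rewrite /Defs.fourier -cintJ; last exact: cL1_dchar.
by congr cint; apply/funext => x; rewrite rmorphM /= conjcK dcharN.
Qed.

Lemma H2_hinfM h N f : hinf h N -> H2 f -> H2 (fun x => h x * f x).
Proof.
move=> [hh h0] [hf f0]; split; first exact: L2_essbdM hh hf.
move=> a nPa; rewrite -(convol_fourier hP hmu _ hh hf) -csum0; congr csum.
apply/funext => b; have [Pb|/f0 ->] := pselect (P b); last by rewrite mulr0.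
rewrite h0 ?mul0r// => Pab; apply: nPa.
by have [PD _ _] := hP; rewrite -(subrK b a); exact: PD.
Qed.

Lemma Wk_hinf h N f : hinf h N -> H2 f ->
  Wk P (fourier h) (fourier f) = fourier (fun x => h x * f x).
Proof.
move=> hh hf; have [bh _] := hh; have [Lf _] := hf.
by apply: Wk_fourier bh Lf (H2_hinfM hh hf) _.
Qed.

Lemma Wk_comp_analytic F M h N g : essbd F M -> hinf h N -> l2plus P g ->
  Wk P (fourier F) (Wk P (fourier h) g) = Wk P (fourier (fun x => F x * h x)) g.
Proof.
move=> hF hh /l2plus_H2[f hf ->]; rewrite (Wk_hinf hh hf).
have [Lhf _] := H2_hinfM hh hf; have [bh _] := hh; have [Lf _] := hf.
have [r [hr re ->]] := Wk_fourierP hF Lhf.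
rewrite (Wk_fourier (essbdM hF bh) Lf hr)// => a Pa; rewrite re//.
by congr fourier; apply/funext => x; rewrite mulrA.
Qed.

Lemma Wk_comp_coanalytic F M h N g : essbd F M -> hinf h N -> l2plus P g ->
  Wk P (fourier (fun x => conjc (h x))) (Wk P (fourier F) g) =
  Wk P (fourier (fun x => conjc (h x) * F x)) g.
Proof.
move=> hF [bh h0] /l2plus_H2[f [hf f0] ->].
have bJ := essbdJ bh; have Lh := essbd_L2 bh.
have [r [hr re ->]] := Wk_fourierP hF hf; have [Lr _] := hr.
have [s [hs se ->]] := Wk_fourierP bJ Lr.
rewrite (Wk_fourier (essbdM bJ hF) hf hs)// => a Pa; rewrite se//.
have LFf := L2_essbdM hF hf.
apply/eqP; rewrite eq_sym -subr_eq0; apply/eqP.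
rewrite -fourierB; last 2 first.
- by apply: L2_cL1; apply: L2_essbdM hf; exact: essbdM bJ hF.
- by apply: L2_cL1; apply: L2_essbdM bJ Lr.
have -> : (fun x => conjc (h x) * F x * f x - conjc (h x) * r x) =
          (fun x => conjc (h x) * (F x * f x - r x)).
  by apply/funext => x; rewrite mulrBr mulrA.
rewrite -(convol_fourier hP hmu _ bJ (L2B LFf Lr)) -csum0; congr csum.
apply/funext => b; rewrite fourierB; [|exact: L2_cL1..].
have [Pb|nPb] := pselect (P b); first by rewrite re// subrr mulr0.
rewrite fourier_conj; last exact: L2_cL1.
rewrite h0 ?conjc0 ?mul0r// opprB => Pba; apply: nPb.
by have [PD _ _] := hP; rewrite -(subrK a b); exact: PD.
Qed.

Lemma toeplitz_adjoint F M f w r s : essbd F M -> H2 f -> H2 w -> L2 r -> L2 s ->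
  (forall a, P a -> fourier r a = fourier (fun x => F x * f x) a) ->
  (forall a, P a -> fourier s a = fourier (fun x => conjc (F x) * w x) a) ->
  inner r w = inner f s.
Proof.
move=> hF hf hw hr hs re se; have [[Lf _] [Lw _]] := (hf, hw).
have LF := L2_essbdM hF Lf; have LJ := L2_essbdM (essbdJ hF) Lw.
rewrite (inner_eq_on hr LF hw re) (innerJ hs Lf) (inner_eq_on hs LJ hf se) -(innerJ LJ Lf).
by congr cint; apply/funext => x; rewrite rmorphM /= conjcK; ring.
Qed.

Lemma l2plusD c g1 g2 : l2plus P g1 -> l2plus P g2 -> l2plus P (fun a => c * g1 a + g2 a).
Proof.
move=> /l2plus_H2[f hf ->] /l2plus_H2[w hw ->].
have [[Lf _] [Lw _]] := (hf, hw).
have -> : (fun a => c * fourier f a + fourier w a) = fourier (fun x => c * f x + w x).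
  have cf := cL1Z c (L2_cL1 Lf); have cw := L2_cL1 Lw; have cf' := L2_cL1 Lf.
  by apply/funext => a; rewrite fourierD ?fourierZ.
by apply: H2_l2plus; apply: H2D => //; exact: H2Z.
Qed.

Lemma l2sq_eq0 g : (l2sq g <= 0)%E -> g = fun=> 0.
Proof.
move=> h; apply/funext => a; apply: cabs0_eq0; apply/eqP; rewrite -sqrf_eq0 eq_le sqr_ge0 andbT.
rewrite -lee_fin; apply: le_trans h.
have := @esum_ge_seq X R (fun a => cabs (g a) ^+ 2) [:: a] (fun=> sqr_ge0 _) isT.
by rewrite big_seq1.
Qed.

Lemma invertible_of_bijective (T : (X -> C) -> (X -> C)) (M : R) : bounded_op P T ->
  (forall v, l2plus P v -> exists2 x, l2plus P x & T x = v) ->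
  (forall x, l2plus P x -> (l2sq x <= M%:E * l2sq (T x))%E) ->
  invertible_op P T.
Proof.
move=> hT sur low; split => //; have [T1 T2 _] := hT.
have inj x v : l2plus P x -> l2plus P v -> T x = T v -> x = v.
  move=> hx hv e; have hxy := l2plusD (-1) hv hx.
  have z : T (fun a => -1 * v a + x a) = fun=> 0.
    by rewrite T2// e; apply/funext => a; rewrite mulN1r addNr.
  have := low _ hxy; rewrite z (_ : l2sq (fun=> 0) = 0%E) ?mule0; last first.
    by rewrite /l2sq esum1// => a _; rewrite cabs0 expr0n.
  move=> /l2sq_eq0 /funeqP d; apply/funext => a; have := d a.
  by rewrite mulN1r addrC => /eqP; rewrite subr_eq0 => /eqP.
have [B hB] := choice (fun v => ex2_and (P := fun x => l2plus P v -> l2plus P x)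
  (Q := fun x => l2plus P v -> T x = v)
  (match pselect (l2plus P v) with
   | left h => let: ex_intro2 x hx e := sur v h in ex_intro2 _ _ x (fun=> hx) (fun=> e)
   | right h => ex_intro2 _ _ v (fun k => False_ind _ (h k)) (fun k => False_ind _ (h k)) end)).
have B1 v : l2plus P v -> l2plus P (B v) by case: (hB v).
have B2 v : l2plus P v -> T (B v) = v by case: (hB v).
exists B; split => //; last first.
  by move=> g hg; apply: inj => //; [exact/B1/T1|rewrite B2//; exact: T1].
split => //.
- move=> c g h hg hh; have hgh := l2plusD c hg hh.
  apply: inj; [exact: B1|by apply: l2plusD; exact: B1|].
  by rewrite B2// T2 ?B2//; exact: B1.
- exists M => g hg; rewrite -{2}(B2 _ hg); apply: low; exact: B1.
Qed.

(* Neumann series: [1 - T_F] is a strict contraction of [H^2]. *)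
Lemma toeplitz_solve F (c : R) y : 0 < c < 1 -> cmeasurable F ->
  essbd (fun x => 1 - F x) c -> H2 y ->
  exists2 x, H2 x & forall a, P a -> fourier (fun t => F t * x t) a = fourier y a.
Proof.
move=> c01 mF hF hy; have [c0 c1] := andP c01.
have bF : essbd F (1 + c).
  have := essbdB (essbd_cst mu 1) hF; rewrite cabs1; congr (essbd _ _).
  by apply/funext => x; rewrite opprB addrCA subrr addr0.
pose S w x := (1 - F x) * w x.
have LS w : L2 w -> L2 (S w) by exact: L2_essbdM hF.
have [pi hpi] := choice (fun w => ex2_and (P := fun r => L2 w -> H2 r)
  (Q := fun r => L2 w -> forall a, P a -> fourier r a = fourier w a)
  (match pselect (L2 w) with
   | left h => let: ex_intro2 r hr e := H2_projection h in ex_intro2 _ _ r (fun=> hr) (fun=> e)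
   | right h => ex_intro2 _ _ w (fun k => False_ind _ (h k)) (fun k => False_ind _ (h k)) end)).
have pi1 w : L2 w -> H2 (pi w) by case: (hpi w).
have pi2 w a : L2 w -> P a -> fourier (pi w) a = fourier w a.
  by case: (hpi w) => _ h /h; exact.
pose f_ := fix f_ n : G -> C := if n is n'.+1 then fun x => y x + pi (S (f_ n')) x else y.
have fH n : H2 (f_ n).
  by elim: n => [//|n [Ln _]] /=; apply: H2D => //; exact/pi1/LS.
have fL n : L2 (f_ n) by case: (fH n).
have [Ly _] := hy.
have dH n : H2 (fun x => f_ n.+1 x - f_ n x).
  have -> : (fun x => f_ n.+1 x - f_ n x) = (fun x => f_ n.+1 x + (-1) * f_ n x).
    by apply/funext => x; rewrite mulN1r.
  by apply: H2D => //; exact: H2Z.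
have contr n : sqnorm (fun x => f_ n.+2 x - f_ n.+1 x) <= c ^+ 2 * sqnorm (fun x => f_ n.+1 x - f_ n x).
  have [Ld _] := dH n; apply: le_trans (sqnorm_essbdM hF Ld).
  apply: sqnorm_H2_le => //; first exact: LS.
  move=> a Pa; have hc := fun w (hw : L2 w) => L2_cL1 hw.
  have [Lp1 _] := pi1 _ (LS _ (fL n)); have [Lp2 _] := pi1 _ (LS _ (fL n.+1)).
  rewrite (_ : (fun x => f_ n.+2 x - f_ n.+1 x) =
     (fun x => pi (S (f_ n.+1)) x - pi (S (f_ n)) x)); last first.
    by apply/funext => x /=; rewrite opprD addrACA subrr add0r.
  rewrite (fourierB _ (hc _ Lp2) (hc _ Lp1)) !pi2//; try exact: LS.
  rewrite -(fourierB _ (hc _ (LS _ (fL n.+1))) (hc _ (LS _ (fL n)))).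
  by congr fourier; apply/funext => x; rewrite /S mulrBr.
pose p := Num.sqrt c.
have p01 : 0 < p < 1.
  by rewrite /p sqrtr_gt0 c0 -sqrtr1 ltr_sqrt.
have p4 n : p ^+ (4 * n) = (c ^+ 2) ^+ n.
  have -> : (4 * n = 2 * (2 * n))%N by rewrite mulnA.
  by rewrite exprM /p sqr_sqrtr ?(ltW c0)// -exprM.
have rate n : sqnorm (fun x => f_ n.+1 x - f_ n x) <=
    sqnorm (fun x => f_ 1%N x - f_ 0%N x) * p ^+ (4 * n).
  rewrite p4; elim: n => [|n IH]; first by rewrite expr0 mulr1.
  apply: le_trans (contr n) _; rewrite [(c ^+ 2) ^+ n.+1]exprS mulrCA.
  by rewrite ler_wpM2l ?sqr_ge0.
have [x Lx [K hK]] := L2_complete p01 fL rate.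
have p2 : 0 <= p ^+ 2 < 1.
  by rewrite sqr_ge0 /= sqr_sqrtr ?(ltW c0).
have K0 : 0 <= K by have := hK 0%N; rewrite muln0 expr0 mulr1; exact/le_trans/sqnorm_ge0.
have xlim a n : cabs (fourier x a - fourier (f_ n) a) ^+ 2 <= K * (p ^+ 2) ^+ n.
  rewrite -exprM; apply: le_trans (hK n); rewrite -fourierB; [|exact: L2_cL1..].
  by apply: sqr_fourier_le; exact: L2B.
have small (z : C) (D : R) : (forall n, cabs z ^+ 2 <= D * (p ^+ 2) ^+ n) -> z = 0.
  move=> h; apply: cabs0_eq0; apply/eqP; rewrite -sqrf_eq0 eq_le sqr_ge0 andbT.
  exact: le0_of_geometric p2 h.
exists x.
  split => // a nPa; apply: (small _ K) => n; apply: le_trans (xlim a n).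
  by have [_ ->//] := fH n; rewrite subr0.
move=> a Pa; apply/eqP; rewrite -subr_eq0; apply/eqP.
have LFx := L2_essbdM bF Lx.
apply: (small _ (4 * K)) => n.
have -> : fourier (fun t => F t * x t) a - fourier y a =
    (fourier x a - fourier (f_ n.+1) a) + (fourier (S (f_ n)) a - fourier (S x) a).
  have [Lp _] := pi1 _ (LS _ (fL n)).
  rewrite /= (fourierD _ (L2_cL1 Ly) (L2_cL1 Lp)) pi2//; last exact: LS.
  have -> : fourier (S x) a = fourier x a - fourier (fun t => F t * x t) a.
    rewrite -fourierB; [|exact: L2_cL1..].
    by congr fourier; apply/funext => t; rewrite /S mulrBl mul1r.
  by ring.
apply: le_trans (cabsD_sqr _ _) _.
have h1 : cabs (fourier x a - fourier (f_ n.+1) a) ^+ 2 <= K * (p ^+ 2) ^+ n.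
  apply: le_trans (xlim a n.+1) _; rewrite [(p ^+ 2) ^+ n.+1]exprS ler_wpM2l//.
  have [p20 p21] := andP p2; have q0 : 0 <= (p ^+ 2) ^+ n by exact: exprn_ge0.
  by rewrite ler_piMl// ltW.
have h2 : cabs (fourier (S (f_ n)) a - fourier (S x) a) ^+ 2 <= K * (p ^+ 2) ^+ n.
  rewrite -fourierB; [|exact/L2_cL1/LS..].
  rewrite -exprM; apply: le_trans (hK n); apply: (@le_trans _ _ (sqnorm (S (fun t => f_ n t - x t)))).
    rewrite (_ : (fun t => S (f_ n) t - S x t) = S (fun t => f_ n t - x t)).
      by apply: sqr_fourier_le; apply: LS; exact: L2B.
    by apply/funext => t; rewrite /S mulrBr.
  apply: le_trans (sqnorm_essbdM hF (L2B (fL n) Lx)) _.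
  rewrite -sqnormN (_ : (fun t => - (f_ n t - x t)) = (fun t => x t - f_ n t)); last first.
    by apply/funext => t; rewrite opprB.
  by rewrite ler_piMl ?sqnorm_ge0// expr_le1// ltW.
lra.
Qed.

Lemma toeplitz_invertible F (c : R) : c < 1 -> cmeasurable F ->
  essbd (fun x => 1 - F x) c -> invertible_op P (Wk P (fourier F)).
Proof.
move=> c1 mF hF0; pose c' := Num.max c 2^-1.
have c01 : 0 < c' < 1.
  by rewrite /c' lt_max gt_max c1 invr_gt0 ltr0n orbT /=; lra.
have hF : essbd (fun x => 1 - F x) c'.
  case: hF0 => m h; split => //; apply: filterS h => x h.
  by rewrite (le_trans h)// le_max lexx.
have bF : essbd F (1 + c').
  have := essbdB (essbd_cst mu 1) hF; rewrite cabs1; congr (essbd _ _).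
  by apply/funext => x; rewrite opprB addrCA subrr addr0.
have [c0 c'1] := andP c01.
apply: (invertible_of_bijective (M := (1 - c') ^- 2) (bounded_Wk bF)).
- move=> _ /l2plus_H2[y hy ->].
  have [x hx e] := toeplitz_solve c01 mF hF hy.
  exists (fourier x); first exact: H2_l2plus.
  by have [Lx _] := hx; rewrite (Wk_fourier bF Lx hy)// => a Pa; rewrite e.
- move=> _ /l2plus_H2[x hx ->]; have [Lx _] := hx.
  have [y [hy ye ->]] := Wk_fourierP bF Lx; have [Ly _] := hy.
  rewrite !(l2sq_fourier hP hmu)// -EFinM lee_fin ler_pdivlMl ?exprn_gt0 ?subr_gt0//.
  have LS := L2_essbdM hF Lx; have LF := L2_essbdM bF Lx.
  have e : inner y x = inner x x - inner (fun t => (1 - F t) * x t) x.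
    rewrite (inner_eq_on Ly LF hx ye) -innerBl//; congr cint; apply/funext => t; ring.
  have h1 := inner_cauchy_schwarz Ly Lx; have h2 := inner_cauchy_schwarz LS Lx.
  have h3 := sqnorm_essbdM hF Lx.
  have h4 : cabs (inner (fun t => (1 - F t) * x t) x) <= c' * sqnorm x.
    rewrite -(@ler_pXn2r _ 2)// ?nnegrE ?cabs_ge0 ?mulr_ge0 ?sqnorm_ge0// ?(ltW c0)//.
    by apply: le_trans h2 _; rewrite exprMn [sqnorm x ^+ 2]expr2 mulrA ler_wpM2r ?sqnorm_ge0.
  have h5 : (1 - c') * sqnorm x <= cabs (inner y x).
    rewrite e inner_self//; have := cabsD ((sqnorm x)%:C%C - inner (fun t => (1 - F t) * x t) x)
      (inner (fun t => (1 - F t) * x t) x).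
    by rewrite subrK cabsR ger0_norm ?sqnorm_ge0//; lra.
  have [->|xn] := eqVneq (sqnorm x) 0; first by rewrite mulr0 sqnorm_ge0.
  have xp : 0 < sqnorm x by rewrite lt_neqAle eq_sym xn sqnorm_ge0.
  rewrite -(ler_pM2r xp); apply: le_trans h1; apply: le_trans (lerXn2r 2 _ _ h5).
  + by rewrite exprMn [sqnorm x ^+ 2]expr2 mulrA.
  + by rewrite nnegrE mulr_ge0 ?sqnorm_ge0// subr_ge0 ltW.
  + by rewrite nnegrE cabs_ge0.
Qed.

End Toeplitz.

(** * Approximate outer functions *)

Section LogSeries.
Variable R : realType.
Implicit Types x : R.

Definition logser N x : R := \sum_(j < N) x ^+ j.+1 / j.+1%:R.

Lemma is_derive_logser N x : is_derive x 1 (logser N) (\sum_(j < N) x ^+ j).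
Proof.
elim: N => [|N IH].
  rewrite (_ : logser 0 = cst 0) ?big_ord0; last by apply/funext => y; rewrite /logser big_ord0.
  exact: is_derive_cst.
have -> : logser N.+1 = logser N \+ (N.+1%:R^-1 \*: (@id R) ^+ N.+1).
  apply/funext => y; rewrite /logser big_ord_recr/=; congr (_ + _).
  by rewrite mulrC exprfctE.
apply: is_derive_eq; rewrite big_ord_recr/=; congr (_ + _).
by rewrite -[_%:A]/(_ * 1) mulr1 -[LHS]/(_ * _) mulrA mulVf ?mul1r// pnatr_eq0.
Qed.

Lemma expR_logser_bounds N x : 0 <= x < 1 ->
  expR (logser N x) * (1 - x) <= 1 /\
  1 - x ^+ N / (1 - x) <= expR (logser N x) * (1 - x).
Proof.
pose f (y : R) : R := expR (logser N y) * (1 - y).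
have df (y : R) : is_derive y 1 f (- (y ^+ N * expR (logser N y))).
  have dL := is_derive_logser N y.
  have dE : is_derive y 1 (expR \o logser N) (expR (logser N y) * \sum_(j < N) y ^+ j).
    exact: is_derive1_comp.
  have dO : is_derive y 1 (fun z : R => 1 - z) (-1).
    have -> : (fun z : R => 1 - z) = (cst 1 - id) by [].
    by apply: is_derive_eq; rewrite sub0r.
  have -> : f = (expR \o logser N) * (fun z => 1 - z) by [].
  apply: is_derive_eq; rewrite /= -![_ *: _]/(_ * _).
  have := subrX1 y N.
  set S := \sum_(i < N) _; set E := expR _ => e.
  rewrite [(1 - y) * _]mulrCA (_ : (1 - y) * S = 1 - y ^+ N); first by ring.
  by rewrite -opprB mulNr -e opprB.
have mvt (y : R) : 0 <= y -> exists2 c, 0 <= c <= y & f y - 1 = - (c ^+ N * expR (logser N c)) * y.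
  move=> y0; have cf : {within `[0, y], continuous f}.
    apply: continuous_subspaceT => z; apply/differentiable_continuous/derivable1_diffP.
    by have [] := df z.
  have [c cy e] := MVT_segment y0 (fun z _ => df z) cf.
  exists c; first by move: cy; rewrite in_itv.
  rewrite -[y in RHS]subr0 -e; congr (_ - _); rewrite /f subr0 mulr1.
  by rewrite /logser big1 ?expR0// => j _; rewrite expr0n mul0r.
have up (y : R) : 0 <= y -> f y <= 1.
  move=> y0; have [c /andP[c0 _] e] := mvt y y0.
  by rewrite -subr_le0 e mulNr oppr_le0 mulr_ge0// mulr_ge0 ?exprn_ge0 ?expR_ge0.
move=> /andP[x0 x1]; split; first exact: up.
have [c /andP[c0 cx] e] := mvt x x0.
have E0 : 0 <= expR (logser N c) by exact: expR_ge0.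
have : expR (logser N c) * (1 - x) <= 1.
  apply: le_trans (up c c0); rewrite /f ler_wpM2l//; lra.
rewrite -ler_pdivlMr ?subr_gt0// div1r => Ex.
have cN : c ^+ N <= x ^+ N by rewrite lerXn2r ?nnegrE.
have : c ^+ N * expR (logser N c) <= x ^+ N / (1 - x) by rewrite ler_pM ?exprn_ge0.
have : c ^+ N * expR (logser N c) * x <= c ^+ N * expR (logser N c).
  by rewrite ler_piMr ?mulr_ge0 ?exprn_ge0// ltW.
move: e; rewrite /f; lra.
Qed.
End LogSeries.

Section RealEstimates.
Variable R : realType.
Implicit Types x y : R.

Lemma expR_le_inv y : y < 1 -> expR y <= (1 - y)^-1.
Proof.
move=> y1; have h : 1 - y <= expR (- y) by exact: expR_ge1Dx.
have p : 0 < 1 - y by rewrite subr_gt0.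
by rewrite -[expR y]invrK -expRN lef_pV2 ?posrE ?expR_gt0.
Qed.

Lemma sqr_cabs_1DX_le (z : R[i]) m : (0 < m)%N ->
  cabs ((1 + (m%:R^-1)%:C%C * z) ^+ m) ^+ 2 <=
  expR (2 * complex.Re z) * expR (cabs z ^+ 2 / m%:R).
Proof.
move=> m0; have mp : (0 : R) < m%:R by rewrite ltr0n.
have mn : (m%:R : R) != 0 by rewrite gt_eqF.
rewrite cabsX -exprM mulnC exprM -expRD.
have -> : 2 * complex.Re z + cabs z ^+ 2 / m%:R =
    m%:R * (m%:R^-1 * (2 * complex.Re z + cabs z ^+ 2 / m%:R)) by rewrite mulrA divff// mul1r.
rewrite expRM_natl lerXn2r ?nnegrE ?sqr_ge0 ?expR_ge0//.
apply: le_trans (expR_ge1Dx _); rewrite le_eqVlt; apply/orP; left; apply/eqP.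
by rewrite !sqr_cabs; case: z => p q /=; field.
Qed.

Lemma cabs_1DX_sub1 (z : R[i]) m : cabs ((1 + z) ^+ m - 1) <= (1 + cabs z) ^+ m - 1.
Proof.
elim: m => [|m IH]; first by rewrite !expr0 !subrr cabs0.
have -> : (1 + z) ^+ m.+1 - 1 = (1 + z) * ((1 + z) ^+ m - 1) + z by rewrite exprS; ring.
have -> : (1 + cabs z) ^+ m.+1 - 1 = (1 + cabs z) * ((1 + cabs z) ^+ m - 1) + cabs z.
  by rewrite exprS; ring.
apply: le_trans (cabsD _ _) _; rewrite lerD2r cabsM ler_pM ?cabs_ge0//.
by apply: le_trans (cabsD _ _) _; rewrite cabs1.
Qed.

Lemma cabs_1DX_mul_sub1 (z : R[i]) m : (0 < m)%N ->
  cabs ((1 + (m%:R^-1)%:C%C * z) ^+ m * (1 + (m%:R^-1)%:C%C * (- z)) ^+ m - 1) <=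
  expR (cabs z ^+ 2 / m%:R) - 1.
Proof.
move=> m0; have mp : (0 : R) < m%:R by rewrite ltr0n.
have mn : (m%:R : R) != 0 by rewrite gt_eqF.
rewrite -exprMn.
have -> : (1 + (m%:R^-1)%:C%C * z) * (1 + (m%:R^-1)%:C%C * - z) =
    1 + - ((m%:R^-1)%:C%C * z) ^+ 2 by ring.
apply: le_trans (cabs_1DX_sub1 _ _) _; rewrite lerD2r.
rewrite cabsN cabsX cabsM cabsR ger0_norm ?invr_ge0 ?ler0n//.
have -> : cabs z ^+ 2 / m%:R = m%:R * (m%:R^-1 * cabs z) ^+ 2 by field.
by rewrite expRM_natl lerXn2r ?nnegrE ?expR_ge0 ?addr_ge0 ?sqr_ge0 ?expR_ge1Dx.
Qed.

End RealEstimates.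

Section TrigonometricPolynomials.
Variables (X : zmodType) (R : realType).
Local Notation G := (Gm X R).
Local Notation C := (R[i]).
Implicit Types (S : set X) (f g : G -> C).

Inductive trigpol S : (G -> C) -> Prop :=
| trigpol0 : trigpol S (fun=> 0)
| trigpolS c a f : S a -> trigpol S f -> trigpol S (fun x => c * dchar x a + f x).

Lemma trigpolD S f g : trigpol S f -> trigpol S g -> trigpol S (fun x => f x + g x).
Proof.
move=> hf hg; elim: hf => [|c a h Sa _ IH].
  by under eq_fun do rewrite add0r.
under eq_fun do rewrite -addrA; exact: trigpolS.
Qed.

Lemma trigpolZ S c f : trigpol S f -> trigpol S (fun x => c * f x).
Proof.
elim=> [|d a h Sa _ IH]; first by under eq_fun do rewrite mulr0; exact: trigpol0.
under eq_fun do rewrite mulrDr mulrA; exact: trigpolS.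
Qed.

Lemma trigpol_dchar S c a : S a -> trigpol S (fun x => c * dchar x a).
Proof.
by move=> Sa; have := trigpolS c Sa (trigpol0 S); under eq_fun do rewrite addr0.
Qed.

Lemma trigpol_cst S c : S 0 -> trigpol S (fun=> c).
Proof.
by move=> S0; have := trigpol_dchar c S0; under eq_fun do rewrite dchar0 mulr1.
Qed.

Lemma trigpolM S T U f g : (forall a b, S a -> T b -> U (a + b)) ->
  trigpol S f -> trigpol T g -> trigpol U (fun x => f x * g x).
Proof.
move=> STU hf hg; elim: hf => [|c a h Sa _ IH].
  by under eq_fun do rewrite mul0r; exact: trigpol0.
under eq_fun do rewrite mulrDl; apply: trigpolD => //; elim: hg => [|d b k Tb _ IHk].
  by under eq_fun do rewrite mulr0; exact: trigpol0.
have := trigpolS (c * d) (STU _ _ Sa Tb) IHk; congr (trigpol _ _); apply/funext => x.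
by rewrite dchar_add; ring.
Qed.

Lemma trigpolX S f n : S 0 -> (forall a b, S a -> S b -> S (a + b)) ->
  trigpol S f -> trigpol S (fun x => f x ^+ n).
Proof.
move=> S0 SD hf; elim: n => [|n IH]; first exact: trigpol_cst.
by under eq_fun do rewrite exprS; exact: trigpolM hf IH.
Qed.

Lemma trigpol_sub S T f : S `<=` T -> trigpol S f -> trigpol T f.
Proof. by move=> ST; elim=> [|c a h Sa _ IH]; [exact: trigpol0|apply: trigpolS => //; exact: ST]. Qed.

Lemma trigpol_conj f : trigpol setT f -> trigpol setT (fun x => conjc (f x)).
Proof.
elim=> [|c a h Sa _ IH]; first by under eq_fun do rewrite conjc0; exact: trigpol0.
have := trigpolS (conjc c) (I : setT (- a)) IH; congr (trigpol _ _); apply/funext => x.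
by rewrite rmorphD rmorphM dcharN.
Qed.

Lemma trigpol_Re (P : set X) f : positive_cone P -> trigpol setT f ->
  exists2 u, trigpol P u & forall x, complex.Re (u x) = complex.Re (f x).
Proof.
move=> [_ _ Ptot]; elim=> [|c a h _ _ [u hu uh]]; first by exists (fun=> 0) => //; exact: trigpol0.
have [Pa|Pa] := Ptot a.
  exists (fun x => c * dchar x a + u x); first exact: trigpolS.
  by move=> x; rewrite !creD uh.
exists (fun x => conjc c * dchar x (- a) + u x); first exact: trigpolS.
by move=> x; rewrite !creD uh dcharN -rmorphM creJ.
Qed.

Lemma trigpol_bounded S f : trigpol S f -> exists2 B : R, 0 <= B & forall x, cabs (f x) <= B.
Proof.
elim=> [|c a h _ _ [B B0 hB]]; first by exists 0 => // x; rewrite cabs0.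
exists (cabs c + B); first by rewrite addr_ge0 ?cabs_ge0.
move=> x; apply: le_trans (cabsD _ _) _.
by rewrite cabsM dchar_abs mulr1 lerD.
Qed.

Lemma cmeas_trigpol S f : trigpol S f -> cmeasurable f.
Proof.
elim=> [|c a h _ _ IH]; first exact: cmeas_cst.
apply: cmeasD => //; apply: cmeasM; [exact: cmeas_cst|exact: cmeas_dchar].
Qed.

Lemma L2_trigpol (mu : probability (Gm X R) R) S f : trigpol S f -> L2 mu f.
Proof.
by elim=> [|c a h _ _ IH]; [exact: L2_cst|apply: L2D => //; apply: L2Z; exact: L2_dchar].
Qed.

Lemma trigpol_logser (s : G -> R) N : trigpol setT (fun x => (s x)%:C%C) ->
  trigpol setT (fun x => (logser N (s x) : R)%:C%C).
Proof.
move=> hf; elim: N => [|N IH].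
  have := @trigpol_cst setT 0 I; congr (trigpol _ _); apply/funext => x.
  by rewrite /logser big_ord0.
have := trigpolD IH (trigpolZ (N.+1%:R^-1)%:C%C (@trigpolX _ _ N.+1 I (fun _ _ _ _ => I) hf)).
congr (trigpol _ _); apply/funext => x.
by rewrite /logser big_ord_recr /= rmorphD rmorphM rmorphXn /= mulrC.
Qed.

(* [a] is nearly an outer function of modulus [sqrt |p|] and [b] is nearly its
   inverse: both are truncations of [exp (+- u)], where [2 Re u] is a polynomial
   approximation of [ln |p|] up to a constant. *)
Lemma approximate_outer (P : set X) p (e : R) : positive_cone P -> trigpol setT p ->
  0 < e <= 1 -> exists a b, [/\ trigpol P a, trigpol P b,
    forall x, cabs (a x * b x - 1) <= e,
    forall x, cabs (a x) ^+ 2 <= (1 + e) * (cabs (p x) + e) &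
    forall x, cabs (p x * b x) ^+ 2 <= (1 + e) * cabs (p x)].
Proof.
move=> hP hp /andP[e0 e1].
have [B B0 pB] := trigpol_bounded hp.
pose K := B ^+ 2 + e ^+ 2; have K0 : 0 < K by rewrite ltr_wpDl ?sqr_ge0 ?exprn_gt0.
pose s x := 1 - K^-1 * (cabs (p x) ^+ 2 + e ^+ 2).
pose s0 := 1 - K^-1 * e ^+ 2.
have sb x : 0 <= s x <= s0.
  have pb2 : cabs (p x) ^+ 2 <= B ^+ 2 by rewrite lerXn2r ?nnegrE ?cabs_ge0.
  have Ki : 0 < K^-1 by rewrite invr_gt0.
  rewrite /s /s0 subr_ge0 lerD2l lerN2 ler_pM2l// lerDr sqr_ge0 andbT.
  by rewrite ler_pdivrMl// mulr1 /K lerD2r.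
have s01 : 0 <= s0 < 1.
  apply/andP; split; first by have /andP[h1 h2] := sb (dual1 X R); exact: le_trans h1 h2.
  by rewrite /s0 ltrBlDr ltrDl mulr_gt0 ?invr_gt0 ?exprn_gt0.
have [s00 s0l1] := andP s01.
have [N hN] : exists N, s0 ^+ N / (1 - s0) <= e / 4.
  have c : s0 ^+ n @[n --> \oo] --> (0 : R) by apply: cvg_expr; rewrite ger0_norm.
  have d : 0 < e / 4 * (1 - s0) by rewrite mulr_gt0 ?divr_gt0 ?subr_gt0.
  have := cvgr0_norm_lt _ c _ d => -[N _ hN]; exists N.
  have := hN N (leqnn N); rewrite /= ger0_norm ?exprn_ge0// => /ltW.
  by rewrite -ler_pdivrMr ?subr_gt0.
have ps : trigpol setT (fun x => (s x)%:C%C).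
  have := trigpolD (@trigpol_cst setT 1 I) (trigpolZ (- K^-1)%:C%C (trigpolD
    (@trigpolM setT setT setT _ _ (fun _ _ _ _ => I) hp (trigpol_conj hp)) (@trigpol_cst setT (e ^+ 2)%:C%C I))).
  congr (trigpol _ _); apply/funext => x; rewrite /s mul_conjc.
  by apply: complex_ext => /=; ring.
have [u pu uE] := trigpol_Re hP (trigpolZ (- 4^-1)%:C%C (trigpol_logser N ps)).
have uRe x : complex.Re (u x) = - 4^-1 * logser N (s x).
  by rewrite uE -rmorphM.
have [U U0 uU] := trigpol_bounded pu.
have [m m0 hm] : exists2 m, (0 < m)%N & U ^+ 2 / m%:R <= e / 8.
  have [m hm] : exists m : nat, 8 * U ^+ 2 / e < m%:R.
    by exists (Num.truncn (8 * U ^+ 2 / e)).+1; exact: truncnS_gt.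
  exists m.+1 => //; rewrite ler_pdivrMr ?ltr0n//.
  have : 8 * U ^+ 2 / e <= m.+1%:R by apply: le_trans (ltW hm) _; rewrite ler_nat.
  by rewrite ler_pdivrMr//; lra.
have eU x : expR (cabs (u x) ^+ 2 / m%:R) <= 1 + e / 4.
  have mi : 0 <= (m%:R^-1 : R) by rewrite invr_ge0.
  have h : cabs (u x) ^+ 2 / m%:R <= e / 8.
    by apply: le_trans hm; rewrite ler_wpM2r// lerXn2r ?nnegrE ?cabs_ge0.
  have : expR (cabs (u x) ^+ 2 / m%:R) <= (1 - e / 8)^-1.
    by apply: le_trans (expR_le_inv _); [rewrite ler_expR|lra].
  move=> /le_trans; apply; rewrite -[leLHS]mul1r ler_pdivrMr; last lra.
  nra.
have mi : (0 : R) < m%:R by rewrite ltr0n.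
pose k := Num.sqrt K; have k0 : 0 < k by rewrite sqrtr_gt0.
have kK : k ^+ 2 = K by rewrite sqr_sqrtr// ltW.
pose c := Num.sqrt k; have c0 : 0 < c by rewrite sqrtr_gt0.
have ck : c ^+ 2 = k by rewrite sqr_sqrtr// ltW.
pose w x := Num.sqrt (cabs (p x) ^+ 2 + e ^+ 2).
have pe0 x : 0 < cabs (p x) ^+ 2 + e ^+ 2 by rewrite ltr_wpDl ?sqr_ge0 ?exprn_gt0.
have w0 x : 0 < w x by rewrite sqrtr_gt0.
have w2 x : w x ^+ 2 = cabs (p x) ^+ 2 + e ^+ 2 by rewrite sqr_sqrtr// ltW.
have pw x : cabs (p x) <= w x.
  by rewrite -(@ler_pXn2r _ 2)// ?nnegrE ?cabs_ge0 ?(ltW (w0 x))// w2 lerDl sqr_ge0.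
have wp x : w x <= cabs (p x) + e.
  have := cabs_ge0 (p x) => q0; rewrite -(@ler_pXn2r _ 2)// ?nnegrE ?addr_ge0 ?cabs_ge0 ?(ltW (w0 x)) ?(ltW e0)// w2.
  by move: (cabs _) q0 => q q0; nra.
pose E x := expR (logser N (s x) / 2); have E0 x : 0 < E x by exact: expR_gt0.
pose y x := E x * w x / k.
have y2 x : y x ^+ 2 = expR (logser N (s x)) * (1 - s x).
  have -> : expR (logser N (s x)) = E x ^+ 2 by rewrite expr2 -expRD -splitr.
  rewrite /y /s !exprMn w2 exprVn kK; have Kn : K != 0 by rewrite gt_eqF.
  by field.
have y0 x : 0 < y x by rewrite divr_gt0// mulr_gt0.
have yb x : 1 - e / 4 <= y x <= 1.
  have /andP[sx0 sx1] := sb x.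
  have sl1 : s x < 1 by exact: le_lt_trans sx1 s0l1.
  have [h1 h2] := @expR_logser_bounds R N (s x) (introT andP (conj sx0 sl1)).
  have h3 : s x ^+ N / (1 - s x) <= e / 4.
    have hA : s x ^+ N <= s0 ^+ N by rewrite lerXn2r ?nnegrE.
    have hB : (1 - s x)^-1 <= (1 - s0)^-1 by rewrite lef_pV2 ?posrE ?subr_gt0// lerD2l lerN2.
    apply: le_trans hN; apply: ler_pM => //; first exact: exprn_ge0.
    by rewrite invr_ge0 subr_ge0 ltW.
  have y1 : y x <= 1.
    by rewrite -(@ler_pXn2r _ 2)// ?nnegrE ?(ltW (y0 x))// y2 expr1n.
  rewrite y1 andbT; have : y x ^+ 2 <= y x by rewrite expr2 ler_piMr// ltW.
  by rewrite y2; lra.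
have yi x : (y x)^-1 <= (1 - e / 4)^-1.
  by have /andP[h _] := yb x; rewrite lef_pV2 ?posrE//; lra.
have P0 : P 0 by have [_ _ /(_ 0)[]//] := hP; rewrite oppr0.
have [PD _ _] := hP.
have pp v : trigpol P v -> trigpol P (fun x => (1 + (m%:R^-1)%:C%C * v x) ^+ m).
  by move=> hv; apply: trigpolX => //; apply: trigpolD; [exact: trigpol_cst|exact: trigpolZ].
exists (fun x => c%:C%C * (1 + (m%:R^-1)%:C%C * u x) ^+ m).
exists (fun x => (c^-1)%:C%C * (1 + (m%:R^-1)%:C%C * (- u x)) ^+ m).
split.
- by apply: trigpolZ; exact: pp.
- apply: trigpolZ; apply: (pp (fun x => - u x)).
  by have := trigpolZ (-1) pu; under eq_fun do rewrite mulN1r.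
- move=> x; rewrite mulrACA -rmorphM /= divff ?gt_eqF// mul1r.
  by apply: le_trans (cabs_1DX_mul_sub1 _ m0) _; have := eU x; lra.
- move=> x; rewrite cabsM cabsR (gtr0_norm c0) exprMn ck.
  have h := sqr_cabs_1DX_le (u x) m0.
  have eE : expR (2 * complex.Re (u x)) = (E x)^-1.
    by rewrite uRe -expRN; congr expR; field.
  rewrite eE in h.
  apply: (@le_trans _ _ (k * ((E x)^-1 * (1 + e / 4)))).
    rewrite ler_wpM2l ?(ltW k0)//; apply: le_trans h _.
    by rewrite ler_wpM2l// invr_ge0 ltW.
  have -> : k * ((E x)^-1 * (1 + e / 4)) = w x * (y x)^-1 * (1 + e / 4).
    by rewrite /y; field; rewrite !gt_eqF.
  apply: (@le_trans _ _ ((cabs (p x) + e) * (1 - e / 4)^-1 * (1 + e / 4))).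
    rewrite ler_wpM2r//; first lra.
    by apply: ler_pM; rewrite ?invr_ge0 ?(ltW (w0 x)) ?(ltW (y0 x)).
  rewrite [leRHS]mulrC -mulrA ler_wpM2l ?addr_ge0 ?cabs_ge0 ?(ltW e0)//.
  rewrite mulrC ler_pdivrMr; last lra.
  nra.
- move=> x; rewrite !cabsM cabsR (gtr0_norm (_ : 0 < c^-1)) ?invr_gt0// !exprMn exprVn ck.
  have h := sqr_cabs_1DX_le (- u x) m0.
  have eE : expR (2 * complex.Re (- u x)) = E x.
    by rewrite creN uRe; congr expR; field.
  rewrite eE cabsN in h.
  apply: (@le_trans _ _ (cabs (p x) ^+ 2 * (k^-1 * (E x * (1 + e / 4))))).
    rewrite ler_wpM2l ?sqr_ge0// ler_wpM2l ?invr_ge0 ?(ltW k0)//; apply: le_trans h _.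
    by rewrite ler_wpM2l// ltW.
  have -> : cabs (p x) ^+ 2 * (k^-1 * (E x * (1 + e / 4))) =
            (cabs (p x) * (cabs (p x) / w x)) * (y x * (1 + e / 4)).
    by rewrite /y; field; rewrite !gt_eqF.
  have h1 : cabs (p x) / w x <= 1 by rewrite ler_pdivrMr// mul1r.
  have h2 : y x * (1 + e / 4) <= 1 + e.
    have /andP[_ y1] := yb x; apply: (@le_trans _ _ (1 * (1 + e / 4))); last lra.
    by rewrite ler_wpM2r//; lra.
  rewrite [leRHS]mulrC; apply: ler_pM => //.
  + by rewrite mulr_ge0 ?cabs_ge0// divr_ge0 ?cabs_ge0 ?ltW.
  + by rewrite mulr_ge0 ?ltW//; lra.
  + by rewrite ler_piMr ?cabs_ge0.
Qed.

End TrigonometricPolynomials.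

(** * The Nehari theorem *)

Section NehariInequality.
Variables (X : zmodType) (R : realType) (mu : probability (Gm X R) R) (P : set X).
Hypothesis hP : positive_cone P.
Local Notation G := (Gm X R).
Local Notation C := (R[i]).
Local Notation P0 := (fun a => P a /\ a <> 0).

Lemma trigpol_strict (p b : G -> C) : trigpol P0 p -> trigpol P b -> trigpol P0 (fun x => p x * b x).
Proof.
have [PD PN _] := hP; apply: trigpolM => a d [Pa a0] Pd; split; first exact: PD.
move=> /eqP; rewrite addr_eq0 => /eqP ad; apply: a0; apply: PN => //.
by rewrite ad opprK.
Qed.

Lemma cint_trigpol_le (phi : G -> C) (c : R) : essbd mu phi 1 -> 0 <= c ->
  (forall u r, trigpol P u -> trigpol P0 r ->
     cabs (cint mu (fun x => phi x * (u x * r x))) ^+ 2 <= c ^+ 2 * (sqnorm mu u * sqnorm mu r)) ->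
  forall p, trigpol P0 p -> cabs (cint mu (fun x => phi x * p x)) <= c * rintegral mu (fun x => cabs (p x)).
Proof.
move=> hphi c0 H p hp; set I := rintegral mu _.
have Lp := L2_trigpol mu hp; have [mp intp] := L2_cL1 Lp.
have I0 : 0 <= I by apply: rintegral_ge0 => x; exact: cabs_ge0.
have key e : 0 < e <= 1 ->
    cabs (cint mu (fun x => phi x * p x)) <= c * ((1 + e) * (I + e)) + e * I.
  move=> he; have /andP[e0 e1] := he.
  have hp' : trigpol setT p by apply: trigpol_sub hp.
  have [a [b [ha hb h1 h2 h3]]] := approximate_outer hP hp' he.
  have [La Lb] := (L2_trigpol mu ha, L2_trigpol mu hb).
  have hpb := trigpol_strict hp hb; have Lpb := L2_trigpol mu hpb.
  have [Ba _ aB] := trigpol_bounded ha; have [Bb _ bB] := trigpol_bounded hb.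
  have m1 := cmeas_trigpol ha; have m2 := cmeas_trigpol hb; have [mphi phi1] := hphi.
  have L1 : cL1 mu (fun x => phi x * (a x * (p x * b x))).
    have Lphia := L2_essbdM hphi La.
    by have := L2M Lphia Lpb; under eq_fun do rewrite -mulrA.
  have Lphip : cL1 mu (fun x => phi x * p x) by exact/L2_cL1/(L2_essbdM hphi).
  have -> : (fun x => phi x * p x) =
      (fun x => phi x * (a x * (p x * b x)) + (phi x * p x - phi x * (a x * (p x * b x)))).
    by apply/funext => x; rewrite addrCA subrr addr0.
  have L3 := cL1B Lphip L1.
  rewrite cintD//; apply: le_trans (cabsD _ _) _; apply: lerD.
    have sq : 0 <= (1 + e) * (I + e) by rewrite mulr_ge0 ?addr_ge0 ?(ltW e0).
    rewrite -(@ler_pXn2r _ 2)// ?nnegrE ?cabs_ge0 ?(mulr_ge0 c0 sq)//.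
    apply: le_trans (H _ _ ha hpb) _; rewrite exprMn ler_wpM2l ?sqr_ge0//.
    rewrite expr2; apply: ler_pM; rewrite ?sqnorm_ge0//.
      have [_ ia] := La; have ie : rintegrable mu (fun x => cabs (p x) + e).
        by apply: rintegrableD => //; exact: rintegrable_cst.
      apply: le_trans (le_rintegral ia (rintegrableZ (1 + e) ie) h2) _.
      by rewrite rintegralZ// rintegralD ?rintegral_cst//; exact: rintegrable_cst.
    have [_ ipb] := Lpb; apply: le_trans (le_rintegral ipb (rintegrableZ (1 + e) intp) h3) _.
    by rewrite rintegralZ// ler_wpM2l ?lerDl// ?addr_ge0// ltW.
  apply: le_trans (cabs_cint L3) _; rewrite -rintegralZ//.
  apply: ae_le_rintegral; [by case: L3|exact: rintegrableZ|].
  apply: filterS phi1 => x px1.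
  have -> : phi x * p x - phi x * (a x * (p x * b x)) = phi x * p x * (- (a x * b x - 1)).
    by ring.
  rewrite !cabsM cabsN mulrC ler_pM ?mulr_ge0 ?cabs_ge0//.
  by rewrite ler_piMl ?cabs_ge0.
rewrite leNgt; apply/negP => lt.
pose d := cabs (cint mu (fun x => phi x * p x)) - c * I.
have d0 : 0 < d by rewrite subr_gt0.
pose D := c * (I + 2) + I + 1.
have D1 : 1 <= D by rewrite /D lerDr addr_ge0// mulr_ge0// addr_ge0.
pose e := Num.min 1 (d / (2 * D)).
have D0 : 0 < 2 * D by lra.
have e0 : 0 < e by rewrite lt_min ltr01 divr_gt0.
have e1 : e <= 1 by rewrite ge_min lexx.
have ed : e * (2 * D) <= d by rewrite -ler_pdivlMr// ge_min lexx orbT.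
have := key e (introT andP (conj e0 e1)).
have -> : cabs (cint mu (fun x => phi x * p x)) = d + c * I by rewrite subrK.
have : c * ((1 + e) * (I + e)) + e * I <= c * I + e * D.
  have : 0 <= c * e * (1 - e) by rewrite !mulr_ge0 ?subr_ge0// ltW.
  rewrite /D; nra.
have : 0 < e * D by rewrite mulr_gt0//; lra.
lra.
Qed.

End NehariInequality.

Section HahnBanach.
Variables (R : realType) (V : lmodType R) (W : set V) (q : V -> R).
Hypotheses (W0 : W 0) (WL : forall a x y, W x -> W y -> W (a *: x + y)).
Hypotheses (qD : forall x y, W x -> W y -> q (x + y) <= q x + q y)
  (qZ : forall a x, 0 <= a -> W x -> q (a *: x) = a * q x).
Implicit Types (S : set (V * R)) (x y v : V).

Definition lin_graph S : Prop :=
  (forall a p r, S p -> S r -> S (a *: p.1 + r.1, a * p.2 + r.2)) /\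
  (forall p, S p -> W p.1 /\ p.2 <= q p.1).

Let WZ a x : W x -> W (a *: x).
Proof. by move=> Wx; rewrite -[_ *: _]addr0; exact: WL. Qed.

Let WB x y : W x -> W y -> W (x - y).
Proof. by move=> Wx Wy; rewrite addrC -scaleN1r; exact: WL. Qed.

Let WD x y : W x -> W y -> W (x + y).
Proof. by move=> Wx Wy; rewrite -[x]scale1r; exact: WL. Qed.

Let q0 : q 0 = 0.
Proof. by rewrite -(scale0r (0 : V)) qZ// mul0r. Qed.

Lemma lin_graph_zero S p : lin_graph S -> S p -> S (0, 0).
Proof.
move=> [SL _] Sp; have := SL (-1) _ _ Sp Sp.
by rewrite scaleN1r addNr mulN1r addNr.
Qed.

Lemma lin_graph_fun S x s t : lin_graph S -> S (x, s) -> S (x, t) -> s = t.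
Proof.
move=> [SL Sq] Ss St.
have le u w : S (x, u) -> S (x, w) -> u <= w.
  move=> Su Sw; have [_] := Sq _ (SL (-1) _ _ Sw Su).
  by rewrite /= scaleN1r mulN1r addNr q0 addrC subr_le0.
by apply/eqP; rewrite eq_le !le.
Qed.

Lemma lin_graph_extend S v : lin_graph S -> S !=set0 -> W v ->
  exists S', [/\ lin_graph S', S `<=` S' & exists t, S' (v, t)].
Proof.
move=> hS [p0 Sp0] Wv; have [SL Sq] := hS; have S00 := lin_graph_zero hS Sp0.
have sep x s y t : S (x, s) -> S (y, t) -> s - q (x - v) <= q (y + v) - t.
  move=> Ss St; rewrite lerBrDr addrAC lerBlDr.
  have [_] := Sq _ (SL 1 _ _ Ss St); rewrite /= scale1r mul1r => /le_trans; apply.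
  have [[Wx _] [Wy _]] := (Sq _ Ss, Sq _ St).
  have -> : x + y = (y + v) + (x - v) by rewrite addrACA subrr addr0 addrC.
  by apply: qD; [exact: WD|exact: WB].
pose E := [set z | exists x s, S (x, s) /\ z = s - q (x - v)].
have E0 : E !=set0 by exists (0 - q (0 - v)); exists 0, 0.
have Eub : has_ubound E.
  by exists (q (0 + v) - 0) => _ [x [s [Ss ->]]]; exact: sep.
pose al := sup E.
have alo x s : S (x, s) -> s - q (x - v) <= al.
  by move=> Ss; apply: ub_le_sup => //; exists x, s.
have ahi y t : S (y, t) -> al <= q (y + v) - t.
  by move=> St; apply: ge_sup => // _ [x [s [Ss ->]]]; exact: sep.
exists [set p | exists x s l, S (x, s) /\ p = (x + l *: v, s + l * al)]; split.
- split.
  + move=> a _ _ [x [s [l [Ss ->]]]] [y [t [k [St ->]]]] /=.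
    exists (a *: x + y), (a * s + t), (a * l + k); split; first exact: (SL a _ _ Ss St).
    congr (_, _); last by ring.
    by rewrite scalerDr scalerDl scalerA addrACA.
  + move=> _ [x [s [l [Ss ->]]]] /=; have [Wx sq] := Sq _ Ss.
    split; first by rewrite addrC; exact: WL.
    have scal a : S (a *: x, a * s).
      by have := SL a _ _ Ss S00; rewrite /= !addr0.
    have [l0|l0|->] := ltrgt0P l; last by rewrite scale0r mul0r !addr0.
    * have := ahi _ _ (scal l^-1).
      have -> : x + l *: v = l *: (l^-1 *: x + v).
        by rewrite scalerDr scalerA divff ?gt_eqF// scale1r.
      rewrite qZ ?(ltW l0)//; last by apply: WD => //; exact: WZ.
      rewrite -(ler_pM2l l0) mulrBr mulrA divff ?gt_eqF// mul1r; lra.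
    * have k0 : 0 < - l by rewrite oppr_gt0.
      have := alo _ _ (scal (- l)^-1).
      have -> : x + l *: v = (- l) *: ((- l)^-1 *: x - v).
        by rewrite scalerBr scalerA divff ?gt_eqF// scale1r scaleNr opprK.
      rewrite qZ ?(ltW k0)//; last by apply: WB => //; exact: WZ.
      rewrite -(ler_pM2l k0) mulrBr mulrA divff ?gt_eqF// mul1r; lra.
- by move=> [x s] Ss; exists x, s, 0; rewrite scale0r mul0r !addr0.
- by exists al; exists 0, 0, 1; rewrite scale1r mul1r !add0r.
Qed.

Lemma hahn_banach (W1 : set V) (rho : V -> R) :
  W1 0 -> W1 `<=` W -> (forall a x y, W1 x -> W1 y -> W1 (a *: x + y)) ->
  (forall a x y, W1 x -> W1 y -> rho (a *: x + y) = a * rho x + rho y) ->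
  (forall x, W1 x -> rho x <= q x) ->
  exists rho' : V -> R, [/\ forall x, W1 x -> rho' x = rho x,
    forall a x y, W x -> W y -> rho' (a *: x + y) = a * rho' x + rho' y
    & forall x, W x -> rho' x <= q x].
Proof.
move=> W10 W1W W1L rhoL rhoq.
pose S1 := [set p | W1 p.1 /\ p.2 = rho p.1].
have hS1 : lin_graph S1.
  split=> [a [x s] [y t] [/= Wx sE] [/= Wy tE]|[x s] [/= Wx sE]].
    by split; [exact: W1L|rewrite /= sE tE rhoL].
  by split; [exact: W1W|rewrite sE; exact: rhoq].
have S10 : S1 !=set0 by exists (0, rho 0).
pose Q S := lin_graph S /\ (S !=set0 -> S1 `<=` S).
have [A [[hA Aa] Amax]] : exists A, Q A /\ (forall B, A `<` B -> ~ Q B).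
  apply: Zorn_bigcup => F FQ Ftot; split; last first.
    by move=> [p [S FS Sp]] r S1r; exists S => //; exact: (FQ _ FS).2 (ex_intro _ p Sp) _ S1r.
  split.
  - move=> a p r [S FS Sp] [S' FS' Sr].
    have [h|h] := Ftot _ _ FS FS'.
      by exists S' => //; have [[SL _] _] := FQ _ FS'; exact: SL (h _ Sp) Sr.
    by exists S => //; have [[SL _] _] := FQ _ FS; exact: SL Sp (h _ Sr).
  - by move=> p [S FS]; have [[_ h] _] := FQ _ FS; exact: h.
have A0 : A !=set0.
  apply/set0P/negP => /eqP A0; apply: (Amax S1); last by split => // _ p.
  by rewrite A0; split => //; have [p S1p] := S10; move=> /(_ _ S1p).
have Atot x : exists t, W x -> A (x, t).
  have [Wx|nWx] := pselect (W x); last by exists 0.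
  have [S' [hS' sub [t S'x]]] := lin_graph_extend hA A0 Wx.
  exists t => _; apply: contrapT => nA; apply: (Amax S').
    by split => // /(_ _ S'x).
  by split => // _; apply: subset_trans sub; exact: Aa.
have [rho' hrho] := choice Atot; exists rho'; split.
- move=> x W1x; apply: (lin_graph_fun hA (hrho x (W1W _ W1x))).
  exact: (Aa A0).
- move=> a x y Wx Wy; apply: (lin_graph_fun hA (hrho _ (WL _ Wx Wy))).
  by have [AL _] := hA; exact: (AL a _ _ (hrho _ Wx) (hrho _ Wy)).
- by move=> x Wx; have [_ /(_ _ (hrho _ Wx))[]] := hA.
Qed.

End HahnBanach.

Section DualityDistance.
Variables (X : zmodType) (R : realType) (mu : probability (Gm X R) R) (P : set X).
Hypotheses (hP : positive_cone P) (hmu : haar mu).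
Local Notation G := (Gm X R).
Local Notation C := (R[i]).
Local Notation P0 := (fun a => P a /\ a <> 0).
Local Notation V := (G -> Rcomplex R).
Local Notation fourier := (fourier mu).
Implicit Types f g p : G -> C.

Lemma scale_fctE (a : R) f g :
  (a *: (f : V) + (g : V)) = (fun x => a%:C%C * f x + g x) :> (G -> C).
Proof.
apply/funext => x; rewrite -[LHS]/((a *: (f x : Rcomplex R)) + (g x : Rcomplex R)).
by apply: complex_ext; case: (f x) (g x) => u v [u' v'] /=; ring.
Qed.

Lemma trigpol_lin S (a : R) f g : trigpol S f -> trigpol S g -> trigpol S (a *: (f : V) + (g : V)).
Proof. by move=> hf hg; rewrite scale_fctE; apply: trigpolD => //; exact: trigpolZ. Qed.

Lemma rintegral_cabs_le f : L2 mu f -> rintegral mu (fun x => cabs (f x)) ^+ 2 <= sqnorm mu f.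
Proof.
move=> hf; have := cauchy_schwarz hf (L2_cst mu 1).
have -> : sqnorm mu (fun=> 1) = 1.
  by rewrite -[RHS](rintegral_cst mu 1); apply: eq_rintegral => x; rewrite cabs1 expr1n.
rewrite mulr1; apply: le_trans; rewrite le_eqVlt; apply/orP; left; apply/eqP.
by congr (_ ^+ 2); apply: eq_rintegral => x; rewrite cabs1 mulr1.
Qed.

Lemma trigpol_trigsum (c : X -> C) s : trigpol setT (trigsum c s).
Proof.
elim: s => [|a s IH]; first by rewrite trigsum_nil; exact: trigpol0.
by rewrite trigsum_cons; exact: trigpolS.
Qed.

Lemma trigpol_dense f (e : R) : L2 mu f -> 0 < e ->
  exists2 p, trigpol setT p & sqnorm mu (fun x => f x - p x) <= e.
Proof.
move=> hf e0; have [|s us h] := @esum_approx_seq X R (fun a => cabs (fourier f a) ^+ 2) e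
    (fun=> sqr_ge0 _) e0.
  by rewrite -/(l2sq _) (l2sq_fourier hP hmu hf) ltry.
exists (trigsum (fourier f) s); first exact: trigpol_trigsum.
rewrite (sqnorm_sub_trigsum hP hmu hf us) lerBlDl.
by move: h; rewrite -/(l2sq _) (l2sq_fourier hP hmu hf) lee_fin.
Qed.

Section Extension.
Variables (rho : (G -> C) -> R) (c : R).
Hypotheses (c0 : 0 <= c)
  (rhoL : forall (a : R) f g, trigpol setT f -> trigpol setT g ->
     rho (fun x => a%:C%C * f x + g x) = a * rho f + rho g)
  (rhoc : forall f, trigpol setT f -> rho f <= c * rintegral mu (fun x => cabs (f x))).

Let coef a : C := Complex (rho (fun x => dchar x (- a)))
                          (- rho (fun x => 'i%C * dchar x (- a))).

Let trigpol_ch z a : trigpol setT (fun x : G => z * dchar x a).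
Proof. exact: trigpol_dchar. Qed.

Let rho0 : rho (fun=> 0) = 0.
Proof.
have z := @trigpol0 X R setT; have := rhoL (-1) z z; rewrite mulN1r addNr => <-; congr rho.
by apply/funext => x; rewrite mulr0 addr0.
Qed.

Let rhoD f g : trigpol setT f -> trigpol setT g -> rho (fun x => f x + g x) = rho f + rho g.
Proof.
move=> hf hg; rewrite -[rho f]mul1r -rhoL//; congr rho.
by apply/funext => x; rewrite mul1r.
Qed.

Let rho_ch z a : rho (fun x => z * dchar x a) = complex.Re (z * coef (- a)).
Proof.
have h1 := trigpol_ch 1 a; have hi := trigpol_ch 'i%C a.
have e1 : (fun x : G => 1 * dchar x a : C) = (fun x => dchar x a).
  by apply/funext => x; rewrite mul1r.
rewrite e1 in h1.
rewrite (_ : (fun x : G => z * dchar x a) = (fun x => (complex.Re z)%:C%C * dchar x a +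
   ((complex.Im z)%:C%C * ('i%C * dchar x a) + 0))); last first.
  apply/funext => x; rewrite addr0 mulrA -mulrDl; congr (_ * _).
  by case: z => u v; apply: complex_ext => /=; ring.
rewrite rhoL//; last first.
  have := trigpolZ (complex.Im z)%:C%C hi; by under eq_fun do rewrite -[_ * _]addr0.
rewrite rhoL//; last exact: (@trigpol0 X R setT).
by rewrite rho0 addr0 creM /coef /= opprK; ring.
Qed.

Lemma coef_l2 : (l2sq coef < +oo)%E.
Proof.
apply: (@le_lt_trans _ _ (c ^+ 2)%:E); last by rewrite ltry.
apply: esum_le_seq => [a|s us]; first exact: sqr_ge0.
rewrite lee_fin; set N := \sum_(a <- s) _.
have N0 : 0 <= N by apply: sumr_ge0 => a _; exact: sqr_ge0.
pose p x := conjc (trigsum coef s x : C).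
have hp : trigpol setT p by apply: trigpol_conj; exact: trigpol_trigsum.
have Lp := L2_trigpol mu hp.
have nnp : sqnorm mu p = N by rewrite sqnorm_J (sqnorm_trigsum hP hmu).
have rp : rho p = N.
  rewrite /p /N; elim: s {us N N0 p hp Lp nnp} => [|a s IH].
    by rewrite big_nil -rho0; congr rho; apply/funext => x; rewrite trigsum_nil conjc0.
  rewrite big_cons -IH (_ : (fun x => conjc (trigsum coef (a :: s) x)) =
    (fun x => conjc (coef a) * dchar x (- a) + conjc (trigsum coef s x))); last first.
    by apply/funext => x; rewrite trigsum_cons rmorphD rmorphM dcharN.
  rewrite rhoD ?rho_ch ?opprK//; last by apply: trigpol_conj; exact: trigpol_trigsum.
  by rewrite mulrC mul_conjc.
have h1 := rhoc hp; have h2 := rintegral_cabs_le Lp; rewrite rp in h1; rewrite nnp in h2.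
set I := rintegral mu _ in h1 h2.
have [->|Nn] := eqVneq N 0; first exact: sqr_ge0.
have Np : 0 < N by rewrite lt_neqAle eq_sym Nn.
have h3 : N ^+ 2 <= (c * I) ^+ 2.
  by rewrite lerXn2r ?nnegrE// (le_trans N0 h1).
rewrite -(ler_pM2r Np) -expr2; apply: le_trans h3 _.
by rewrite exprMn ler_wpM2l ?sqr_ge0.
Qed.

Lemma functional_density : exists u, essbd mu u c /\
  forall p, trigpol setT p -> rho p = complex.Re (cint mu (fun x => u x * p x)).
Proof.
have [u [Lu uc _]] := riesz_fischer hP hmu coef_l2.
have repr p : trigpol setT p -> rho p = complex.Re (cint mu (fun x => u x * p x)).
  elim=> [|z a f _ hf IH].
    by rewrite rho0; under eq_fun do rewrite mulr0; rewrite cint_cst.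
  have Lf := L2_trigpol mu hf; have La := L2_dchar mu a; have Lza := L2Z z La.
  rewrite rhoD// IH rho_ch -uc.
  rewrite (_ : (fun x => u x * (z * dchar x a + f x)) =
     (fun x => u x * (z * dchar x a) + u x * f x)); last first.
    by apply/funext => x; rewrite mulrDr.
  rewrite cintD; [|exact: L2M..].
  rewrite creD; congr (complex.Re _ + _).
  rewrite /Defs.fourier -cintZ; last exact/cL1_dchar/L2_cL1.
  by congr cint; apply/funext => x; rewrite dcharN conjcK; ring.
have bnd f : L2 mu f -> complex.Re (cint mu (fun x => u x * f x)) <= c * rintegral mu (fun x => cabs (f x)).
  move=> Lf; rewrite -subr_le0.
  set A := _ - _.
  have key e : 0 < e -> A <= (c + Num.sqrt (sqnorm mu u)) * e.
    move=> e0; have [p hp pe] := trigpol_dense Lf (exprn_gt0 2 e0).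
    have Lp := L2_trigpol mu hp; have Lfp := L2B Lf Lp.
    have h1 : complex.Re (cint mu (fun x => u x * f x)) =
        rho p + complex.Re (cint mu (fun x => u x * (f x - p x))).
      rewrite repr// -creD -cintD; [|exact: L2M..].
      by congr (complex.Re (cint _ _)); apply/funext => x; rewrite -mulrDr addrC subrK.
    have h2 := rhoc hp.
    have I1 : rintegral mu (fun x => cabs (f x - p x)) <= e.
      rewrite -(@ler_pXn2r _ 2)// ?nnegrE ?(ltW e0)//.
        by apply: le_trans (rintegral_cabs_le Lfp) _.
      by apply: rintegral_ge0 => x; exact: cabs_ge0.
    have h3 : rintegral mu (fun x => cabs (p x)) <= rintegral mu (fun x => cabs (f x)) + e.
      apply: le_trans (lerD (lexx _) I1).
      have [[_ i1] [_ i2] [_ i3]] := And3 (L2_cL1 Lp) (L2_cL1 Lf) (L2_cL1 Lfp).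
      rewrite -rintegralD//; apply: le_rintegral => //; first exact: rintegrableD.
      move=> x; rewrite addrC -[p x in leLHS](subKr (f x)) -[f x - (_ - _)]addrC.
      by apply: le_trans (cabsD _ _) _; rewrite cabsN addrC.
    have h4 : complex.Re (cint mu (fun x => u x * (f x - p x))) <= Num.sqrt (sqnorm mu u) * e.
      apply: le_trans (ler_norm _) _; apply: le_trans (Re_le_cabs _) _.
      have := inner_cauchy_schwarz Lu (L2J Lfp).
      rewrite (_ : inner mu u _ = cint mu (fun x => u x * (f x - p x))); last first.
        by congr cint; apply/funext => x; rewrite conjcK.
      rewrite sqnorm_J => h; rewrite -(@ler_pXn2r _ 2)// ?nnegrE ?cabs_ge0//.
        apply: le_trans h _; rewrite exprMn sqr_sqrtr ?sqnorm_ge0//.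
        by rewrite ler_wpM2l ?sqnorm_ge0.
      by rewrite mulr_ge0 ?sqrtr_ge0// ltW.
    rewrite /A h1; have := ler_wpM2l c0 h3; lra.
  rewrite leNgt; apply/negP => A0.
  pose D := c + Num.sqrt (sqnorm mu u) + 1.
  have D0 : 0 < D by rewrite ltr_wpDl// addr_ge0 ?sqrtr_ge0.
  have := key (A / D / 2) _; rewrite !divr_gt0// => /(_ isT).
  have : (D - 1) * (A / D / 2) = A / 2 - A / D / 2 by field; rewrite gt_eqF.
  have : 0 < A / D by rewrite divr_gt0.
  rewrite /D addrK; lra.
exists u; split => //; have [mu_ iu] := Lu; split => //.
pose A := [set x | c < cabs (u x)].
have mA : measurable A.
  have := @measurable_fun_ltr _ _ _ setT (fun=> c) (fun x => cabs (u x))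
    (measurable_cst _) (cmeas_cabs mu_).
  by move=> /(_ measurableT [set true] I); rewrite setTI.
have mI : measurable_fun setT (\1_A : G -> R) by exact: measurable_indic.
have i01 x : (\1_A x : R) = 0 \/ (\1_A x : R) = 1 by rewrite indicE; case: (_ \in _); [right|left].
pose f x := (\1_A x : R)%:C%C * conjc (u x).
have Lf : L2 mu f.
  apply: (L2_essbdM (M := 1)); last exact: L2J.
  split; first exact: cmeasR.
  by apply: aeW => x; rewrite cabsR; case: (i01 x) => ->; rewrite ?normr0 ?normr1.
have [_ iau] := L2_cL1 Lu; have Luf := L2M Lu Lf; have [_ if_] := L2_cL1 Lf.
pose g x := \1_A x * (cabs (u x) * (cabs (u x) - c)).
have gE x : g x = complex.Re (u x * f x) - c * cabs (f x).
  rewrite /g /f [u x * _]mulrCA mul_conjc cabsM cabsR cabs_conj.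
  by case: (i01 x) => ->; rewrite /= ?normr0 ?normr1; ring.
have ig : rintegrable mu g.
  by rewrite (funext gE); apply: rintegrableB; [exact: cL1_Re|exact: rintegrableZ].
have g0 x : 0 <= g x.
  rewrite /g indicE; have [|] := boolP (x \in A); last by rewrite mul0r.
  by rewrite inE /A /= => h; rewrite mul1r mulr_ge0 ?cabs_ge0// subr_ge0 ltW.
have Ig : rintegral mu g = 0.
  apply/eqP; rewrite eq_le rintegral_ge0// andbT (funext gE) rintegralB; [|exact: cL1_Re|exact: rintegrableZ].
  by rewrite rintegralZ// subr_le0; have := bnd _ Lf; rewrite Re_cint.
have : ae_eq mu setT (EFin \o g) (cst 0%E).
  apply/ae_eq_integral_abs => //; first by apply/measurable_EFinP; exact: rintegrable_meas ig.
  rewrite (_ : (fun x => _) = (fun x => (g x)%:E)); last first.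
    by apply/funext => x /=; rewrite ger0_norm.
  by rewrite -rintegral_EFin// Ig.
apply: filterS => x /(_ I) /= []; rewrite /g indicE leNgt => gx.
apply/negP => cu; move/eqP: gx; rewrite (mem_set (cu : A x)) mul1r mulf_eq0 subr_eq0.
by rewrite !gt_eqF// (le_lt_trans c0 cu).
Qed.

End Extension.

Lemma nehari (phi : G -> C) (c : R) : essbd mu phi 1 -> 0 <= c ->
  (forall p, trigpol P0 p -> cabs (cint mu (fun x => phi x * p x)) <= c * rintegral mu (fun x => cabs (p x))) ->
  exists2 h, Hinf mu P h & \forall x \ae mu, cabs (phi x - h x) <= c.
Proof.
move=> hphi c0 H.
pose rho0 (f : G -> C) := complex.Re (cint mu (fun x => phi x * f x)).
have cL S p : trigpol S p -> cL1 mu (fun x => phi x * p x).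
  by move=> hp; apply/L2_cL1/(L2_essbdM hphi)/(L2_trigpol mu hp).
have cA S p : trigpol S p -> rintegrable mu (fun x => cabs (p x)).
  by move=> hp; have [] := L2_cL1 (L2_trigpol mu hp).
pose q (f : V) : R := c * rintegral mu (fun x => cabs (f x)).
have z S : trigpol S (0 : V) by exact: trigpol0.
have qD (f g : V) : trigpol setT f -> trigpol setT g -> q (f + g) <= q f + q g.
  move=> hf hg; rewrite /q -mulrDr -rintegralD; [|exact: cA _ _ hf|exact: cA _ _ hg].
  rewrite ler_wpM2l//; apply: le_rintegral.
  - exact: cA _ _ (trigpolD hf hg).
  - by apply: rintegrableD; [exact: cA _ _ hf|exact: cA _ _ hg].
  - by move=> x; exact: cabsD.
have scaleE (a : R) (f : V) : a *: f = (fun x => a%:C%C * f x).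
  by rewrite -[LHS]addr0 scale_fctE; apply/funext => x; rewrite addr0.
have qZ (a : R) (f : V) : 0 <= a -> trigpol setT f -> q (a *: f) = a * q f.
  move=> a0 hf; rewrite /q mulrCA -(rintegralZ a (cA _ _ hf)).
  by congr (_ * _); apply: eq_rintegral => x; rewrite scaleE cabsM cabsR ger0_norm.
have rho0L (a : R) (f g : V) : trigpol P0 f -> trigpol P0 g ->
    rho0 (a *: f + g) = a * rho0 f + rho0 g.
  move=> hf hg; rewrite scale_fctE /rho0.
  have -> : (fun x => phi x * (a%:C%C * f x + g x)) =
      (fun x => a%:C%C * (phi x * f x) + phi x * g x).
    by apply/funext => x; ring.
  rewrite cintD; [|exact: cL1Z (cL _ _ hf)|exact: cL _ _ hg].
  by rewrite (cintZ _ (cL _ _ hf)) creD creM /= mul0r subr0.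
have rho0q (f : V) : trigpol P0 f -> rho0 f <= q f.
  move=> hf; apply: le_trans (H _ hf); apply: le_trans (ler_norm _) _.
  exact: Re_le_cabs.
have [rho [rhoE rhoL rhoq]] := @hahn_banach R V (fun f => trigpol setT f) q
  (z setT) (fun a f g => @trigpol_lin setT a f g) qD qZ (fun f => trigpol P0 f) rho0 (z P0)
  (fun f => @trigpol_sub _ _ P0 setT f (fun _ _ => I)) (fun a f g => @trigpol_lin P0 a f g) rho0L rho0q.
have [|f hf|u [[mu_ ub] uE]] := @functional_density rho c c0.
- by move=> a f g hf hg; rewrite -scale_fctE; exact: rhoL.
- exact: rhoq.
have cLu S p : trigpol S p -> cL1 mu (fun x => u x * p x).
  by move=> hp; apply/L2_cL1/(L2_essbdM (conj mu_ ub))/(L2_trigpol mu hp).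
have [mphi phi1] := hphi.
exists (fun x => phi x - u x); last first.
  by apply: filterS ub => x; rewrite opprB addrCA subrr addr0.
have bh := essbdB hphi (conj mu_ ub : essbd mu u c).
split; first by case: bh.
  apply: (@le_lt_trans _ _ (1 + c)%:E); last by rewrite ltry.
  by apply/ess_supP; apply: filterS bh.2 => x; rewrite lee_fin.
move=> a nPa.
have [PD PN Ptot] := hP.
have Pa : P (- a) /\ - a <> 0.
  have Pna : P (- a) by case: (Ptot a).
  split => // a0; apply: nPa; have aE : a = 0 by rewrite -[a]opprK a0 oppr0.
  by rewrite aE; move: Pna; rewrite a0.
have key w : complex.Re (cint mu (fun x => phi x * (w * dchar x (- a)))) =
    complex.Re (cint mu (fun x => u x * (w * dchar x (- a)))).
  have h1 := @trigpol_dchar X R P0 w _ Pa.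
  rewrite -uE; last exact: trigpol_sub h1.
  by rewrite rhoE.
have L2a w : cL1 mu (fun x => phi x * (w * dchar x (- a))).
  by apply: (cL P0); exact: trigpol_dchar.
have L2b w : cL1 mu (fun x => u x * (w * dchar x (- a))).
  by apply: (cLu P0); exact: trigpol_dchar.
have fE w : w * fourier (fun x => phi x - u x) a =
   cint mu (fun x => phi x * (w * dchar x (- a))) - cint mu (fun x => u x * (w * dchar x (- a))).
  rewrite -cintB// -cintZ; last by apply/cL1_dchar/L2_cL1/(essbd_L2 bh).
  by congr cint; apply/funext => x; rewrite dcharN; ring.
have r0 w : complex.Re (w * fourier (fun x => phi x - u x) a) = 0.
  by rewrite fE creD creN key subrr.
have := r0 1; have := r0 'i%C; rewrite mul1r.
by case: (fourier _ _) => s t /= h1 h2; apply: complex_ext => /=; lra.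
Qed.

End DualityDistance.

(** * Invertibility of Toeplitz operators with unimodular symbols *)

Section EssentialBounds.
Variables (X : zmodType) (R : realType) (mu : probability (Gm X R) R) (P : set X).
Local Notation G := (Gm X R).
Local Notation C := (R[i]).
Implicit Types f h : G -> C.

Lemma Linf_norm_lty f : cmeasurable f -> (Linf_norm mu f < +oo)%E -> exists M, essbd mu f M.
Proof.
move=> mf; have := ess_sup_ge mu (fun x => (cabs (f x))%:E); rewrite -/(Linf_norm mu f).
case: (Linf_norm mu f) => [r h _| |h _]//; last by exists 0; split => //; apply: filterS h.
by exists r; split => //; apply: filterS h => x; rewrite lee_fin.
Qed.

Lemma Linf_norm_le f (c : R) : (\forall x \ae mu, cabs (f x) <= c) -> (Linf_norm mu f <= c%:E)%E.
Proof. by move=> h; apply/ess_supP; apply: filterS h => x; rewrite lee_fin. Qed.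

Lemma Linf_norm_lt1P f : (Linf_norm mu f < 1)%E <->
  exists2 c : R, c < 1 & \forall x \ae mu, cabs (f x) <= c.
Proof.
split=> [|[c c1 h]]; last first.
  by apply: le_lt_trans (Linf_norm_le h) _; rewrite lte_fin.
have := ess_sup_ge mu (fun x => (cabs (f x))%:E); rewrite -/(Linf_norm mu f).
case: (Linf_norm mu f) => [r h r1| |h _]//; last by exists 0 => //; apply: filterS h.
by exists r => //; apply: filterS h => x; rewrite lee_fin.
Qed.

Lemma Hinf_hinf h : Hinf mu P h -> exists M, hinf mu P h M.
Proof. by move=> [mh /(Linf_norm_lty mh)[M bh] h0]; exists M. Qed.

Lemma hinf_Hinf h M : hinf mu P h M -> Hinf mu P h.
Proof.
move=> [[mh bh] h0]; split => //.
by apply: le_lt_trans (Linf_norm_le bh) _; rewrite ltry.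
Qed.

Lemma dist_Hinf_lt1P f : (dist_Hinf mu P f < 1)%E <->
  exists h, Hinf mu P h /\ exists2 c : R, c < 1 & \forall x \ae mu, cabs (f x - h x) <= c.
Proof.
split=> [/ereal_inf_lt[_ [h hh <-] /Linf_norm_lt1P[c c1 hc]]|[h [hh [c c1 hc]]]].
  by exists h; split => //; exists c.
have lt : (Linf_norm mu (fun x => (f x - h x)%R) < 1)%E by apply/Linf_norm_lt1P; exists c.
by apply: le_lt_trans lt; apply: ereal_inf_lbound; exists h.
Qed.

End EssentialBounds.

Section BoundedOperators.
Variables (X : zmodType) (R : realType) (P : set X).
Local Notation C := (R[i]).
Implicit Types A B : (X -> C) -> (X -> C).

Lemma bounded_op_ge0 A : bounded_op P A -> exists2 M : R, 0 <= M &
  forall g, l2plus P g -> (l2sq (A g) <= M%:E * l2sq g)%E.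
Proof.
move=> [_ _ [M hM]]; exists `|M| => // g hg; apply: le_trans (hM g hg) _.
rewrite lee_wpmul2r ?lee_fin ?ler_norm//.
by apply: esum_ge0 => a _; rewrite lee_fin sqr_ge0.
Qed.

Lemma bounded_op_comp A B : bounded_op P A -> bounded_op P B ->
  bounded_op P (fun g => A (B g)).
Proof.
move=> hA hB; have [M M0 hM] := bounded_op_ge0 hA; have [N N0 hN] := bounded_op_ge0 hB.
have [A1 A2 _] := hA; have [B1 B2 _] := hB; split.
- by move=> g hg; exact/A1/B1.
- by move=> c g h hg hh; rewrite B2// A2//; exact: B1.
- exists (M * N) => g hg; apply: le_trans (hM _ (B1 _ hg)) _.
  by rewrite EFinM -muleA lee_wpmul2l ?lee_fin// hN.
Qed.

End BoundedOperators.

Section UnimodularSymbols.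
Variables (X : zmodType) (R : realType) (mu : probability (Gm X R) R) (P : set X).
Hypotheses (hP : positive_cone P) (hmu : haar mu).
Local Notation G := (Gm X R).
Local Notation C := (R[i]).
Local Notation fourier := (fourier mu).
Local Notation essbd := (essbd mu).
Local Notation hinf := (hinf mu P).
Local Notation H2 := (H2 mu P).
Local Notation L2 := (L2 mu).
Local Notation sqnorm := (sqnorm mu).
Local Notation toep F := (Wk P (fourier F)).
Implicit Types (h f phi psi chi : G -> C).

Lemma fourier_trigpol S f a : trigpol S f -> ~ S a -> fourier f a = 0.
Proof.
move=> hf nSa; elim: hf => [|c b k Sb hk IH]; first exact: fourier0.
have Lb := L2_cL1 (L2_dchar mu b); have Lk := L2_cL1 (L2_trigpol mu hk).
rewrite fourierD//; last exact: cL1Z.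
rewrite fourierZ// IH (fourier_dchar b a hP hmu) addr0.
by have [E|] := eqVneq b a; [case: nSa; rewrite -E|rewrite mulr0].
Qed.

Definition unimod phi := cmeasurable phi /\ \forall x \ae mu, cabs (phi x) = 1.

Lemma unimod_essbd phi : unimod phi -> essbd phi 1.
Proof. by move=> [m h]; split => //; apply: filterS h => x ->. Qed.

Lemma unimodJ phi : unimod phi -> unimod (fun x => conjc (phi x)).
Proof. by move=> [m h]; split; [exact: cmeasJ|apply: filterS h => x; rewrite cabs_conj]. Qed.

Lemma sqnorm_unimod phi f : unimod phi -> L2 f -> sqnorm (fun x => phi x * f x) = sqnorm f.
Proof.
move=> [m h] [mf _]; apply: rintegral_ae; last 1 first.
- by apply: filterS h => x e; rewrite cabsM e mul1r.
- by apply: cmeas_sqr_cabs; exact: cmeasM.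
- exact: cmeas_sqr_cabs.
Qed.

Lemma toep_conj_mul_invertible phi psi N (c : R) : unimod phi -> essbd psi N -> c < 1 ->
  (\forall x \ae mu, cabs (phi x - psi x) <= c) ->
  invertible_op P (toep (fun x => conjc (psi x) * phi x)).
Proof.
move=> [m u] [mpsi _] c1 hc; apply: (toeplitz_invertible hP hmu c1).
  by apply: cmeasM => //; exact: cmeasJ.
split; first by apply: cmeasB; [exact: cmeas_cst|apply: cmeasM => //; exact: cmeasJ].
apply: filterS2 u hc => x u1; rewrite -(conjc_mul1 u1) -mulrBl -rmorphB.
by rewrite cabsM cabs_conj u1 mulr1.
Qed.

Lemma toep_left_invertible phi h N (c : R) : unimod phi -> hinf h N -> c < 1 ->
  (\forall x \ae mu, cabs (phi x - h x) <= c) -> left_invertible P (toep phi).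
Proof.
move=> hphi hh c1 hc; have bphi := unimod_essbd hphi; have [bh _] := hh.
have [_ [B [hB BT TB]]] := toep_conj_mul_invertible hphi bh c1 hc.
split; first exact: (bounded_Wk hP hmu bphi).
exists (fun g => B (toep (fun x => conjc (h x)) g)); split.
  exact: (bounded_op_comp hB (bounded_Wk hP hmu (essbdJ bh))).
by move=> g hg; rewrite (Wk_comp_coanalytic hP hmu bphi hh hg) BT.
Qed.

Lemma toep_right_invertible phi h N (c : R) : unimod phi -> hinf h N -> c < 1 ->
  (\forall x \ae mu, cabs (conjc (phi x) - h x) <= c) -> right_invertible P (toep phi).
Proof.
move=> hphi hh c1 hc; have bphi := unimod_essbd hphi; have [bh _] := hh.
have e : \forall x \ae mu, cabs (phi x - conjc (h x)) <= c.
  by apply: filterS hc => x; rewrite -[phi x in X in _ -> X]conjcK -rmorphB cabs_conj.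
have [_ [B [hB BT TB]]] := toep_conj_mul_invertible hphi (essbdJ bh) c1 e.
have eE : (fun x => conjc (conjc (h x)) * phi x) = (fun x => phi x * h x).
  by apply/funext => x; rewrite conjcK mulrC.
rewrite eE in BT TB.
split; first exact: (bounded_Wk hP hmu bphi).
have [B1 _ _] := hB.
exists (fun g => toep h (B g)); split.
  exact: (bounded_op_comp (bounded_Wk hP hmu bh) hB).
by move=> g hg; rewrite (Wk_comp_analytic hP hmu bphi hh (B1 _ hg)) TB.
Qed.

Definition toep_bounded_below phi (M : R) := forall f r, H2 f -> H2 r ->
  (forall a, P a -> fourier r a = fourier (fun x => phi x * f x) a) -> sqnorm f <= M * sqnorm r.

(* A lower bound for [T_phi] makes the Hankel operator of [phi] a strict
   contraction, as [|phi f|^2 = |T_phi f|^2 + |H_phi f|^2]. *)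
Lemma bounded_below_dist phi (M : R) : unimod phi -> toep_bounded_below phi M ->
  exists h, Hinf mu P h /\ exists2 c : R, c < 1 & \forall x \ae mu, cabs (phi x - h x) <= c.
Proof.
move=> hphi low; have bphi := unimod_essbd hphi.
pose M' := Num.max M 1; have M1 : 1 <= M' by rewrite le_max lexx orbT.
have M0 : 0 < M' by apply: lt_le_trans M1.
pose d := 1 - M'^-1.
have d0 : 0 <= d by rewrite subr_ge0 invf_le1.
have d1 : d < 1 by rewrite ltrBlDr ltrDl invr_gt0.
have c1 : Num.sqrt d < 1 by rewrite -sqrtr1 ltr_sqrt.
have [h hh hc] : exists2 h, Hinf mu P h & \forall x \ae mu, cabs (phi x - h x) <= Num.sqrt d.
  apply: (nehari hP hmu bphi) => //; apply: (cint_trigpol_le hP bphi) => //.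
  move=> u r hu hr; rewrite [Num.sqrt d ^+ 2]sqr_sqrtr//.
  have [Lu Lr] := (L2_trigpol mu hu, L2_trigpol mu hr).
  have Hu : H2 u by split => // a; exact: fourier_trigpol hu.
  have Lpu := L2_essbdM bphi Lu.
  have [s hs se] := H2_projection hP hmu Lpu; have [Ls _] := hs.
  have LrJ := L2J Lr.
  have -> : cint mu (fun x => phi x * (u x * r x)) =
      inner mu (fun x => phi x * u x - s x) (fun x => conjc (r x)).
    rewrite innerBl// (_ : inner mu s _ = 0) ?subr0.
      by congr cint; apply/funext => x; rewrite conjcK mulrA.
    apply: (inner_eq0 hP hmu Ls LrJ) => a.
    have [_ s0] := hs; have [Pa|nPa] := pselect (P a); last by rewrite s0// mul0r.
    rewrite fourier_conj; last exact: L2_cL1.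
    rewrite (fourier_trigpol hr) ?conjc0 ?mulr0// => -[PNa a0]; apply: a0.
    by have [_ PN _] := hP; rewrite (PN a Pa PNa) oppr0.
  apply: le_trans (inner_cauchy_schwarz (L2B Lpu Ls) LrJ) _.
  rewrite sqnorm_J mulrA ler_wpM2r ?sqnorm_ge0//.
  rewrite (sqnorm_sub_H2_projection hP hmu hs Lpu se) sqnorm_unimod// mulrBl mul1r lerD2l lerN2.
  rewrite ler_pdivrMl//; apply: le_trans (low _ _ Hu hs se) _.
  by rewrite ler_wpM2r ?sqnorm_ge0// le_max lexx.
by exists h; split => //; exists (Num.sqrt d).
Qed.

Lemma left_invertible_bounded_below phi : unimod phi -> left_invertible P (toep phi) ->
  exists M, toep_bounded_below phi M.
Proof.
move=> hphi [_ [L [hL LT]]]; have bphi := unimod_essbd hphi.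
have [M M0 hM] := bounded_op_ge0 hL; exists M => f r hf hr re.
have [[Lf _] [Lr _]] := (hf, hr).
have := hM _ (H2_l2plus hP hmu hr).
rewrite -(Wk_fourier hP hmu bphi Lf hr re) LT; last exact: H2_l2plus.
by rewrite (Wk_fourier hP hmu bphi Lf hr re) !(l2sq_fourier hP hmu).
Qed.

Lemma right_invertible_bounded_below phi : unimod phi -> right_invertible P (toep phi) ->
  exists M, toep_bounded_below (fun x => conjc (phi x)) M.
Proof.
move=> hphi [_ [B [hB TB]]]; have bphi := unimod_essbd hphi; have [B1 _ _] := hB.
have [M M0 hM] := bounded_op_ge0 hB; exists M => y s hy hs se.
have [[Ly _] [Ls _]] := (hy, hs); have ly := H2_l2plus hP hmu hy.
have [f hf Bf] := l2plus_H2 hP hmu (B1 _ ly); have [Lf _] := hf.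
have [r [hr re rE]] := Wk_fourierP hP hmu bphi Lf.
have yr : fourier y = fourier r by rewrite -rE -Bf TB.
have e : inner mu y y = inner mu f s.
  apply: (toeplitz_adjoint hP hmu bphi hf hy Ly Ls _ se) => a Pa.
  by rewrite yr re.
have nf : sqnorm f <= M * sqnorm y.
  by have := hM _ ly; rewrite Bf !(l2sq_fourier hP hmu).
have h1 := inner_cauchy_schwarz Lf Ls; rewrite -e inner_self// cabsR ger0_norm ?sqnorm_ge0// in h1.
have [->|yn] := eqVneq (sqnorm y) 0; first by rewrite mulr_ge0 ?sqnorm_ge0.
have yp : 0 < sqnorm y by rewrite lt_neqAle eq_sym yn sqnorm_ge0.
rewrite -(ler_pM2r yp) -expr2; apply: le_trans h1 _.
apply: (@le_trans _ _ (M * sqnorm y * sqnorm s)); first by rewrite ler_wpM2r ?sqnorm_ge0.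
by rewrite mulrAC.
Qed.

Lemma toep_invertible_of_Hinf_invertible phi psi (c : R) : unimod phi ->
  Hinf_invertible mu P psi -> c < 1 -> (\forall x \ae mu, cabs (phi x - psi x) <= c) ->
  invertible_op P (toep phi).
Proof.
move=> hphi [/Hinf_hinf[M hpsi] [chi [/Hinf_hinf[N hchi] inv]]] c1 hc.
have bphi := unimod_essbd hphi; have [[bpsi _] [bchi _]] := (hpsi, hchi).
have [bF [B [hB BT TB]]] := toep_conj_mul_invertible hphi bpsi c1 hc.
have [bT1 _ _] := bounded_Wk hP hmu (essbdJ bpsi); have [B1 _ _] := hB.
have bF' : essbd (fun x => conjc (psi x) * phi x) (M * 1) by apply: essbdM => //; exact: essbdJ.
have inv' x : psi x * chi x = 1 -> conjc (chi x) * conjc (psi x) = 1.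
  by move=> e; rewrite -rmorphM mulrC e rmorph1.
have [mphi _] := hphi; have [mpsi _] := essbdJ bpsi; have [mchi _] := essbdJ bchi.
have fac g : l2plus P g ->
    toep (fun x => conjc (chi x)) (toep (fun x => conjc (psi x) * phi x) g) = toep phi g.
  move=> hg; rewrite (Wk_comp_coanalytic hP hmu bF' hchi hg).
  rewrite (_ : fourier (fun x => conjc (chi x) * _) = fourier phi)//.
  apply/funext => a; apply: (fourier_ae _ (cmeasM mchi (cmeasM mpsi mphi)) mphi).
  by apply: filterS inv => x /inv' e; rewrite mulrA e mul1r.
have one g : l2plus P g -> toep (fun x => conjc (chi x)) (toep (fun x => conjc (psi x)) g) = g.
  move=> hg; rewrite (Wk_comp_coanalytic hP hmu (essbdJ bpsi) hchi hg).
  have [f hf ->] := l2plus_H2 hP hmu hg; have [Lf _] := hf; have [mf _] := Lf.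
  apply: (Wk_fourier hP hmu (essbdM (essbdJ bchi) (essbdJ bpsi)) Lf hf) => a _.
  apply: (fourier_ae _ mf (cmeasM (cmeasM mchi mpsi) mf)).
  by apply: filterS inv => x /inv' e; rewrite e mul1r.
split; first exact: (bounded_Wk hP hmu bphi).
exists (fun g => B (toep (fun x => conjc (psi x)) g)); split.
- exact: (bounded_op_comp hB (bounded_Wk hP hmu (essbdJ bpsi))).
- by move=> g hg; rewrite (Wk_comp_coanalytic hP hmu bphi hpsi hg) BT.
- move=> g hg; have hg' := bT1 _ hg; rewrite -fac; last exact: B1.
  by rewrite TB// one.
Qed.

Lemma Hinf_invertible_of_toep phi : unimod phi -> invertible_op P (toep phi) ->
  exists psi, Hinf_invertible mu P psi /\
    exists2 c : R, c < 1 & \forall x \ae mu, cabs (phi x - psi x) <= c.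
Proof.
move=> hphi [bT [B [hB BT TB]]]; have bphi := unimod_essbd hphi.
have [M low] := left_invertible_bounded_below hphi (conj bT (ex_intro _ B (conj hB BT))).
have [N lowJ] := right_invertible_bounded_below hphi (conj bT (ex_intro _ B (conj hB TB))).
have [h [hh [c c1 hc]]] := bounded_below_dist hphi low.
have [K hK] := Hinf_hinf hh; have [bh _] := hK.
exists h; split; last by exists c.
split => //.
have bJ := essbdJ bphi.
pose one : G -> C := fun=> 1.
have P0 : P 0 by have [_ _ /(_ 0)[]//] := hP; rewrite oppr0.
have Hone : H2 one.
  split; first exact: L2_cst.
  by move=> a nPa; apply: (@fourier_trigpol P) nPa; exact: trigpol_cst.
have [Lone _] := Hone.
have [s [hs se sE]] := Wk_fourierP hP hmu bJ Lone.
have e : \forall x \ae mu, cabs (conjc (phi x) - conjc (h x)) <= c.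
  by apply: filterS hc => x; rewrite -rmorphB cabs_conj.
have [_ [B' [hB' BT' TB']]] := toep_conj_mul_invertible (unimodJ hphi) (essbdJ bh) c1 e.
have eE : (fun x => conjc (conjc (h x)) * conjc (phi x)) = (fun x => conjc (phi x) * h x).
  by apply/funext => x; rewrite conjcK mulrC.
rewrite eE in BT' TB'.
have [B1' _ _] := hB'; have ls := H2_l2plus hP hmu hs.
have [g hg gE] := l2plus_H2 hP hmu (B1' _ ls); have [Lg g0] := hg.
have Hhg := H2_hinfM hP hmu hK hg; have [Lhg _] := Hhg.
have Hd : H2 (fun x => h x * g x - one x).
  have -> : (fun x => h x * g x - one x) = (fun x => h x * g x + (-1) * one x).
    by apply/funext => x; rewrite mulN1r.
  by apply: H2D => //; exact: H2Z.
have [Ld _] := Hd.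
have [t [ht te tE]] := Wk_fourierP hP hmu bJ Lhg; have [Lt _] := ht.
have ts : fourier t = fourier s.
  rewrite -tE -(Wk_hinf hP hmu hK hg) (Wk_comp_analytic hP hmu bJ hK); last exact: H2_l2plus.
  by rewrite -gE TB'.
have H0 : H2 (fun=> 0) by split; [exact: L2_cst|move=> a _; exact: fourier0].
have nd : sqnorm (fun x => h x * g x - one x) <= 0.
  have := lowJ _ _ Hd H0; rewrite (_ : sqnorm (fun=> 0) = 0) ?mulr0; last first.
    by rewrite -[RHS](rintegral_cst mu 0); apply: eq_rintegral => x; rewrite cabs0 expr0n.
  apply => a Pa; rewrite fourier0.
  have -> : (fun x => conjc (phi x) * (h x * g x - one x)) =
      (fun x => conjc (phi x) * (h x * g x) - conjc (phi x) * one x).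
    by apply/funext => x; rewrite mulrBr.
  rewrite fourierB; [|exact/L2_cL1/(L2_essbdM bJ)..].
  by rewrite -te// -se// ts subrr.
have hg1 : \forall x \ae mu, h x * g x = 1.
  have : null_coef mu (fun x => h x * g x - one x).
    split; first exact: L2_cL1.
    move=> a; apply: cabs0_eq0; apply/eqP; rewrite -sqrf_eq0 eq_le sqr_ge0 andbT.
    exact: le_trans (sqr_fourier_le a Ld) nd.
  by move=> /null_coef_ae0; apply: filterS => x /eqP; rewrite subr_eq0 => /eqP.
exists g; split => //; apply: (@hinf_Hinf _ _ _ _ _ (1 - c)^-1); split => //.
have [mg _] := Lg; split => //; have [_ u] := hphi.
apply: filterS3 hg1 hc u => x hgx hcx ux.
have c1' : 0 < 1 - c by rewrite subr_gt0.
have hx : 1 - c <= cabs (h x).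
  have := cabsD (phi x - h x) (h x); rewrite subrK ux; lra.
have : cabs (h x) * cabs (g x) = 1 by rewrite -cabsM hgx cabs1.
move=> hgc; rewrite -[leRHS]mul1r ler_pdivlMr//.
by apply: le_trans (ler_wpM2l (cabs_ge0 (g x)) hx) _; rewrite mulrC hgc.
Qed.

End UnimodularSymbols.

Theorem mainTheorem10 (R : realType) (X : zmodType) (P : set X)
    (mu : probability (Gm X R) R) (k : X -> R[i]) (kc : Gm X R -> R[i]) :
  positive_cone P ->
  haar mu ->
  (l2sq k < +oo)%E ->
  (* kc is \check k : measurable, in L^oo, |kc| = 1 a.e., with Fourier coefficients k *)
  cmeasurable kc ->
  (Linf_norm mu kc < +oo)%E ->
  (\forall x \ae mu, cabs (kc x) = 1) ->
  (forall xi, fourier mu kc xi = k xi) ->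
  ((left_invertible P (Wk P k) <-> (dist_Hinf mu P kc < 1)%E) /\
   (right_invertible P (Wk P k) <->
      (dist_Hinf mu P (fun x => conjc (kc x)) < 1)%E)) /\
  (invertible_op P (Wk P k) <->
     exists psi : Gm X R -> R[i],
       Hinf_invertible mu P psi /\ (Linf_norm mu (fun x => (kc x - psi x)%R) < 1)%E).
Proof.
move=> hP hmu _ mkc _ kc1 hk; have <- : fourier mu kc = k by exact/funext.
have u : unimod mu kc by [].
split; [split|]; split.
- move=> /(left_invertible_bounded_below hP hmu u)[M /(bounded_below_dist hP hmu u) h].
  exact/dist_Hinf_lt1P.
- move=> /dist_Hinf_lt1P[h [/Hinf_hinf[N hh] [c c1 hc]]].
  exact (toep_left_invertible hP hmu u hh c1 hc).
- move=> /(right_invertible_bounded_below hP hmu u)[M low].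
  exact/dist_Hinf_lt1P/(bounded_below_dist hP hmu (unimodJ u) low).
- move=> /dist_Hinf_lt1P[h [/Hinf_hinf[N hh] [c c1 hc]]].
  exact (toep_right_invertible hP hmu u hh c1 hc).
- move=> /(Hinf_invertible_of_toep hP hmu u)[psi [hpsi hc]].
  by exists psi; split => //; exact/Linf_norm_lt1P.
- move=> [psi [hpsi /Linf_norm_lt1P[c c1 hc]]].
  exact (toep_invertible_of_Hinf_invertible hP hmu u hpsi c1 hc).
Qed.
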